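(* Let $s\ge0$, $1\le p<\infty$ and $0<q\le\infty$. Then: (1) if $s>0$, there is no reverse Carleson measure for $HB_s^{p,q}$; (2) if $p\ge2$ and $q\ge p$, a finite positive Borel measure $\mu$ on $\overline{\mathbb{D}}$ is a reverse Carleson measure for $HB_0^{p,q}$ if and only if there is $c>0$ with $\mu(I)\ge c|I|$ for every arc $I\subset\partial\mathbb{D}$; (3) if $p\ge2$ and $q<p$, there is no reverse Carleson measure for $HB_0^{p,q}$; (4) if $p<2$ and $q\ge2$, $\mu$ is a reverse Carleson measure for $HB_0^{p,q}$ if and only if there is $c>0$ with $\mu(I)\ge c|I|$ for every arc $I\subset\partial\mathbb{D}$; (5) if $p<2$ and $q<2$, there is no reverse Carleson measure for $HB_0^{p,q}$.
   Context: For $0<p,q<\infty$, $s\ge0$ and an integer $m>s$, the holomorphic Besov space $HB_s^{p,q}$ consists of holomorphic $f$ on $\mathbb{D}$ with quasinorm $\|f\|_{HB_s^{p,q}}=\sum_{j=0}^{m-1}|f^{(j)}(0)|+\big(\int_0^1(\|f^{(m)}(re^{2\pi i\cdot})\|_{L^p(\mathbb{T})}(1-r)^{m-s-1/q})^q\,dr\big)^{1/q}<\infty$ (different admissible $m$ give equivalent quasinorms); for $q=\infty$ the integral is replaced by $\sup_{0<r<1}\|f^{(m)}(re^{2\pi i\cdot})\|_{L^p(\mathbb{T})}(1-r)^{m-s}$. A finite positive Borel measure $\mu$ on $\overline{\mathbb{D}}$ is a reverse Carleson measure for $HB_s^{p,q}$ if there is $C>0$ with $\|f\|_{HB_s^{p,q}}\le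 C\|f\|_{L^p(\overline{\mathbb{D}},\mu)}$ for all $f\in HB_s^{p,q}\cap C(\overline{\mathbb{D}})$. $|I|$ denotes normalized arc-length. *)

(* Defs.v *)
From HB Require Import structures.
From mathcomp Require Import all_boot all_order all_algebra.
From mathcomp Require Import all_classical all_reals all_analysis.
From mathcomp Require Import complex.
Import Order.TTheory GRing.Theory Num.Theory.
Import numFieldNormedType.Exports.
Local Open Scope classical_set_scope.
Local Open Scope ring_scope.

Set Implicit Arguments.
Unset Strict Implicit.
Unset Printing Implicit Defensive.

Definition openDisc (R : realType) : set R[i]^o := [set z | Normc.normc (z : R[i]) < 1].
Definition closedDisc (R : realType) : set R[i]^o := [set z | Normc.normc (z : R[i]) <= 1].

(* Identification of R^2 (carrying its Borel = product sigma-algebra) with C. *)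
Definition cplx_of (R : realType) (x : (R * R)%type) : R[i]^o := Complex x.1 x.2.
Definition closedDisc2 (R : realType) : set (R * R)%type :=
  [set x | Normc.normc (cplx_of x : R[i]) <= 1].

Definition holo (R : realType) (f : R[i]^o -> R[i]^o) : Prop :=
  forall z, @openDisc R z -> derivable f z 1.

Definition polar (R : realType) (r t : R) : R[i]^o :=
  Complex (r * cos (2 * pi * t)) (r * sin (2 * pi * t)).

Definition circ_Lp (R : realType) (p : R) (h : R[i]^o -> R[i]^o) (r : R) : R :=
  powR (fine (\int[lebesgue_measure]_(t in `[0%R, 1%R])
                 ((powR (Normc.normc (h (polar r t) : R[i])) p)%:E))%E) p^-1.

Definition besov_tail (R : realType) (s p : R) (q : \bar R) (m : nat)
    (f : R[i]^o -> R[i]^o) : \bar R :=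
  match q with
  | EFin q' =>
      ((\int[lebesgue_measure]_(r in `]0%R, 1%R[)
          ((powR (circ_Lp p (derive1n m f) r
                  * powR (1 - r) (m%:R - s - q'^-1)) q')%:E)) `^ q'^-1)%E
  | +oo%E =>
      ereal_sup [set ((circ_Lp p (derive1n m f) r * powR (1 - r) (m%:R - s))%:E)
                | r in `]0%R, 1%R[]
  | -oo%E => +oo%E
  end.

Definition besov_norm (R : realType) (s p : R) (q : \bar R) (m : nat)
    (f : R[i]^o -> R[i]^o) : \bar R :=
  ((\sum_(j < m) (Normc.normc (derive1n j f 0 : R[i]))%:E) + besov_tail s p q m f)%E.

Definition in_HB (R : realType) (s p : R) (q : \bar R) (m : nat)
    (f : R[i]^o -> R[i]^o) : Prop :=
  holo f /\ (besov_norm s p q m f < +oo)%E.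

Definition Lp_mu (R : realType) (p : R)
    (mu : {measure set (R * R)%type -> \bar R}) (f : R[i]^o -> R[i]^o) : \bar R :=
  ((\int[mu]_(x in @closedDisc2 R)
      ((powR (Normc.normc (f (cplx_of x) : R[i])) p)%:E)) `^ p^-1)%E.

Definition on_closed_disc (R : realType) (mu : {finite_measure set (R * R)%type -> \bar R})
  : Prop := mu (~` @closedDisc2 R) = 0%E.

Definition reverse_carleson (R : realType) (s p : R) (q : \bar R) (m : nat)
    (mu : {finite_measure set (R * R)%type -> \bar R}) : Prop :=
  exists C : R, 0 < C /\
    forall f : R[i]^o -> R[i]^o,
      in_HB s p q m f -> {within @closedDisc R, continuous f} ->
      (besov_norm s p q m f <= C%:E * Lp_mu p mu f)%E.

(* The closed arc { e^{2 pi i t} : a <= t <= a + l } of the unit circle;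
   its normalized arc-length is l (for 0 < l <= 1). *)
Definition arc (R : realType) (a l : R) : set (R * R)%type :=
  [set (cos (2 * pi * t), sin (2 * pi * t)) | t in `[a, a + l]].

Definition arc_condition (R : realType) (mu : {finite_measure set (R * R)%type -> \bar R})
  : Prop :=
  exists c : R, 0 < c /\
    forall a l : R, 0 < l <= 1 -> ((c * l)%:E <= mu (arc a l))%E.

(* Main.v *)
Require Import Defs.
From HB Require Import structures.
From mathcomp Require Import all_boot all_order all_algebra.
From mathcomp Require Import all_classical all_reals all_analysis.
From mathcomp Require Import measurable_realfun complex ring lra.
Import Order.TTheory GRing.Theory Num.Theory.
Import numFieldNormedType.Exports.
Local Open Scope classical_set_scope.
Local Open Scope ring_scope.
Set Implicit Arguments.
Unset Strict Implicit.
Unset Printing Implicit Defensive.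

(** Put [Q = max p 2].  A duality argument on circles, Jensen's inequality and integration over
    rotations show that the means [M(r)] of [|f|] in [L^p] over the circle of radius [r] satisfy
    [M(r + d) ^ Q >= M(r) ^ Q + (c d^m M_m(r)) ^ Q], with [M_m] the means of [f^(m)].  Along the
    radii [1 - 2^-k] this telescopes, so for [q >= Q] the [HB_0] quasinorm of [f] is at most a
    constant times its [L^p] norm on the circle, and a Riemann sum over disjoint short arcs bounds
    the latter by the [L^p(mu)] norm when [mu] charges all arcs.

    Conversely, for [N = 2^(K+1)] large, the derivative of order [m] of [z^N g] has modulus about
    [N^m |g|] when [1 - |z|] is about [1/N], whence a lower bound for its quasinorm.  With [g = 1]
    the factor [N^s] excludes [s > 0].  With [g(z) = ((1 + z)/2)^n] and its rotations, averaged
    over half an arc, one lets [N] and then [n] tend to infinity: the mass inside the disc and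
    off the arc disappears, leaving a lower bound for [mu] on the arc.  Finally, averaging over
    all rotations turns a reverse Carleson inequality into a bound of the [HB_0] quasinorm by the
    [L^p] norm on the circle; sums [z^(N_1) g_1 + ... + z^(N_n) g_n] violate it when [q < Q], where
    the [g_j] are peak functions at the [n]-th roots of unity if [Q = p], and [g_j = 1] if [Q = 2]. *)

(** * Integrals over segments *)

(** The exponent [Q] records two distinct losses. At a point [w] the gain is quadratic: the squared
    mean of |f| over a circle of radius [d] about [w] exceeds |f(w)|^2 by at least a constant times
    (d^m |f^(m)(w)|)^2. Integrated over [w] on a circle with the power p/2, this keeps the exponent
    2 when p < 2, but only the exponent p when p >= 2. Neither loss can be avoided: n distinct
    monomials have a sum of L^p norm at most n^(1/2) for p < 2, and n functions concentrated near
    distinct points one of order n^(1/p), while each of the n terms adds its share to the q-th power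
    of the tail.

    Lower bounds use only the tail of the quasinorm, which is the same for all rotations of a test
    function. The p-th power of the reverse Carleson inequality may therefore be integrated over an
    interval of rotations, and Tonelli's theorem moves this integral inside the one over the disc. A
    full period leaves radial means, so that [mu] enters only through its total mass; a short
    interval remembers a position on the circle, which is how arcs are detected. The test functions
    are polynomials, hence continuous up to the boundary and of finite quasinorm. *)

Definition rint (R : realType) (a b : R) (f : R -> R) : R :=
  \int[lebesgue_measure]_(x in `[a, b]) f x.

Section rint.
Context {R : realType}.
Implicit Types (a b c k M : R) (f g : R -> R).
Notation mu := (@lebesgue_measure R).

Lemma integrable_itv a b f : {within `[a, b], continuous f} ->
  mu.-integrable `[a, b] (EFin \o f).
Proof. by move=> cf; apply: continuous_compact_integrable => //; exact: segment_compact. Qed.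

Lemma eq_rint a b f g : (forall x, a <= x <= b -> f x = g x) ->
  rint a b f = rint a b g.
Proof.
by move=> fg; apply: eq_Rintegral => x; rewrite inE/= in_itv/= => /fg.
Qed.

Lemma rint_cst a b k : a <= b -> rint a b (fun=> k) = k * (b - a).
Proof.
move=> ab; rewrite /rint Rintegral_cst//= lebesgue_measure_itv/= lte_fin.
case: ltP => //= ba; have -> : b = a by apply/eqP; rewrite eq_le ba ab.
by rewrite subrr.
Qed.

Lemma rintD a b f g : {within `[a, b], continuous f} ->
  {within `[a, b], continuous g} ->
  rint a b (fun x => f x + g x) = rint a b f + rint a b g.
Proof. by move=> cf cg; apply: RintegralD => //; exact: integrable_itv. Qed.

Lemma rintB a b f g : {within `[a, b], continuous f} ->
  {within `[a, b], continuous g} ->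
  rint a b (fun x => f x - g x) = rint a b f - rint a b g.
Proof. by move=> cf cg; apply: RintegralB => //; exact: integrable_itv. Qed.

Lemma rintZ a b f k : {within `[a, b], continuous f} ->
  rint a b (fun x => k * f x) = k * rint a b f.
Proof. by move=> cf; apply: RintegralZl => //; exact: integrable_itv. Qed.

Lemma le_rint a b f g : {within `[a, b], continuous f} ->
  {within `[a, b], continuous g} ->
  (forall x, a <= x <= b -> f x <= g x) -> rint a b f <= rint a b g.
Proof.
by move=> cf cg fg; apply: le_Rintegral => //; exact: integrable_itv.
Qed.

Lemma rint_ge0 a b f : (forall x, a <= x <= b -> 0 <= f x) -> 0 <= rint a b f.
Proof. by move=> f0; apply: Rintegral_ge0 => x/=; rewrite in_itv => /f0. Qed.

Lemma rint_le_cst a b f M : a <= b -> {within `[a, b], continuous f} ->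
  (forall x, a <= x <= b -> f x <= M) -> rint a b f <= M * (b - a).
Proof.
move=> ab cf fM; rewrite -rint_cst//; apply: le_rint => //.
exact/continuous_subspaceT/cst_continuous.
Qed.

Lemma rint_norm_le a b f M : a <= b -> {within `[a, b], continuous f} ->
  (forall x, a <= x <= b -> `|f x| <= M) -> `|rint a b f| <= M * (b - a).
Proof.
move=> ab cf fM; rewrite ler_norml; apply/andP; split; last first.
  by apply: rint_le_cst => // x /fM; rewrite ler_norml => /andP[].
rewrite -mulNr -rint_cst//; apply: le_rint => //.
  exact/continuous_subspaceT/cst_continuous.
by move=> x /fM; rewrite ler_norml => /andP[].
Qed.

Lemma rint_cat a c b f : a <= c <= b -> {within `[a, b], continuous f} ->
  rint a b f = rint a c f + rint c b f.
Proof.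
move=> /andP[ac cb] cf; have := integrable_itv cf => fi.
apply/eqP; rewrite addrC -subr_eq; apply/eqP; rewrite /rint Rintegral_itvB//.
by rewrite Rintegral_itv_obnd_cbnd//; apply: integrableS fi => //;
   apply: subset_itvr; rewrite bnd_simp.
Qed.

Lemma rint_FTC a b (F f : R -> R) : a <= b ->
  (forall x, is_derive x (1 : R) F (f x)) -> continuous f ->
  rint a b f = F b - F a.
Proof.
rewrite le_eqVlt => /predU1P[->|ab] dF cf.
  by rewrite /rint set_itv1 Rintegral_set1 subrr.
have cF : continuous F.
  move=> x; apply: differentiable_continuous; apply/derivable1_diffP.
  by have [] := dF x.
rewrite /rint /Rintegral (@continuous_FTC2 _ f F)//.
- exact: continuous_subspaceT.
- split; first by move=> x _; have [] := dF x.
  + by apply: cvg_at_right_filter; exact: cF.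
  + by apply: cvg_at_left_filter; exact: cF.
- by move=> x _; rewrite derive1E; have [_ ->] := dF x.
Qed.

End rint.

(** * Goursat's theorem on a rectangle *)

Lemma continuous_pointP (R : realType) (f : R -> R) (x : R) :
  (forall eps : R, 0 < eps -> exists2 del : R, 0 < del &
     forall t, `|t - x| < del -> `|f t - f x| <= eps) ->
  {for x, continuous f}.
Proof.
move=> H; apply/cvgrPdist_le => eps /H[del del0 Hd].
near=> t; rewrite distrC; apply: Hd; near: t.
by apply: filterS (nbhsx_ballx x del del0) => t; rewrite /ball/= distrC.
Unshelve. all: by end_near. Qed.

Lemma dist_itv (R : realType) (u v x y : R) : u <= x <= v -> u <= y <= v ->
  `|x - y| <= v - u.
Proof.
by move=> /andP[? ?] /andP[? ?]; rewrite ler_norml; apply/andP; split; lra.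
Qed.

Section goursat.
Context {R : realType}.
Variables (U V : R -> R -> R) (A B C D : R).
Hypothesis AB : A <= B.
Hypothesis CD : C <= D.
(* [U + i V] is complex differentiable, with derivative [al + i be]. *)
Hypothesis dUV : forall x0 y0, A <= x0 <= B -> C <= y0 <= D ->
  exists al be, forall eps : R, 0 < eps -> exists2 del : R, 0 < del &
  forall x y, `|x - x0| < del -> `|y - y0| < del ->
    `|U x y - U x0 y0 - al * (x - x0) + be * (y - y0)| <=
      eps * (`|x - x0| + `|y - y0|) /\
    `|V x y - V x0 y0 - be * (x - x0) - al * (y - y0)| <=
      eps * (`|x - x0| + `|y - y0|).

(** The imaginary part of the counterclockwise contour integral of [U + i V] over the boundary of
    the rectangle. This part alone is what the comparison of circle means uses. *)
Let bdry a b c d := rint c d (fun y => U b y - U a y) -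
                    rint a b (fun x => V x d - V x c).

Let contU x0 y0 : A <= x0 <= B -> C <= y0 <= D -> {for y0, continuous (U x0)}.
Proof.
move=> /dUV h /h[al [be {}h]]; apply: continuous_pointP => eps eps0.
have [del del0 hd] := h 1 ltr01.
have k0 : 0 < 1 + `|be| by rewrite ltr_pwDl.
exists (Num.min del (eps / (1 + `|be|))); first by rewrite lt_min del0 divr_gt0.
move=> t; rewrite lt_min => /andP[t1 t2].
have [+ _] := hd x0 t (eq_ind_r (fun z => z < _) del0 (eq_ind_r (fun z => `|z| = 0) (normr0 _) (subrr x0))) t1.
rewrite subrr mulr0 subr0 normr0 add0r mul1r => h1.
have -> : U x0 t - U x0 y0 = (U x0 t - U x0 y0 + be * (t - y0)) - be * (t - y0) by ring.
rewrite (le_trans (ler_normB _ _))// normrM.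
rewrite (le_trans (lerD h1 (lexx _)))// -{1}[`|t - y0|]mul1r -mulrDl mulrC.
by rewrite -ler_pdivlMr// ltW.
Qed.

Let contV x0 y0 : A <= x0 <= B -> C <= y0 <= D -> {for x0, continuous (V ^~ y0)}.
Proof.
move=> /dUV h /h[al [be {}h]]; apply: continuous_pointP => eps eps0.
have [del del0 hd] := h 1 ltr01.
have k0 : 0 < 1 + `|be| by rewrite ltr_pwDl.
exists (Num.min del (eps / (1 + `|be|))); first by rewrite lt_min del0 divr_gt0.
move=> t; rewrite lt_min => /andP[t1 t2].
have [_] := hd t y0 t1 (eq_ind_r (fun z => z < _) del0 (eq_ind_r (fun z => `|z| = 0) (normr0 _) (subrr y0))).
rewrite subrr mulr0 subr0 normr0 addr0 mul1r => h1.
have -> : V t y0 - V x0 y0 = (V t y0 - V x0 y0 - be * (t - x0)) + be * (t - x0) by ring.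
rewrite (le_trans (ler_normD _ _))// normrM.
rewrite (le_trans (lerD h1 (lexx _)))// -{1}[`|t - x0|]mul1r -mulrDl mulrC.
by rewrite -ler_pdivlMr// ltW.
Qed.

Let contU_itv x0 c d : A <= x0 <= B -> C <= c -> d <= D ->
  {within `[c, d], continuous (U x0)}.
Proof.
move=> hx hc hd; apply: continuous_in_subspaceT => y.
rewrite inE/= in_itv/= => /andP[cy yd]; apply: contU => //.
by rewrite (le_trans hc cy) (le_trans yd hd).
Qed.

Let contV_itv y0 a b : C <= y0 <= D -> A <= a -> b <= B ->
  {within `[a, b], continuous (V ^~ y0)}.
Proof.
move=> hy ha hb; apply: continuous_in_subspaceT => x.
rewrite inE/= in_itv/= => /andP[ax xb]; apply: contV => //.
by rewrite (le_trans ha ax) (le_trans xb hb).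
Qed.

Let bdryE a b c d : A <= a <= b -> b <= B -> C <= c <= d -> d <= D ->
  bdry a b c d = rint c d (U b) - rint c d (U a) - rint a b (V ^~ d) + rint a b (V ^~ c).
Proof.
move=> /andP[Aa ab] bB /andP[Cc cd] dD; rewrite /bdry !rintB; first ring.
- by apply: contV_itv => //; rewrite dD (le_trans Cc).
- by apply: contV_itv => //; rewrite Cc (le_trans cd).
- by apply: contU_itv => //; rewrite bB (le_trans Aa).
- by apply: contU_itv => //; rewrite Aa (le_trans ab).
Qed.

Let bdry_catx a m b c d : A <= a <= m -> m <= b <= B -> C <= c <= d -> d <= D ->
  bdry a b c d = bdry a m c d + bdry m b c d.
Proof.
move=> /andP[Aa am] /andP[mb bB] /andP[Cc cd] dD.
have ab := le_trans am mb.
have mB := le_trans mb bB; have Am := le_trans Aa am.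
rewrite !bdryE ?Aa ?Cc ?am ?Am//.
rewrite (@rint_cat _ a m b (V ^~ c)) ?am ?mb//; last first.
  by apply: contV_itv => //; rewrite Cc (le_trans cd).
rewrite (@rint_cat _ a m b (V ^~ d)) ?am ?mb//; last first.
  by apply: contV_itv => //; rewrite dD (le_trans Cc).
ring.
Qed.

Let bdry_caty a b c m d : A <= a <= b -> b <= B -> C <= c <= m -> m <= d <= D ->
  bdry a b c d = bdry a b c m + bdry a b m d.
Proof.
move=> /andP[Aa ab] bB /andP[Cc cm] /andP[md dD].
have cd := le_trans cm md.
have mD := le_trans md dD; have Cm := le_trans Cc cm.
rewrite !bdryE ?Aa ?Cc ?cm ?Cm//.
rewrite (@rint_cat _ c m d (U a)) ?cm ?md//; last first.
  by apply: contU_itv => //; rewrite Aa (le_trans ab).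
rewrite (@rint_cat _ c m d (U b)) ?cm ?md//; last first.
  by apply: contU_itv => //; rewrite bB (le_trans Aa).
ring.
Qed.

(** Affine functions contribute nothing: across opposite sides the constant and [be] terms cancel,
    and the two [al] terms both integrate to [al (b - a) (d - c)]. The remaining error is at most
    [eps] times the half perimeter on each pair of sides, two corrections of [eps / 2] being
    subtracted from one another. *)
Let bdry_local x0 y0 : A <= x0 <= B -> C <= y0 <= D -> forall eps, 0 < eps ->
  exists2 del, 0 < del & forall a b c d, A <= a <= x0 -> x0 <= b <= B ->
    C <= c <= y0 -> y0 <= d <= D -> b - a < del -> d - c < del ->
    `|bdry a b c d| <= eps * (b - a + (d - c)) ^+ 2.
Proof.
move=> hx0 hy0 eps eps0; have [al [be h]] := dUV hx0 hy0.
have e20 : 0 < eps / 2 by rewrite divr_gt0.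
have [del del0 hd] := h _ e20; exists del => // a b c d.
move=> /andP[Aa ax] /andP[xb bB] /andP[Cc cy] /andP[yd dD] hab hcd.
have ab := le_trans ax xb; have cd := le_trans cy yd.
have -> : bdry a b c d = rint c d (fun y => U b y - U a y - al * (b - a)) -
     rint a b (fun x => V x d - V x c - al * (d - c)).
  have cst (k u v : R) : {within `[u, v], continuous (fun=> k : R)}.
    exact/continuous_subspaceT/cst_continuous.
  have E1 : rint c d (fun y => U b y - U a y - al * (b - a)) =
      rint c d (fun y => U b y - U a y) - al * (b - a) * (d - c).
    rewrite (@rintB _ c d (fun y => U b y - U a y) (fun=> al * (b - a))) ?rint_cst//.
    move=> z; apply: cvgB; [apply: contU_itv|apply: contU_itv] => //.
      by rewrite bB (le_trans Aa).
    by rewrite Aa (le_trans ab).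
  have E2 : rint a b (fun x => V x d - V x c - al * (d - c)) =
      rint a b (fun x => V x d - V x c) - al * (d - c) * (b - a).
    rewrite (@rintB _ a b (fun x => V x d - V x c) (fun=> al * (d - c))) ?rint_cst//.
    move=> z; apply: cvgB; [apply: contV_itv|apply: contV_itv] => //.
      by rewrite dD (le_trans Cc).
    by rewrite Cc (le_trans cd).
  by rewrite E1 E2 /bdry; ring.
rewrite (le_trans (ler_normB _ _))//.
set L := b - a + (d - c).
suff [h1 h2] : `|rint c d (fun y => U b y - U a y - al * (b - a))| <= eps * L * (d - c) /\
  `|rint a b (fun x => V x d - V x c - al * (d - c))| <= eps * L * (b - a).
  by apply: le_trans (lerD h1 h2) _; rewrite -mulrDr [_ + (b - a)]addrC -/L expr2 mulrA.
have cst (k u v : R) : {within `[u, v], continuous (fun=> k : R)}.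
  exact/continuous_subspaceT/cst_continuous.
have e2 x : eps / 2 * x + eps / 2 * x = eps * x by field.
split; apply: rint_norm_le => //.
- move=> z; apply: cvgB; last exact: cst; apply: cvgB; apply: contU_itv => //.
    by rewrite bB (le_trans Aa).
  by rewrite Aa (le_trans ab).
- move=> y /andP[cy' yd'].
  have hy : `|y - y0| <= d - c by apply: dist_itv; rewrite ?cy ?yd ?cy' ?yd'.
  have hb : `|b - x0| <= b - a by apply: dist_itv; rewrite ?lexx ?ab ?ax ?xb.
  have ha : `|a - x0| <= b - a by apply: dist_itv; rewrite ?lexx ?ab ?ax ?xb.
  have [h1 _] := hd b y (le_lt_trans hb hab) (le_lt_trans hy hcd).
  have [h2 _] := hd a y (le_lt_trans ha hab) (le_lt_trans hy hcd).
  have -> : U b y - U a y - al * (b - a) =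
   (U b y - U x0 y0 - al * (b - x0) + be * (y - y0)) -
   (U a y - U x0 y0 - al * (a - x0) + be * (y - y0)) by ring.
  rewrite (le_trans (ler_normB _ _))// -e2 lerD//.
    by apply: le_trans h1 _; rewrite ler_wpM2l ?(ltW e20)// lerD.
  by apply: le_trans h2 _; rewrite ler_wpM2l ?(ltW e20)// lerD.
- move=> z; apply: cvgB; last exact: cst; apply: cvgB; apply: contV_itv => //.
    by rewrite dD (le_trans Cc).
  by rewrite Cc (le_trans cd).
- move=> x /andP[ax' xb'].
  have hy : `|x - x0| <= b - a by apply: dist_itv; rewrite ?ax ?xb ?ax' ?xb'.
  have hb : `|d - y0| <= d - c by apply: dist_itv; rewrite ?lexx ?cd ?cy ?yd.
  have ha : `|c - y0| <= d - c by apply: dist_itv; rewrite ?lexx ?cd ?cy ?yd.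
  have [_ h1] := hd x d (le_lt_trans hy hab) (le_lt_trans hb hcd).
  have [_ h2] := hd x c (le_lt_trans hy hab) (le_lt_trans ha hcd).
  have -> : V x d - V x c - al * (d - c) =
   (V x d - V x0 y0 - be * (x - x0) - al * (d - y0)) -
   (V x c - V x0 y0 - be * (x - x0) - al * (c - y0)) by ring.
  rewrite (le_trans (ler_normB _ _))// -e2 lerD//.
    by apply: le_trans h1 _; rewrite ler_wpM2l ?(ltW e20)// lerD.
  by apply: le_trans h2 _; rewrite ler_wpM2l ?(ltW e20)// lerD.
Qed.

Let w n := (B - A) / 2 ^+ n.
Let h n := (D - C) / 2 ^+ n.

Let wS n : w n = w n.+1 + w n.+1.
Proof. by rewrite /w exprS; field; rewrite expf_neq0. Qed.
Let hS n : h n = h n.+1 + h n.+1.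
Proof. by rewrite /h exprS; field; rewrite expf_neq0. Qed.
Let w_ge0 n : 0 <= w n. Proof. by rewrite divr_ge0 ?exprn_ge0// subr_ge0. Qed.
Let h_ge0 n : 0 <= h n. Proof. by rewrite divr_ge0 ?exprn_ge0// subr_ge0. Qed.

(** A rectangle of generation [n] is encoded by its lower left corner [s], its sides being [w n] and
    [h n]; it retains at least the fraction [4 ^- n] of the original boundary term. *)
Let good n (s : R * R) M := [/\ A <= s.1, s.1 + w n <= B, C <= s.2, s.2 + h n <= D &
  M / 4 ^+ n <= `|bdry s.1 (s.1 + w n) s.2 (s.2 + h n)|].

(** The boundary terms of the four quarters add up to that of the rectangle, so one of them has at
    least a quarter of its modulus. *)
Let quarter n s M : good n s M -> exists s', [/\ good n.+1 s' M,
  s.1 <= s'.1 <= s.1 + w n.+1 & s.2 <= s'.2 <= s.2 + h n.+1].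
Proof.
case: s => a c [/= Aa aB Cc cD hM].
have w0 := w_ge0 n.+1; have h0 := h_ge0 n.+1.
rewrite wS !addrA in aB hM; rewrite hS !addrA in cD hM.
set a' := a + w n.+1 in aB hM *; set c' := c + h n.+1 in cD hM *.
have [aa' cc'] : a <= a' /\ c <= c' by rewrite !lerDl.
have [a1 c1] : a' <= a' + w n.+1 /\ c' <= c' + h n.+1 by rewrite !lerDl.
have Aa' : A <= a' by exact: le_trans aa'.
have Cc' : C <= c' by exact: le_trans cc'.
have a'B := le_trans a1 aB; have c'D := le_trans c1 cD.
rewrite (@bdry_catx _ a') ?Aa ?Cc ?a1 ?(le_trans cc' c1)// in hM.
rewrite (@bdry_caty a _ _ c') ?Aa ?Cc ?c1// in hM.
rewrite (@bdry_caty a' _ _ c') ?Aa' ?Cc ?c1// in hM.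
set b1 := bdry a a' c c' in hM; set b2 := bdry a a' c' _ in hM.
set b3 := bdry a' _ c c' in hM; set b4 := bdry a' _ c' _ in hM.
have {}hM : M / 4 ^+ n <= `|b1| + `|b2| + (`|b3| + `|b4|).
  apply: le_trans hM _; apply: le_trans (ler_normD _ _) _.
  by apply: lerD; exact: ler_normD.
have q : M / 4 ^+ n = M / 4 ^+ n.+1 + M / 4 ^+ n.+1 + (M / 4 ^+ n.+1 + M / 4 ^+ n.+1).
  by rewrite exprS; field; rewrite expf_neq0.
rewrite q in hM; set Q := M / 4 ^+ n.+1 in hM.
have : [\/ Q <= `|b1|, Q <= `|b2|, Q <= `|b3| | Q <= `|b4|].
  have [?|l1] := leP Q `|b1|; first by constructor 1.
  have [?|l2] := leP Q `|b2|; first by constructor 2.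
  have [?|l3] := leP Q `|b3|; first by constructor 3.
  have [?|l4] := leP Q `|b4|; first by constructor 4.
  have := lt_le_trans (ltrD (ltrD l1 l2) (ltrD l3 l4)) hM.
  by rewrite ltxx.
case=> hQ; [exists (a, c)|exists (a, c')|exists (a', c)|exists (a', c')];
  (split; [split => //=|rewrite /= ?lexx ?aa' ?lerDl//|rewrite /= ?lexx ?cc' ?lerDl//]).
Qed.

Lemma goursat_rect : rint C D (fun y => U B y - U A y) =
  rint A B (fun x => V x D - V x C).
Proof.
apply/eqP; rewrite -subr_eq0 -/(bdry A B C D); apply: contraT => nz.
set M := `|bdry A B C D|; have M0 : 0 < M by rewrite normr_gt0.
have good0 : good 0 (A, C) M.
  rewrite /good/= /w /h !expr0 !divr1 ![_ + (_ - _)]addrC !subrK.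
  by split.
(* Stated as an implication, the relation is total, so that a successor can be chosen for every pair
   at once. *)
pose P (x : nat * (R * R)) (y : R * R) := good x.1 x.2 M -> [/\ good x.1.+1 y M,
  x.2.1 <= y.1 <= x.2.1 + w x.1.+1 & x.2.2 <= y.2 <= x.2.2 + h x.1.+1].
have [nx nxP] : {f & forall x, P x (f x)}.
  apply: choice => -[n s]; rewrite /P/=.
  by have [/quarter[s' ?]|ng] := pselect (good n s M); [exists s'|exists s].
pose fix s n := if n is m.+1 then nx (m, s m) else (A, C).
have sg n : good n (s n) M.
  by elim: n => //= n ih; have [] := nxP (n, s n) ih.
have sS n : (s n).1 <= (s n.+1).1 <= (s n).1 + w n.+1 /\
            (s n).2 <= (s n.+1).2 <= (s n).2 + h n.+1.
  by have [] := nxP (n, s n) (sg n).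
have nested (u v : nat -> R) : (forall n, v n = v n.+1 + v n.+1) -> (forall n, 0 <= v n) ->
    (forall n, u n <= u n.+1 <= u n + v n.+1) ->
    exists x0, forall n, u n <= x0 <= u n + v n.
  move=> vS v0 uS.
  have umono : {homo u : i j / (i <= j)%N >-> i <= j}.
    by apply: homo_leq => [//|? ? ?|i]; [exact: le_trans|have /andP[] := uS i].
  have vdec n m : u (n + m)%N + v (n + m)%N <= u n + v n.
    elim: m => [|m ih]; first by rewrite addn0.
    rewrite addnS; apply: le_trans ih.
    have /andP[_ h2] := uS (n + m)%N.
    by rewrite [X in _ <= _ + X]vS addrA lerD.
  have ub n m : u m <= u n + v n.
    case: (leqP n m) => [nm|/ltnW mn].
      by have := vdec n (m - n)%N; rewrite subnKC//; apply: le_trans; rewrite lerDl.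
    by rewrite (le_trans (umono _ _ mn))// lerDl.
  have hs : has_sup (range u).
    split; first by exists (u 0%N); exists 0%N.
    by exists (u 0%N + v 0%N) => _ [m _ <-].
  exists (sup (range u)) => n; apply/andP; split.
    by apply: ub_le_sup; [case: hs|exists n].
  by apply: ge_sup; [case: hs|move=> _ [m _ <-]].
have [x0 hx0] := nested _ _ wS w_ge0 (fun n => (sS n).1).
have [y0 hy0] := nested _ _ hS h_ge0 (fun n => (sS n).2).
have hxAB : A <= x0 <= B.
  have := hx0 0%N; rewrite /= /w expr0 divr1.
  by have -> : A + (B - A) = B by ring.
have hyCD : C <= y0 <= D.
  have := hy0 0%N; rewrite /= /h expr0 divr1.
  by have -> : C + (D - C) = D by ring.
pose L := (B - A) + (D - C).
have L0 : 0 <= L by rewrite addr_ge0 ?subr_ge0.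
(* With this value the local estimate is less than half of [M / 4 ^+ n], whatever the half perimeter
   [L]. *)
have eps0 : 0 < M / (2 * (L ^+ 2 + 1)).
  by rewrite divr_gt0// mulr_gt0// ltr_wpDl// exprn_ge0.
have [del del0 hd] := bdry_local hxAB hyCD eps0.
have [n hn] : exists n, L / 2 ^+ n < del.
  exists (Num.truncn (L / del)).+1.
  rewrite ltr_pdivrMr ?exprn_gt0// mulrC -ltr_pdivrMr//.
  rewrite (lt_le_trans (truncnS_gt _))// -natrX ler_nat.
  exact/ltnW/ltn_expl.
have [g1 g2 g3 g4] := sg n.
have /andP[x1 x2] := hx0 n; have /andP[y1 y2] := hy0 n.
have := hd (s n).1 ((s n).1 + w n) (s n).2 ((s n).2 + h n).
have ww : w n + h n = L / 2 ^+ n by rewrite /w /h -mulrDl.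
rewrite g1 g2 g3 g4 x1 x2 y1 y2 ![_ + _ - _]addrC !addKr.
have lw : w n < del by apply: le_lt_trans hn; rewrite -ww lerDl.
have lh : h n < del by apply: le_lt_trans hn; rewrite -ww lerDr.
move=> /(_ isT isT isT isT lw lh) le1 le2; have := le_trans le2 le1.
have e4 : (2 ^+ n : R) ^+ 2 = 4 ^+ n.
  by rewrite -exprM mulnC exprM; congr (_ ^+ n); rewrite -natrX.
rewrite ww expr_div_n e4 mulrA ler_pM2r ?invr_gt0 ?exprn_gt0// mulrAC ler_pdivlMr; last first.
  by rewrite mulr_gt0// ltr_wpDl// exprn_ge0.
rewrite ler_pM2l// => k.
have : 0 <= L ^+ 2 by rewrite exprn_ge0.
by lra.
Qed.

End goursat.

(** * Complex differentiability *)

Section cbasic.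
Context {R : realType}.
Local Notation C := (R[i]).
Local Notation nc := (@Normc.normc R).
Local Notation Re := (@complex.Re R).
Local Notation Im := (@complex.Im R).
Local Notation "x %:C" := (Complex x 0) : ring_scope.
Implicit Types (z w c d : C) (f g : C -> C).

Lemma ncE z : nc z = Num.sqrt (Re z ^+ 2 + Im z ^+ 2).
Proof. by case: z. Qed.

Lemma nc_sqr z : nc z ^+ 2 = Re z ^+ 2 + Im z ^+ 2.
Proof. by rewrite ncE sqr_sqrtr// addr_ge0 ?sqr_ge0. Qed.

Lemma nc_ge0 z : 0 <= nc z. Proof. by rewrite ncE sqrtr_ge0. Qed.

Lemma ncM z w : nc (z * w) = nc z * nc w.
Proof. exact: Normc.normcM. Qed.

Lemma ncD z w : nc (z + w) <= nc z + nc w.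
Proof. exact: le_normcD. Qed.

Lemma ncN z : nc (- z) = nc z.
Proof. by case: z => a b; rewrite !ncE/= !sqrrN. Qed.

Lemma ncB z w : nc (z - w) <= nc z + nc w.
Proof. by rewrite -(ncN w); exact: ncD. Qed.

Lemma nc_distC z w : nc (z - w) = nc (w - z).
Proof. by rewrite -ncN opprB. Qed.

Lemma nc0 : nc 0 = 0. Proof. exact: Normc.normc0. Qed.
Lemma nc1 : nc 1 = 1. Proof. exact: Normc.normc1. Qed.

Lemma nc_eq0 z : nc z = 0 -> z = 0. Proof. exact: Normc.eq0_normc. Qed.

Lemma nc_gt0 z : z != 0 -> 0 < nc z.
Proof. by move=> z0; rewrite lt_def nc_ge0 andbT; apply: contra z0 => /eqP/nc_eq0 ->. Qed.

Lemma ncV z : nc z^-1 = (nc z)^-1. Proof. exact: Normc.normcV. Qed.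

Lemma ncX z n : nc (z ^+ n) = nc z ^+ n.
Proof. by elim: n => [|n ih]; rewrite ?expr0 ?nc1// !exprS ncM ih. Qed.

Lemma nc_real (x : R) : nc (x%:C) = `|x|.
Proof. by rewrite ncE/= expr0n addr0 sqrtr_sqr. Qed.

Lemma normRe_le z : `|Re z| <= nc z.
Proof. by rewrite ncE -sqrtr_sqr ler_wsqrtr// lerDl sqr_ge0. Qed.

Lemma normIm_le z : `|Im z| <= nc z.
Proof. by rewrite ncE -sqrtr_sqr ler_wsqrtr// lerDr sqr_ge0. Qed.

Lemma Re_le_nc z : Re z <= nc z.
Proof. by rewrite (le_trans (ler_norm _))// normRe_le. Qed.

Lemma nc_le z : nc z <= `|Re z| + `|Im z|.
Proof.
rewrite ncE -[leRHS]ger0_norm ?addr_ge0// -sqrtr_sqr ler_wsqrtr//.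
rewrite sqrrD !real_normK ?num_real// -addrA [_ *+ 2 + _]addrC addrA lerDl.
by rewrite mulrn_wge0// mulr_ge0.
Qed.

Lemma ncB_ge z w : nc z - nc w <= nc (z - w).
Proof. by rewrite lerBlDr -{1}(subrK w z) ncD. Qed.

Lemma nc_dist_le z w : `|nc z - nc w| <= nc (z - w).
Proof. rewrite ler_norml ncB_ge andbT lerNl opprB nc_distC; exact: ncB_ge. Qed.

Lemma cReD z w : Re (z + w) = Re z + Re w. Proof. by case: z; case: w. Qed.
Lemma cReN z : Re (- z) = - Re z. Proof. by case: z. Qed.
Lemma cReB z w : Re (z - w) = Re z - Re w. Proof. by rewrite cReD cReN. Qed.
Lemma cReM z w : Re (z * w) = Re z * Re w - Im z * Im w. Proof. by case: z; case: w. Qed.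
Lemma cImD z w : Im (z + w) = Im z + Im w. Proof. by case: z; case: w. Qed.
Lemma cImN z : Im (- z) = - Im z. Proof. by case: z. Qed.
Lemma cImB z w : Im (z - w) = Im z - Im w. Proof. by rewrite cImD cImN. Qed.
Lemma cImM z w : Im (z * w) = Re z * Im w + Im z * Re w. Proof. by case: z; case: w. Qed.
Lemma cReZ (x : R) z : Re (x%:C * z) = x * Re z.
Proof. by rewrite cReM/= mul0r subr0. Qed.

Lemma nc_rot z : exists2 c, nc c = 1 & c * z = (nc z)%:C.
Proof.
have [->|z0] := eqVneq z 0; first by exists 1; rewrite ?nc1// mulr0 nc0.
exists ((nc z)%:C / z).
  rewrite ncM ncV nc_real ger0_norm ?nc_ge0// divff//.
  by rewrite gt_eqF// nc_gt0.
by rewrite divfK.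
Qed.

(** The neighbourhood is not punctured, so [clim p z d] includes [p z = d]: it is continuity at [z]
    with value [d]. *)
Definition clim (p : C -> C) z d := forall eps : R, 0 < eps ->
  exists2 del : R, 0 < del & forall w, nc (w - z) < del -> nc (p w - d) <= eps.

Lemma clim_bound p z d : clim p z d -> exists2 M, 0 < M &
  exists2 del : R, 0 < del & forall w, nc (w - z) < del -> nc (p w) <= M.
Proof.
move=> /(_ 1 ltr01)[del d0 h]; exists (1 + nc d).
  by rewrite ltr_pwDl// nc_ge0.
exists del => // w /h hw; rewrite -(subrK d (p w)).
by rewrite (le_trans (ncD _ _))// lerD.
Qed.

Lemma climD p q z d e : clim p z d -> clim q z e -> clim (fun w => p w + q w) z (d + e).
Proof.
move=> hp hq eps e0; have e20 : 0 < eps / 2 by rewrite divr_gt0.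
have [d1 d10 h1] := hp _ e20; have [d2 d20 h2] := hq _ e20.
exists (Num.min d1 d2); first by rewrite lt_min d10.
move=> w; rewrite lt_min => /andP[/h1 k1 /h2 k2].
rewrite opprD addrACA (le_trans (ncD _ _))// (le_trans (lerD k1 k2))//.
by rewrite -splitr.
Qed.

Lemma climM p q z d e : clim p z d -> clim q z e -> clim (fun w => p w * q w) z (d * e).
Proof.
move=> hp hq eps e0; have e20 : 0 < eps / 2 by rewrite divr_gt0.
have [M M0 [d3 d30 h3]] := clim_bound hq.
have k0 : 0 < 1 + nc d by rewrite ltr_pwDl// nc_ge0.
have [d1 d10 h1] := hp _ (divr_gt0 e20 M0).
have [d2 d20 h2] := hq _ (divr_gt0 e20 k0).
exists (Num.min (Num.min d1 d2) d3); first by rewrite !lt_min d10 d20.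
move=> w; rewrite !lt_min => /andP[/andP[/h1 k1 /h2 k2] /h3 k3].
have -> : p w * q w - d * e = (p w - d) * q w + d * (q w - e) by ring.
rewrite (le_trans (ncD _ _))// !ncM (splitr eps) lerD//.
  by rewrite -[leRHS](divfK (lt0r_neq0 M0)) ler_pM ?nc_ge0.
rewrite -[leRHS](divfK (lt0r_neq0 k0)) mulrC ler_pM ?nc_ge0//.
by rewrite lerDr.
Qed.

Lemma clim_cst c z : clim (fun=> c) z c.
Proof. by move=> eps e0; exists 1 => // w _; rewrite subrr nc0 ltW. Qed.

Lemma clim_id z : clim id z z.
Proof. by move=> eps e0; exists eps => // w /ltW. Qed.

Lemma climV p z d : d != 0 -> clim p z d -> clim (fun w => (p w)^-1) z d^-1.
Proof.
move=> d0 hp eps e0; have n0 := nc_gt0 d0.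
have n20 : 0 < nc d / 2 by rewrite divr_gt0.
have [d1 d10 h1] := hp _ n20.
have [d2 d20 h2] := hp _ (mulr_gt0 e0 (mulr_gt0 n20 n0)).
exists (Num.min d1 d2); first by rewrite lt_min d10.
move=> w; rewrite lt_min => /andP[/h1 k1 /h2 k2].
have k3 : nc d / 2 <= nc (p w).
  have := ncB_ge d (d - p w); rewrite subKr nc_distC; lra.
have pw0 : p w != 0.
  by apply/eqP => E; move: k3; rewrite E nc0 leNgt n20.
have -> : (p w)^-1 - d^-1 = (d - p w) / (p w * d) by field; rewrite pw0 d0.
rewrite ncM ncV ncM nc_distC ler_pdivrMr ?mulr_gt0 ?nc_gt0//.
by apply: le_trans k2 _; rewrite ler_pM2l// ler_pM2r.
Qed.

Definition cdiff f z d := forall eps : R, 0 < eps ->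
  exists2 del : R, 0 < del & forall w, nc (w - z) < del ->
    nc (f w - f z - d * (w - z)) <= eps * nc (w - z).

(** Carathéodory's form of differentiability: the difference quotient extends continuously to [z].
    It reduces the product, inverse and chain rules to the algebra of limits. *)
Lemma cdiffP f z d : cdiff f z d <-> exists p, [/\ clim p z d &
  exists2 del : R, 0 < del & forall w, nc (w - z) < del -> f w - f z = p w * (w - z)].
Proof.
split=> [h|[p [hp [d1 d10 h1]]] eps e0]; last first.
  have [d2 d20 h2] := hp _ e0; exists (Num.min d1 d2); first by rewrite lt_min d10.
  move=> w; rewrite lt_min => /andP[/h1 -> /h2 k].
  by rewrite -mulrBl ncM ler_wpM2r// nc_ge0.
exists (fun w => if w == z then d else (f w - f z) / (w - z)); split.
  move=> eps /[dup] e0 /h [del d0 hd]; exists del => // w /hd.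
  case: ifPn => [/eqP -> _|wz h1]; first by rewrite !subrr nc0 ltW.
  have w0 : w - z != 0 by rewrite subr_eq0.
  move: h1.
  have -> : (f w - f z) / (w - z) - d = (f w - f z - d * (w - z)) / (w - z).
    by rewrite [in RHS]mulrBl mulfK.
  by rewrite ncM ncV ler_pdivrMr ?nc_gt0.
exists 1 => // w _; case: ifPn => [/eqP ->|wz]; first by rewrite !subrr mulr0.
by rewrite divfK// subr_eq0.
Qed.

Lemma cdiff_clim f z d : cdiff f z d -> clim f z (f z).
Proof.
move=> /cdiffP[p [hp [d1 d10 h1]]] eps e0.
have [M M0 [d2 d20 h2]] := clim_bound hp.
exists (Num.min (Num.min d1 d2) (eps / M)); first by rewrite !lt_min d10 d20 divr_gt0.
move=> w; rewrite !lt_min => /andP[/andP[/h1 -> /h2 k2]] /ltW k3.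
by rewrite ncM -[leRHS](divfK (lt0r_neq0 M0)) mulrC ler_pM ?nc_ge0.
Qed.

Lemma cdiff_ext f g z d : (exists2 del : R, 0 < del &
  forall w, nc (w - z) < del -> f w = g w) -> cdiff f z d -> cdiff g z d.
Proof.
move=> [d1 d10 h1] h eps /h [d2 d20 h2].
exists (Num.min d1 d2); first by rewrite !lt_min d10 d20.
move=> w; rewrite !lt_min => /andP[k1 k2]; rewrite -(h1 _ k1) -(h1 z) ?subrr ?nc0//.
exact: h2.
Qed.

Lemma cdiff_cst c z : cdiff (fun=> c) z 0.
Proof.
move=> eps e0; exists 1 => // w _.
by rewrite subrr mul0r subr0 nc0 mulr_ge0 ?nc_ge0// ltW.
Qed.

Lemma cdiff_id z : cdiff id z 1.
Proof.
move=> eps e0; exists 1 => // w _.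
by rewrite mul1r subrr nc0 mulr_ge0 ?nc_ge0// ltW.
Qed.

Lemma cdiffD f g z d e : cdiff f z d -> cdiff g z e ->
  cdiff (fun w => f w + g w) z (d + e).
Proof.
move=> /cdiffP[p [hp [d1 d10 h1]]] /cdiffP[q [hq [d2 d20 h2]]].
apply/cdiffP; exists (fun w => p w + q w); split; first exact: climD.
exists (Num.min d1 d2); first by rewrite !lt_min d10 d20.
move=> w; rewrite !lt_min => /andP[/h1 k1 /h2 k2].
by rewrite opprD addrACA k1 k2 mulrDl.
Qed.

Lemma cdiffM f g z d e : cdiff f z d -> cdiff g z e ->
  cdiff (fun w => f w * g w) z (d * g z + f z * e).
Proof.
move=> hf hg; have cg := cdiff_clim hg; move: hf hg.
move=> /cdiffP[p [hp [d1 d10 h1]]] /cdiffP[q [hq [d2 d20 h2]]].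
apply/cdiffP; exists (fun w => p w * g w + f z * q w); split.
  by apply: climD; apply: climM => //; exact: clim_cst.
exists (Num.min d1 d2); first by rewrite !lt_min d10 d20.
move=> w; rewrite !lt_min => /andP[/h1 k1 /h2 k2].
have -> : f w * g w - f z * g z = (f w - f z) * g w + f z * (g w - g z) by ring.
by rewrite k1 k2; ring.
Qed.

Lemma cdiffZ c f z d : cdiff f z d -> cdiff (fun w => c * f w) z (c * d).
Proof.
move=> /(cdiffM (cdiff_cst c z)); rewrite mul0r add0r; exact.
Qed.

Lemma cdiffB f g z d e : cdiff f z d -> cdiff g z e ->
  cdiff (fun w => f w - g w) z (d - e).
Proof.
move=> hf /(cdiffZ (-1)) hg; have := cdiffD hf hg; rewrite mulN1r.
by apply: cdiff_ext; exists 1 => // w _; rewrite mulN1r.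
Qed.

Lemma cdiffX f z d n : cdiff f z d ->
  cdiff (fun w => f w ^+ n.+1) z (n.+1%:R * f z ^+ n * d).
Proof.
move=> hf; elim: n => [|n ih].
  rewrite expr0 mul1r mul1r; apply: cdiff_ext hf.
  by exists 1 => // w _; rewrite expr1.
have := cdiffM hf ih.
have -> : d * f z ^+ n.+1 + f z * (n.+1%:R * f z ^+ n * d) = n.+2%:R * f z ^+ n.+1 * d.
  by rewrite exprS -[in RHS]natr1; ring.
by apply: cdiff_ext; exists 1 => // w _; rewrite -exprS.
Qed.

Lemma cdiffV f z d : f z != 0 -> cdiff f z d ->
  cdiff (fun w => (f w)^-1) z (- d / (f z) ^+ 2).
Proof.
move=> fz0 hf; have cf := cdiff_clim hf.
have [p [hp [d1 d10 h1]]] := (cdiffP f z d).1 hf.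
have [d2 d20 h2] := cf _ (divr_gt0 (nc_gt0 fz0) (ltr0Sn R 1)).
apply/cdiffP; exists (fun w => - 1 * p w * ((f w)^-1 * (f z)^-1)); split.
  have -> : - d / f z ^+ 2 = - 1 * d * ((f z)^-1 * (f z)^-1).
    by rewrite expr2 invfM mulN1r.
  do 2! (apply: climM; last by (try (apply: climM; last exact: clim_cst)); try exact: climV).
  exact: clim_cst.
exists (Num.min d1 d2); first by rewrite !lt_min d10 d20.
move=> w; rewrite !lt_min => /andP[/h1 k1 /h2 k2].
have fw0 : f w != 0.
  apply/eqP => E; move: k2; rewrite E sub0r ncN leNgt.
  by rewrite ltr_pdivrMr ?nc_gt0// mulrDr mulr1 ltrDl nc_gt0.
have -> : - 1 * p w * ((f w)^-1 / f z) * (w - z) = - 1 * (p w * (w - z)) * ((f w)^-1 / f z) by ring.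
by rewrite -k1; field; rewrite fw0 fz0.
Qed.

End cbasic.

Lemma is_derive_eps (R : realType) (f : R -> R) (x d : R) :
  is_derive x (1 : R) f d -> forall eps : R, 0 < eps -> exists2 del : R, 0 < del &
    forall t, `|t - x| < del -> `|f t - f x - d * (t - x)| <= eps * `|t - x|.
Proof.
move=> [df dE] eps e0.
have /cvgrPdist_le/(_ _ e0) : (h^-1 *: ((f \o shift x) (h *: (1 : R)) - f x) @[h --> 0^']) --> d.
  by rewrite -dE; exact: df.
move=> /nbhs_ballP[del /= d0 hd]; exists del => // t tx.
have [->|tx0] := eqVneq t x; first by rewrite !subrr mulr0 subr0 normr0 mulr0.
have tx0' : t - x != 0 by rewrite subr_eq0.
have := hd (t - x); rewrite /ball/= sub0r normrN => /(_ tx tx0').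
rewrite /shift/= /GRing.scale/= mulr1 subrK => h.
have -> : f t - f x - d * (t - x) = - ((d - (t - x)^-1 * (f t - f x)) * (t - x)) by field.
by rewrite normrN normrM ler_wpM2r.
Qed.

Lemma eps_is_derive (R : realType) (f : R -> R) (x d : R) :
  (forall eps : R, 0 < eps -> exists2 del : R, 0 < del &
    forall t, `|t - x| < del -> `|f t - f x - d * (t - x)| <= eps * `|t - x|) ->
  is_derive x (1 : R) f d.
Proof.
move=> h.
have dF : (h^-1 *: ((f \o shift x) (h *: (1 : R)) - f x) @[h --> 0^']) --> d.
  apply/cvgrPdist_le => eps /h [del d0 hd].
  apply/nbhs_ballP; exists del => //= t; rewrite /ball/= sub0r normrN => td t0.
  have := hd (t + x); rewrite addrK => /(_ td).
  rewrite /shift/= /GRing.scale/= mulr1.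
  have -> : f (t + x) - f x - d * t = - ((d - t^-1 * (f (t + x) - f x)) * t) by field.
  by rewrite normrN normrM ler_pM2r// normr_gt0.
apply: DeriveDef; first by apply/cvg_ex; exists d.
exact: cvg_lim dF.
Qed.

(** * The complex exponential and the parametrization of the unit circle *)

Section cexp.
Context {R : realType}.
Local Notation C := (R[i]).
Local Notation nc := (@Normc.normc R).
Local Notation Re := (@complex.Re R).
Local Notation Im := (@complex.Im R).
Local Notation "x %:C" := (Complex x 0) : ring_scope.
Implicit Types (z w c d : C) (f g : C -> C).

Lemma cdiff_comp f g z d e : cdiff g z e -> cdiff f (g z) d ->
  cdiff (f \o g) z (d * e).
Proof.
move=> hg; have cg := cdiff_clim hg.
move: hg => /cdiffP[q [hq [d1 d10 h1]]] /cdiffP[p [hp [d2 d20 h2]]].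
have [d3 d30 h3] := cg _ (divr_gt0 d20 (ltr0Sn R 1)).
apply/cdiffP; exists (fun w => p (g w) * q w); split.
  apply: climM => // eps /hp [d4 d40 h4].
  have [d5 d50 h5] := cg _ (divr_gt0 d40 (ltr0Sn R 1)).
  exists d5 => // w /h5 k; apply: h4; apply: le_lt_trans k _.
  by rewrite ltr_pdivrMr// mulrDr mulr1 ltrDl.
exists (Num.min d1 d3); first by rewrite lt_min d10.
move=> w; rewrite lt_min => /andP[/h1 k1 /h3 k3].
rewrite /= h2 ?k1 ?mulrA// -k1; apply: le_lt_trans k3 _.
by rewrite ltr_pdivrMr// mulrDr mulr1 ltrDl.
Qed.

Definition cexp z : C := (expR (Re z))%:C * Complex (cos (Im z)) (sin (Im z)).

Lemma cexpD z w : cexp (z + w) = cexp z * cexp w.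
Proof.
case: z => a b; case: w => c d; rewrite /cexp/=.
apply/eqP; rewrite eq_complex/=; apply/andP; split; apply/eqP.
  by rewrite expRD cosD; ring.
by rewrite expRD sinD; ring.
Qed.

Lemma nc_cexp z : nc (cexp z) = expR (Re z).
Proof.
rewrite ncM nc_real ger0_norm ?expR_ge0// ncE/= cos2Dsin2 sqrtr1 mulr1//.
Qed.

Lemma cexp0 : cexp 0 = 1.
Proof. by rewrite /cexp/= expR0 cos0 sin0 mul1r. Qed.

(** Only the derivatives of [expR], [cos] and [sin] at 0 enter here; the functional equation [cexpD]
    transports the result to all other points. *)
Lemma cdiff_cexp0 : cdiff cexp 0 1.
Proof.
move=> eps e0; have e40 : 0 < eps / 8 by rewrite divr_gt0.
have [d1 d10 h1] := is_derive_eps (is_derive_expR (0 : R)) e40.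
have [d2 d20 h2] := is_derive_eps (is_derive_cos (0 : R)) e40.
have [d3 d30 h3] := is_derive_eps (is_derive_sin (0 : R)) e40.
have [d4 d40 h4] := is_derive_eps (is_derive_expR (0 : R)) ltr01.
exists (Num.min (Num.min (Num.min d1 d2) (Num.min d3 d4)) (Num.min (eps / 8) 4^-1)).
  by rewrite !lt_min d10 d20 d30 d40 e40 invr_gt0 ltr0n.
move=> [a b]; rewrite subr0 cexp0 => hn; rewrite mul1r.
have ha : `|a| <= nc (Complex a b) by apply: (normRe_le (Complex a b)).
have hb : `|b| <= nc (Complex a b) by apply: (normIm_le (Complex a b)).
set n := nc _ in hn ha hb *.
move: hn; rewrite !lt_min => /andP[/andP[/andP[n1 n2] /andP[n3 n4]] /andP[n5 n6]].
have := h4 a; rewrite subr0 expR0 !mul1r => /(_ (le_lt_trans ha n4)) k4.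
have := h3 b; rewrite subr0 sin0 cos0 subr0 mul1r => /(_ (le_lt_trans hb n3)) k3.
have := h2 b; rewrite subr0 sin0 cos0 oppr0 mul0r subr0 => /(_ (le_lt_trans hb n2)) k2.
have := h1 a; rewrite subr0 expR0 mul1r => /(_ (le_lt_trans ha n1)) k1.
have ea : `|expR a - 1| <= 2 * `|a|.
  rewrite -[expR a - 1](subrK a) (le_trans (ler_normD _ _))//.
  by rewrite (le_trans (lerD k4 (lexx _)))// mulrDl mul1r.
have a1 : `|a| <= 4^-1 by rewrite (le_trans ha)// ltW.
have e2 : expR a <= 2 by move: ea; rewrite ler_norml => /andP[_]; lra.
have e2' := expR_ge0 a.
rewrite (le_trans (nc_le _))// /cexp/=.
(* Of eight shares [eps / 8 * n], the real part uses three and the imaginary part five. *)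
have -> : eps * n = eps / 8 * n * 3 + eps / 8 * n * 5 by field.
have n0 : 0 <= eps / 8 * n by rewrite mulr_ge0 ?(ltW e40)// (le_trans _ ha).
have mono (t : R) : `|t| <= n -> eps / 8 * `|t| <= eps / 8 * n by move=> ?; rewrite ler_wpM2l// ltW.
apply: lerD.
  have -> : expR a * cos b - 0 * sin b - 1 - a = (expR a - 1 - a) + expR a * (cos b - 1) by ring.
  rewrite (le_trans (ler_normD _ _))// normrM (ger0_norm e2').
  have -> : eps / 8 * n * 3 = eps / 8 * n + 2 * (eps / 8 * n) by ring.
  rewrite lerD// ?(le_trans k1)// ?mono// ler_pM// (le_trans k2)// mono//.
have -> : expR a * sin b + 0 * cos b - 0 - b = expR a * (sin b - b) + (expR a - 1) * b by ring.
rewrite (le_trans (ler_normD _ _))// !normrM (ger0_norm e2').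
have -> : eps / 8 * n * 5 = 2 * (eps / 8 * n) + 3 * (eps / 8 * n) by ring.
apply: lerD; first by rewrite ler_pM// (le_trans k3)// mono.
rewrite (le_trans (ler_pM _ _ ea hb))// -mulrA.
have : `|a| * n <= eps / 8 * n by rewrite ler_wpM2r ?(le_trans _ hb)// (le_trans ha)// ltW.
lra.
Qed.

Lemma cdiff_cexp z : cdiff cexp z (cexp z).
Proof.
have h : cdiff (fun w => w - z) z (1 - 0).
  by apply: cdiffB; [exact: cdiff_id|exact: cdiff_cst].
have := @cdiff_comp cexp (fun w => w - z) z 1 _ h.
rewrite subrr => /(_ cdiff_cexp0) /(cdiffZ (cexp z)).
rewrite subr0 !mulr1; apply: cdiff_ext; exists 1 => // w _ /=.
by rewrite -cexpD addrCA subrr addr0.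
Qed.

Definition unit_pt (t : R) : C := Complex (cos (2 * pi * t)) (sin (2 * pi * t)).
Local Notation e := unit_pt.

Lemma polarE r t : polar r t = r%:C * e t.
Proof.
by apply/eqP; rewrite eq_complex /= !mul0r subr0 addr0 !eqxx.
Qed.

Lemma unit_ptE t : e t = cexp (Complex 0 (2 * pi * t)).
Proof. by rewrite /cexp/= expR0 mul1r. Qed.

Lemma nc_unit t : nc (e t) = 1.
Proof. by rewrite unit_ptE nc_cexp expR0. Qed.

Lemma unitD s t : e (s + t) = e s * e t.
Proof.
rewrite !unit_ptE -cexpD; congr cexp; apply/eqP.
by rewrite eq_complex/= addr0 mulrDr !eqxx.
Qed.

Lemma unit0 : e 0 = 1.
Proof. by rewrite /e mulr0 cos0 sin0. Qed.

Lemma unit1 : e 1 = 1.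
Proof. by rewrite /e mulr1 mulr_natl cos2pi sin2pi. Qed.

Lemma unit_neq0 t : e t != 0.
Proof. by apply/eqP => h; have := nc_unit t; rewrite h nc0 => /eqP; rewrite eq_sym oner_eq0. Qed.
End cexp.

(** * Cauchy's formulas on circles *)

Section circle.
Context {R : realType}.
Local Notation C := (R[i]).
Local Notation nc := (@Normc.normc R).
Local Notation Re := (@complex.Re R).
Local Notation Im := (@complex.Im R).
Local Notation "x %:C" := (Complex x 0) : ring_scope.
Local Notation e := (@unit_pt R).
Implicit Types (z w c d : C) (f g : C -> C) (u : R -> C) (r t rho : R).

Definition rcont u t := forall eps : R, 0 < eps -> exists2 del : R, 0 < del &
  forall s, `|s - t| < del -> nc (u s - u t) <= eps.

Definition rdiff u t d := forall eps : R, 0 < eps -> exists2 del : R, 0 < del &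
  forall s, `|s - t| < del -> nc (u s - u t - (s - t)%:C * d) <= eps * `|s - t|.

Lemma rdiff_rcont u t d : rdiff u t d -> rcont u t.
Proof.
move=> /(_ 1 ltr01)[del d0 hd] eps e0.
have k0 : 0 < 1 + nc d by rewrite ltr_pwDl// nc_ge0.
exists (Num.min del (eps / (1 + nc d))); first by rewrite lt_min d0 divr_gt0.
move=> s; rewrite lt_min => /andP[/hd + /ltW h].
rewrite mul1r => h1; rewrite -(subrK ((s - t)%:C * d) (u s - u t)).
rewrite (le_trans (ncD _ _))// (le_trans (lerD h1 (lexx _)))//.
by rewrite ncM nc_real -{1}[`|s - t|]mulr1 -mulrDr -ler_pdivlMr.
Qed.

Lemma rdiff_comp f u t d v : rdiff u t v -> cdiff f (u t) d ->
  rdiff (f \o u) t (d * v).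
Proof.
move=> hu hf eps e0; have cu := rdiff_rcont hu.
have k0 : 0 < 1 + nc v by rewrite ltr_pwDl// nc_ge0.
have l0 : 0 < 1 + nc d by rewrite ltr_pwDl// nc_ge0.
have e20 : 0 < eps / 2 by rewrite divr_gt0.
have [d1 d10 h1] := hf _ (divr_gt0 e20 k0).
have [d2 d20 h2] := cu _ (divr_gt0 d10 (ltr0Sn R 1)).
have [d3 d30 h3] := hu _ ltr01.
have [d4 d40 h4] := hu _ (divr_gt0 e20 l0).
exists (Num.min d2 (Num.min d3 d4)); first by rewrite !lt_min d20 d30.
move=> s; rewrite !lt_min => /andP[/h2 k2 /andP[/h3 k3 /h4 k4]].
have us : nc (u s - u t) < d1.
  by apply: le_lt_trans k2 _; rewrite ltr_pdivrMr// mulrDr mulr1 ltrDl.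
have k1 := h1 _ us.
have n1 : nc (u s - u t) <= (1 + nc v) * `|s - t|.
  rewrite -(subrK ((s - t)%:C * v) (u s - u t)) (le_trans (ncD _ _))//.
  by rewrite (le_trans (lerD k3 (lexx _)))// ncM nc_real mulrDl [_ * nc v]mulrC.
have -> : (f \o u) s - (f \o u) t - (s - t)%:C * (d * v) =
   (f (u s) - f (u t) - d * (u s - u t)) + d * (u s - u t - (s - t)%:C * v).
  by rewrite /=; ring.
rewrite (le_trans (ncD _ _))// (splitr eps) mulrDl lerD//.
  apply: le_trans k1 _; apply: le_trans (ler_wpM2l _ n1) _.
    by rewrite ltW// divr_gt0.
  by rewrite mulrA divfK// lt0r_neq0.
rewrite ncM (le_trans (ler_wpM2l (nc_ge0 _) k4))//.
rewrite mulrA ler_wpM2r// mulrC -mulrA ler_piMr// ?ltW//.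
by rewrite mulrC ltr_pdivrMr// mul1r ltrDr.
Qed.

Lemma rdiff_Re u t d : rdiff u t d -> is_derive t (1 : R) (fun s => Re (u s)) (Re d).
Proof.
move=> h; apply: eps_is_derive => eps /h[del d0 hd]; exists del => // s /hd.
apply: le_trans; apply: le_trans (normRe_le _).
by rewrite cReB cReB cReZ mulrC.
Qed.

Lemma rcont_comp f u t : rcont u t -> clim f (u t) (f (u t)) -> rcont (f \o u) t.
Proof.
move=> hu hf eps /hf[d1 d10 h1].
have [d2 d20 h2] := hu _ (divr_gt0 d10 (ltr0Sn R 1)).
exists d2 => // s /h2 k; apply: h1; apply: le_lt_trans k _.
by rewrite ltr_pdivrMr// mulrDr mulr1 ltrDl.
Qed.

Lemma rcont_continuous_Re u t : rcont u t -> {for t, continuous (fun s => Re (u s))}.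
Proof.
move=> h; apply: continuous_pointP => eps /h[del d0 hd]; exists del => // s /hd.
by apply: le_trans; rewrite -cReB normRe_le.
Qed.

Lemma rcont_continuous_nc u t : rcont u t -> {for t, continuous (fun s => nc (u s))}.
Proof.
move=> h; apply: continuous_pointP => eps /h[del d0 hd]; exists del => // s /hd.
by apply: le_trans; rewrite nc_dist_le.
Qed.

Lemma rdiff_affine z d t : rdiff (fun s => z + s%:C * d) t d.
Proof.
move=> eps e0; exists 1 => // s _.
have -> : z + s%:C * d - (z + t%:C * d) - (s - t)%:C * d = 0.
  have -> : (s - t)%:C = s%:C - t%:C by apply/eqP; rewrite eq_complex/= subr0 !eqxx.
  by ring.
by rewrite nc0 mulr_ge0// ltW.
Qed.

Lemma rdiff_unit t : rdiff e t ((Complex 0 (2 * pi)) * e t).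
Proof.
have h : rdiff (fun s => 0 + s%:C * (Complex 0 (2 * pi))) t (Complex 0 (2 * pi)).
  exact: rdiff_affine.
have := rdiff_comp h (cdiff_cexp _).
have E (s : R) : 0 + s%:C * Complex 0 (2 * pi) = Complex 0 (2 * pi * s).
  by apply/eqP; rewrite add0r eq_complex/= !mulr0 !mul0r subr0 addr0 mulrC !eqxx.
rewrite E -unit_ptE [X in rdiff _ _ X -> _]mulrC.
by have -> : cexp \o (fun s : R => 0 + s%:C * Complex 0 (2 * pi)) = e
  by apply/funext => s /=; rewrite E unit_ptE.
Qed.

Definition cpt w r t : C := w + r%:C * e t.

Lemma nc_cpt w r t : 0 <= r -> nc (cpt w r t - w) = r.
Proof. by move=> r0; rewrite /cpt addrC addKr ncM nc_real nc_unit mulr1 ger0_norm. Qed.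

Lemma rdiff_cpt w r t : rdiff (cpt w r) t (Complex 0 (2 * pi) * (r%:C * e t)).
Proof.
have h : cdiff (fun z => w + r%:C * z) (e t) (0 + r%:C * 1).
  by apply: cdiffD; [exact: cdiff_cst|apply: cdiffZ; exact: cdiff_id].
have := rdiff_comp (rdiff_unit t) h.
by rewrite add0r mulr1 mulrCA.
Qed.

Lemma rcont_cpt w r t : rcont (cpt w r) t.
Proof. exact: rdiff_rcont (rdiff_cpt _ _ _). Qed.

Lemma cpt1 w r : cpt w r 1 = cpt w r 0.
Proof. by rewrite /cpt unit1 unit0. Qed.

Definition cdiffable f z := exists d, cdiff f z d.

Lemma cdiffable_clim f z : cdiffable f z -> clim f z (f z).
Proof. by move=> [d /cdiff_clim]. Qed.

Lemma continuous_Re_cpt f w r : (forall t, clim f (cpt w r t) (f (cpt w r t))) ->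
  continuous (fun t => Re (f (cpt w r t))).
Proof.
move=> h t; apply: (@rcont_continuous_Re (f \o cpt w r)).
by apply: rcont_comp; [exact: rcont_cpt|exact: h].
Qed.

Lemma continuous_nc_cpt f w r : (forall t, clim f (cpt w r t) (f (cpt w r t))) ->
  continuous (fun t => nc (f (cpt w r t))).
Proof.
move=> h t; apply: (@rcont_continuous_nc (f \o cpt w r)).
by apply: rcont_comp; [exact: rcont_cpt|exact: h].
Qed.

(** Tube lemma for the compact interval [[0, 1]]: if near each point all small parameters are
    admissible, one parameter serves the whole interval. Uniform continuity on circles and
    continuity of parameter integrals are derived from it. *)
Lemma tube (Q : R -> R -> Prop) :
  (forall t0, 0 <= t0 <= 1 -> exists2 d0 : R, 0 < d0 &
     forall t (d : R), 0 <= t <= 1 -> `|t - t0| < d0 -> 0 < d < d0 -> Q d t) ->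
  exists2 d : R, 0 < d & forall t, 0 <= t <= 1 -> Q d t.
Proof.
move=> h.
have /compact_near_coveringP/near_covering_withinP cv := @segment_compact R 0 1.
have := cv R (0^'+) Q _.
have hh : forall x : R, `[0, 1]%classic x ->
   \forall x' \near x & i \near 0^'+, `[0, 1]%classic x' -> Q i x'.
  move=> t0; rewrite /= in_itv/= => /h[d0 d00 hd].
  exists (ball t0 d0, [set d | 0 < d < d0]); first split => /=.
  - exact: nbhsx_ballx.
  - near=> d; apply/andP; split; [near: d; exact: nbhs_right_gt|near: d; exact: nbhs_right_lt].
  - move=> [t d]/=[]; rewrite /ball/= => td dd; rewrite in_itv/= => t01.
    by apply: hd => //; rewrite distrC.
move=> /(_ _ hh) H.
have [d dP] : exists d : R, 0 < d /\ (`[0, 1]%classic `<=` Q d).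
  apply: (@filter_ex _ (0^'+ : set_system R)).
  near=> d; split; near: d; [exact: nbhs_right_gt|exact: H].
case: dP => d0 dP; by exists d => // t t01; apply: dP.
Unshelve. all: by end_near. Qed.

(** The increment [h] is an arbitrary complex number rather than a displacement along the circle,
    because the circle is later translated together with its centre. *)
Lemma unif_on_circle f w r : (forall t, clim f (cpt w r t) (f (cpt w r t))) ->
  forall eps : R, 0 < eps -> exists2 del : R, 0 < del &
  forall t h, 0 <= t <= 1 -> nc h < del -> nc (f (cpt w r t + h) - f (cpt w r t)) <= eps.
Proof.
move=> hf eps e0.
have [|d d0 hd] := @tube (fun (d : R) t => forall h,
  nc h < d -> nc (f (cpt w r t + h) - f (cpt w r t)) <= eps); last first.
  by exists d => // t h t01; apply: hd.
move=> t0 _.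
have [d1 d10 h1] := hf t0 _ (divr_gt0 e0 (ltr0Sn R 1)).
have d1h : d1 / 2 < d1 by rewrite ltr_pdivrMr// mulrDr mulr1 ltrDl.
have d120 : 0 < d1 / 2 by rewrite divr_gt0.
have [d2 d20 h2] := rcont_cpt w r t0 (divr_gt0 d120 (ltr0Sn R 1)).
exists (Num.min (d1 / 2) d2); first by rewrite lt_min d20 d120.
move=> t d _; rewrite !lt_min => /andP[_ /h2 k2] /andP[_ /andP[k3 _]] h hk.
have q : nc (cpt w r t - cpt w r t0) < d1 / 2.
  by apply: le_lt_trans k2 _; rewrite ltr_pdivrMr// mulrDr mulr1 ltrDl.
have l1 : nc (f (cpt w r t) - f (cpt w r t0)) <= eps / 2.
  by apply: h1; apply: lt_trans q _.
have l2 : nc (f (cpt w r t + h) - f (cpt w r t0)) <= eps / 2.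
  apply: h1; rewrite addrAC [ltRHS]splitr; apply: le_lt_trans (ncD _ _) _.
  by apply: ltrD => //; exact: lt_trans hk k3.
have -> : f (cpt w r t + h) - f (cpt w r t) =
  (f (cpt w r t + h) - f (cpt w r t0)) - (f (cpt w r t) - f (cpt w r t0)) by ring.
by rewrite (le_trans (ncB _ _))// (splitr eps) lerD.
Qed.

(* In the coordinates [z = w + exp (2 pi (x + i y))] circles become vertical segments,
   and the horizontal sides of the Goursat rectangle cancel by periodicity. *)
Lemma circle_mean_const g w rho :
  (forall z, 0 < nc (z - w) < rho -> cdiffable g z) ->
  forall r1 r2, 0 < r1 -> r1 <= r2 -> r2 < rho ->
  rint 0 1 (fun t => Re (g (cpt w r1 t))) = rint 0 1 (fun t => Re (g (cpt w r2 t))).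
Proof.
move=> hg r1 r2 r10 r12 r2rho.
have r20 : 0 < r2 := lt_le_trans r10 r12.
have pi2 : 0 < 2 * pi :> R by rewrite mulr_gt0// pi_gt0.
pose A := ln r1 / (2 * pi); pose B := ln r2 / (2 * pi).
have AB : A <= B by rewrite ler_pM2r ?invr_gt0// ler_ln ?posrE.
pose G z := g (w + cexp z).
pose Z (x y : R) := Complex (2 * pi * x) (2 * pi * y).
have ZE x y : w + cexp (Z x y) = cpt w (expR (2 * pi * x)) y by [].
have rA : expR (2 * pi * A) = r1 by rewrite mulrC divfK ?lt0r_neq0// lnK ?posrE.
have rB : expR (2 * pi * B) = r2 by rewrite mulrC divfK ?lt0r_neq0// lnK ?posrE.
have cG x y : A <= x <= B -> cdiffable G (Z x y).
  move=> /andP[Ax xB]; have [d hd] : cdiffable g (w + cexp (Z x y)).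
    apply: hg; rewrite ZE nc_cpt ?expR_ge0// expR_gt0/=.
    by apply: le_lt_trans r2rho; rewrite -rB ler_expR ler_wpM2l// ltW.
  have h1 : cdiff (fun z => w + cexp z) (Z x y) (0 + cexp (Z x y)).
    by apply: cdiffD; [exact: cdiff_cst|exact: cdiff_cexp].
  by exists (d * (0 + cexp (Z x y))); exact: cdiff_comp h1 hd.
have := @goursat_rect R (fun x y => Re (G (Z x y))) (fun x y => Im (G (Z x y))) A B 0 1 AB ler01.
have periodic : rint A B (fun x => Im (G (Z x 1)) - Im (G (Z x 0))) = 0.
  rewrite -[RHS](mul0r (B - A)) -rint_cst//; apply: eq_rint => x _.
  by rewrite /G !ZE cpt1 subrr.
rewrite periodic.
have cont x : A <= x <= B -> continuous (fun y => Re (G (Z x y))).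
  move=> hx y; apply: (@continuous_Re_cpt g w (expR (2 * pi * x))) => {}y.
  apply: cdiffable_clim; apply: hg; rewrite nc_cpt ?expR_ge0// expR_gt0/=.
  by case/andP: hx => _ hx; apply: le_lt_trans r2rho; rewrite -rB ler_expR ler_wpM2l// ltW.
rewrite rintB; last 2 first.
- by apply: continuous_subspaceT; apply: cont; rewrite lexx AB.
- by apply: continuous_subspaceT; apply: cont; rewrite lexx AB.
have -> : (fun y => Re (G (Z B y))) = (fun t => Re (g (cpt w r2 t))).
  by apply/funext => y; rewrite /G ZE rB.
have -> : (fun y => Re (G (Z A y))) = (fun t => Re (g (cpt w r1 t))).
  by apply/funext => y; rewrite /G ZE rA.
move=> H; apply/esym/eqP; rewrite -subr_eq0; apply/eqP; apply: H.
move=> x0 y0 hx _; have [d hd] := cG x0 y0 hx.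
exists (2 * pi * Re d), (2 * pi * Im d) => eps e0.
have e20 : 0 < eps / (2 * pi) by rewrite divr_gt0.
have [d1 d10 h1] := hd _ e20.
exists (d1 / (2 * pi) / 2); first by rewrite !divr_gt0.
move=> x y hx' hy'.
have dZ : Z x y - Z x0 y0 = Complex (2 * pi * (x - x0)) (2 * pi * (y - y0)).
  by apply/eqP; rewrite eq_complex/= !mulrBr !eqxx.
have nZ : nc (Z x y - Z x0 y0) <= 2 * pi * (`|x - x0| + `|y - y0|).
  have nc_le2 (a b : R) : nc (Complex a b) <= `|a| + `|b| by exact: (nc_le (Complex a b)).
  rewrite dZ (le_trans (nc_le2 _ _))// !normrM !(gtr0_norm (pi_gt0 R)) normr_nat.
  by rewrite -mulrDr lexx.
have nZ1 : nc (Z x y - Z x0 y0) < d1.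
  apply: le_lt_trans nZ _; rewrite mulrC -ltr_pdivlMr//.
  by rewrite [ltRHS]splitr ltrD.
have k1 := h1 _ nZ1.
have k2 : nc (G (Z x y) - G (Z x0 y0) - d * (Z x y - Z x0 y0)) <= eps * (`|x - x0| + `|y - y0|).
  apply: le_trans k1 _; apply: le_trans (ler_wpM2l (ltW e20) nZ) _.
  by rewrite mulrA divfK// lt0r_neq0.
split.
- apply: le_trans k2; apply: le_trans (normRe_le _).
  rewrite dZ cReB cReB cReM/=; rewrite le_eqVlt; apply/orP; left; apply/eqP; congr (`|_|); ring.
- apply: le_trans k2; apply: le_trans (normIm_le _).
  rewrite dZ cImB cImB cImM/=; rewrite le_eqVlt; apply/orP; left; apply/eqP; congr (`|_|); ring.
Qed.

(** The mean does not depend on the radius and tends to [Re L] as the radius shrinks. The centre is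
    excluded so that [g] may be a difference quotient [(f z - f w) / (z - w)]. *)
Lemma circle_mean_lim g w rho L :
  (forall z, 0 < nc (z - w) < rho -> cdiffable g z) ->
  (forall eps : R, 0 < eps -> exists2 del : R, 0 < del &
    forall z, 0 < nc (z - w) < del -> nc (g z - L) <= eps) ->
  forall r, 0 < r < rho -> rint 0 1 (fun t => Re (g (cpt w r t))) = Re L.
Proof.
move=> hg hL r /andP[r0 rrho].
apply/eqP; rewrite -subr_eq0 -normr_le0; apply/ler_addgt0Pl => eps e0; rewrite addr0.
have [del d0 hd] := hL _ e0.
pose r1 := Num.min r del / 2.
have m0 : 0 < Num.min r del by rewrite lt_min r0.
have r10 : 0 < r1 by rewrite divr_gt0.
have : r1 < Num.min r del by rewrite /r1 ltr_pdivrMr// mulrDr mulr1 ltrDl.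
rewrite lt_min => /andP[r1r r1d].
rewrite -(circle_mean_const hg r10 (ltW r1r) rrho).
have cst : {within `[(0 : R), 1], continuous (fun=> Re L : R)}.
  exact/continuous_subspaceT/cst_continuous.
have cg : {within `[(0 : R), 1], continuous (fun t => Re (g (cpt w r1 t)))}.
  apply: continuous_subspaceT; apply: continuous_Re_cpt => t.
  apply: cdiffable_clim; apply: hg; rewrite nc_cpt ?r10 ?(ltW r10)//=.
  exact: lt_trans r1r rrho.
rewrite -[X in _ - X]mulr1 -[X in _ - Re L * X]subr0 -(rint_cst (Re L) ler01) -rintB//.
apply: le_trans (rint_norm_le ler01 (M := eps) _ _) _.
- by move=> z; apply: cvgB; [exact: cg|exact: cst].
- move=> t _; rewrite -cReB (le_trans (normRe_le _))// hd//.
  by rewrite nc_cpt ?r10 ?(ltW r10)//=.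
- by rewrite subr0 mulr1.
Qed.

End circle.

(** * The mean value property, Cauchy's formula for the derivative, and differentiability of the
    derivative *)

Section cauchy.
Context {R : realType}.
Local Notation C := (R[i]).
Local Notation nc := (@Normc.normc R).
Local Notation Re := (@complex.Re R).
Local Notation Im := (@complex.Im R).
Local Notation "x %:C" := (Complex x 0) : ring_scope.
Local Notation e := (@unit_pt R).
Implicit Types (z w c d : C) (f g : C -> C) (u : R -> C) (r t rho : R).

Lemma realC_neq0 r : r != 0 -> r%:C != 0.
Proof. by rewrite eq_complex/= eqxx andbT. Qed.

Lemma realCX r k : r%:C ^+ k = (r ^+ k)%:C.
Proof.
elim: k => [|k ih]; rewrite ?expr0// !exprS ih; apply/eqP.
by rewrite eq_complex/= !mul0r !mulr0 subr0 addr0 !eqxx.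
Qed.

Lemma cptK w r t : cpt w r t - w = r%:C * e t.
Proof. by rewrite /cpt addrC addKr. Qed.

Lemma unit_cpt w r t : r != 0 -> e t = (cpt w r t - w) / r%:C.
Proof. by move=> r0; rewrite cptK mulrAC mulfV ?mul1r ?realC_neq0. Qed.

(* Integrals being real-valued, Cauchy's formulas are stated for real parts; they are
   applied to unimodular multiples of [f]. *)
Lemma mean_value f w rho : (forall z, nc (z - w) < rho -> cdiffable f z) ->
  forall r, 0 < r < rho -> rint 0 1 (fun t => Re (f (cpt w r t))) = Re (f w).
Proof.
move=> hf r rr; apply: (@circle_mean_lim _ _ _ rho) => //.
  by move=> z /andP[_]; exact: hf.
move=> eps e0; have rho0 : 0 < rho by case/andP: rr; exact: lt_trans.
have /cdiffable_clim/(_ _ e0) : cdiffable f w by apply: hf; rewrite subrr nc0.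
by move=> [del d0 hd]; exists del => // z /andP[_]; exact: hd.
Qed.

Lemma cdiffable_mulX f z w k : cdiffable f z -> cdiffable (fun z => f z * (z - w) ^+ k.+1) z.
Proof.
move=> [d hd].
have h : cdiff (fun z => z - w) z (1 - 0) by apply: cdiffB; [exact: cdiff_id|exact: cdiff_cst].
by have := cdiffM hd (cdiffX k h); exists (d * (z - w) ^+ k.+1 + f z * (k.+1%:R * (z - w) ^+ k * (1 - 0))).
Qed.

(** Mean value property of [f z * (z - w) ^+ k.+1], which vanishes at the centre. *)
Lemma mean_pos f w rho k : (forall z, nc (z - w) < rho -> cdiffable f z) ->
  forall r, 0 < r < rho -> rint 0 1 (fun t => Re (f (cpt w r t) * e t ^+ k.+1)) = 0.
Proof.
move=> hf r rr; have /andP[r0 rrho] := rr.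
have := @mean_value (fun z => f z * (z - w) ^+ k.+1) w rho _ r rr.
have hh z : nc (z - w) < rho -> cdiffable (fun z => f z * (z - w) ^+ k.+1) z.
  by move=> /hf; exact: cdiffable_mulX.
move=> /(_ hh); rewrite subrr expr0n/= mulr0.
have -> : (fun t => Re (f (cpt w r t) * (cpt w r t - w) ^+ k.+1)) =
          (fun t => r ^+ k.+1 * Re (f (cpt w r t) * e t ^+ k.+1)).
  apply/funext => t; rewrite -cReZ; congr Re.
  by rewrite cptK exprMn mulrCA realCX.
have cf : {within `[(0 : R), 1], continuous (fun t => Re (f (cpt w r t) * e t ^+ k.+1))}.
  apply: continuous_subspaceT => t.
  apply: (@rcont_continuous_Re _ (fun t => f (cpt w r t) * e t ^+ k.+1)).
  have -> : (fun t => f (cpt w r t) * e t ^+ k.+1) =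
            (fun z => f z * ((z - w) / r%:C) ^+ k.+1) \o cpt w r.
    by apply/funext => s /=; rewrite (unit_cpt w s (lt0r_neq0 r0)).
  apply: rcont_comp; first exact: rcont_cpt.
  have [|d hd] := hf (cpt w r t); first by rewrite nc_cpt// ltW.
  apply: (@cdiff_clim _ (fun z => f z * ((z - w) / r%:C) ^+ k.+1)).
  apply: cdiffM; first exact: hd.
  apply: cdiffX; apply: cdiffM; last exact: cdiff_cst.
  by apply: cdiffB; [exact: cdiff_id|exact: cdiff_cst].
rewrite rintZ// => /eqP; rewrite mulf_eq0 expf_eq0/= (gt_eqF r0)/= => /eqP //.
Qed.

Lemma unitV t : (e t)^-1 = Complex (cos (2 * pi * t)) (- sin (2 * pi * t)).
Proof.
apply: (mulfI (unit_neq0 t)); rewrite mulfV ?unit_neq0//.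
apply/eqP; rewrite eq_complex cReM cImM /=.
by rewrite mulrN opprK -!expr2 cos2Dsin2 mulrN [sin _ * _]mulrC addrC subrr !eqxx.
Qed.

(** The inverse of [e t] is its conjugate, so conjugating the product turns the negative power into
    a positive one, to which [mean_pos] applies. *)
Lemma Re_div_unit c t : Re (c / e t) = Re (Complex (Re c) (- Im c) * e t).
Proof.
rewrite unitV !cReM.
rewrite [Re (e t)]/complex.Re [Im (e t)]/complex.Im ![Re (Complex _ _)]/complex.Re ![Im (Complex _ _)]/complex.Im.
by rewrite mulrN mulNr.
Qed.

Lemma continuous_div_unit f w r : (forall t, clim f (cpt w r t) (f (cpt w r t))) ->
  {within `[(0 : R), 1], continuous (fun t => Re (f (cpt w r t) / e t))}.
Proof.
move=> hf; apply: continuous_subspaceT => t.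
have -> : (fun t => Re (f (cpt w r t) / e t)) =
    (fun t => Re (f (cpt w r t)) * Re (e t) + Im (f (cpt w r t)) * Im (e t)).
  apply/funext => s; rewrite unitV cReM.
  rewrite [Re (e s)]/complex.Re [Im (e s)]/complex.Im [Re (Complex _ _)]/complex.Re [Im (Complex _ _)]/complex.Im.
  by rewrite mulrN opprK.
have ImE (u : R -> C) : (fun t => Im (u t)) = (fun t => Re (Complex 0 (-1) * u t)).
  by apply/funext => s; rewrite cReM/= mul0r sub0r mulNr opprK mul1r.
have cu : rcont e t by exact: rdiff_rcont (rdiff_unit t).
have cfc : rcont (f \o cpt w r) t by apply: rcont_comp => //; exact: rcont_cpt.
have mi (u : R -> C) : rcont u t -> {for t, continuous (fun t => Im (u t))}.
  move=> hu; rewrite ImE; apply: rcont_continuous_Re.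
  apply: (@rcont_comp _ (fun z => Complex 0 (-1) * z) u) => //.
  by apply: (@cdiff_clim _ (fun z => Complex 0 (-1) * z)); exact: cdiffZ (cdiff_id _).
apply: cvgD; apply: cvgM.
- exact: (rcont_continuous_Re cfc).
- exact: (rcont_continuous_Re cu).
- exact: (mi _ cfc).
- exact: (mi _ cu).
Qed.

(** Cauchy's formula for the first derivative: the difference quotient of [f] at [w] has a removable
    singularity with value [d], and the term [f w / e t] in its mean integrates to 0. *)
Lemma mean_neg1 f w rho d : (forall z, nc (z - w) < rho -> cdiffable f z) ->
  cdiff f w d ->
  forall r, 0 < r < rho -> rint 0 1 (fun t => Re (f (cpt w r t) / e t)) = r * Re d.
Proof.
move=> hf hd r rr; have /andP[r0 rrho] := rr.
have := @circle_mean_lim _ (fun z => (f z - f w) / (z - w)) w rho d _ _ r rr.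
have h1 z : 0 < nc (z - w) < rho -> cdiffable (fun z => (f z - f w) / (z - w)) z.
  move=> /andP[h0 /hf[d1 hd1]].
  have zw : z - w != 0 by apply/eqP => E; rewrite E nc0 ltxx in h0.
  have k : cdiff (fun z => z - w) z (1 - 0) by apply: cdiffB; [exact: cdiff_id|exact: cdiff_cst].
  have k1 : cdiff (fun z => f z - f w) z (d1 - 0) by apply: cdiffB => //; exact: cdiff_cst.
  by have := cdiffM k1 (@cdiffV _ (fun z => z - w) z _ zw k); eexists; eassumption.
have h2 (eps : R) : 0 < eps -> exists2 del : R, 0 < del &
    forall z, 0 < nc (z - w) < del -> nc ((f z - f w) / (z - w) - d) <= eps.
  move=> /hd[del d0 hdel]; exists del => // z /andP[z0 /hdel].
  have zw : z - w != 0 by apply/eqP => E; rewrite E nc0 ltxx in z0.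
  have -> : (f z - f w) / (z - w) - d = (f z - f w - d * (z - w)) / (z - w).
    by rewrite [in RHS]mulrBl mulfK.
  by rewrite ncM ncV ler_pdivrMr.
move=> /(_ h1 h2) <-.
have cst0 (c : C) : {within `[(0 : R), 1], continuous (fun t => Re (c / e t))}.
  by apply: (@continuous_div_unit (fun=> c) w r) => t; exact: clim_cst.
have cf : {within `[(0 : R), 1], continuous (fun t => Re (f (cpt w r t) / e t))}.
  apply: continuous_div_unit => t; apply: cdiffable_clim; apply: hf.
  by rewrite nc_cpt// ltW.
have z0 c : rint 0 1 (fun t => Re (c / e t)) = 0.
  have hh z : nc (z - w) < rho -> cdiffable (fun=> Complex (Re c) (- Im c)) z.
    by exists 0; exact: cdiff_cst.
  rewrite -[RHS](mean_pos 0 hh rr); apply: eq_rint => t _.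
  by rewrite expr1 Re_div_unit.
have E : (fun t => Re ((f (cpt w r t) - f w) / (cpt w r t - w))) =
         (fun t => r^-1 * (Re (f (cpt w r t) / e t) - Re (f w / e t))).
  apply/funext => t; rewrite -cReB -mulrBl -cReZ; congr Re.
  have -> : (r^-1)%:C = (r%:C)^-1.
    apply: (mulfI (realC_neq0 (lt0r_neq0 r0))); rewrite mulfV ?realC_neq0 ?lt0r_neq0//.
    by apply/eqP; rewrite eq_complex/= !mulr0 !mul0r subr0 addr0 mulfV ?lt0r_neq0// !eqxx.
  by rewrite cptK invfM mulrCA.
have cfw : {within `[(0 : R), 1], continuous (fun t => Re (f (cpt w r t) / e t) - Re (f w / e t))}.
  by move=> t; apply: cvgB; [exact: cf|exact: cst0].
by rewrite E rintZ// rintB// z0 subr0 mulrA mulfV ?lt0r_neq0// mul1r.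
Qed.

Lemma nc_le_Re z (M : R) : (forall c, nc c = 1 -> Re (c * z) <= M) -> nc z <= M.
Proof. by move=> h; have [c c1 cz] := nc_rot z; have := h c c1; rewrite cz. Qed.

Definition has_cderiv f (F : C -> C) w rho := forall z, nc (z - w) < rho -> cdiff f z (F z).

Lemma has_cderiv_shrink f F w rho z : has_cderiv f F w rho -> nc (z - w) < rho ->
  has_cderiv f F z (rho - nc (z - w)).
Proof.
move=> hf hz y hy; apply: hf; rewrite -(subrK z y) -addrA.
by apply: le_lt_trans (ncD _ _) _; rewrite -ltrBrDr.
Qed.

Lemma has_cderivZ c f F w rho : has_cderiv f F w rho ->
  has_cderiv (fun z => c * f z) (fun z => c * F z) w rho.
Proof. by move=> hf z /hf; exact: cdiffZ. Qed.

Lemma cderiv_formula f F w rho r z : has_cderiv f F w rho -> 0 < r ->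
  r + nc (z - w) < rho ->
  rint 0 1 (fun t => Re (f (cpt z r t) / e t)) = r * Re (F z).
Proof.
move=> hf r0 hr.
have hz : nc (z - w) < rho by apply: lt_trans hr; rewrite ltrDr.
have hf' := has_cderiv_shrink hf hz.
apply: (@mean_neg1 _ _ (rho - nc (z - w))).
- by move=> y /hf'; exists (F y).
- exact: hf.
- by rewrite r0 ltrBrDr.
Qed.

(** Cauchy's formula writes [F z] as an integral of [f] over a circle of fixed radius about [z];
    moving the centre moves the integrand uniformly little. The radius [r] is half the distance from
    [z0] to the boundary of the disc, so that all circles about points within [r] of [z0] remain
    inside. *)
Lemma cderiv_clim f F w rho : has_cderiv f F w rho ->
  forall z, nc (z - w) < rho -> clim F z (F z).
Proof.
move=> hf z0 hz0 eps e0.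
pose r := (rho - nc (z0 - w)) / 2.
have r0 : 0 < r by rewrite divr_gt0// subr_gt0.
have rr : r + r = rho - nc (z0 - w) by rewrite -splitr.
have fin z t : nc (z - z0) < r -> clim f (cpt z r t) (f (cpt z r t)).
  move=> hz; apply: (@cdiff_clim _ _ _ (F (cpt z r t))); apply: hf.
  have -> : cpt z r t - w = (cpt z r t - z) + (z - z0) + (z0 - w) by ring.
  apply: le_lt_trans (ncD _ _) _; rewrite -ltrBrDr -rr.
  by apply: le_lt_trans (ncD _ _) _; rewrite nc_cpt ?ltW// ltrD2l.
have [|d d0 hd] := @unif_on_circle _ f z0 r _ _ (mulr_gt0 e0 r0).
  by move=> t; apply: fin; rewrite subrr nc0.
exists (Num.min d r); first by rewrite lt_min d0.
move=> z; rewrite lt_min => /andP[zd zr]; apply: nc_le_Re => c c1.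
have hcf := has_cderivZ c hf.
have f1 := @cderiv_formula _ _ _ _ r z hcf r0.
have f2 := @cderiv_formula _ _ _ _ r z0 hcf r0.
have hr2 : r + nc (z0 - w) < rho by rewrite -ltrBrDr -rr ltrDl.
have hr1 : r + nc (z - w) < rho.
  have -> : z - w = (z - z0) + (z0 - w) by ring.
  apply: le_lt_trans (lerD (lexx _) (ncD _ _)) _.
  by rewrite addrA -ltrBrDr -rr ltrD2l.
rewrite -(ler_pM2l r0) mulrBr cReB mulrBr -(f1 hr1) -(f2 hr2) -rintB; last 2 first.
- apply: (@continuous_div_unit (fun z => c * f z)) => t.
  by apply: climM; [exact: clim_cst|exact: fin].
- apply: (@continuous_div_unit (fun z => c * f z)) => t.
  by apply: climM; [exact: clim_cst|apply: fin; rewrite subrr nc0].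
apply: le_trans (rint_le_cst ler01 (M := eps * r) _ _) _.
- move=> t; apply: cvgB.
    apply: (@continuous_div_unit (fun z => c * f z)) => {}t.
    by apply: climM; [exact: clim_cst|exact: fin].
  apply: (@continuous_div_unit (fun z => c * f z)) => {}t.
  by apply: climM; [exact: clim_cst|apply: fin; rewrite subrr nc0].
- move=> t t01; rewrite -cReB -mulrBl -mulrBr (le_trans (Re_le_nc _))//.
  rewrite !ncM c1 mul1r ncV nc_unit invr1 mulr1.
  have -> : cpt z r t = cpt z0 r t + (z - z0) by rewrite /cpt; ring.
  exact: hd.
- by rewrite subr0 mulr1 mulrC.
Qed.

(** The mean value theorem on the segment from [v] to [v + h], for the real part of a unimodular
    multiple of [f], leaves an increment of [F] along that segment, which is uniformly small by
    [cderiv_clim] and [unif_on_circle]. *)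
Lemma unif_taylor f F w rho z0 r : has_cderiv f F w rho -> 0 < r ->
  r + nc (z0 - w) < rho ->
  forall eps : R, 0 < eps -> exists2 del : R, 0 < del & forall t h, 0 <= t <= 1 -> nc h < del ->
  nc (f (cpt z0 r t + h) - f (cpt z0 r t) - h * F (cpt z0 r t)) <= eps * nc h.
Proof.
move=> hf r0 hr eps e0.
pose q := rho - (r + nc (z0 - w)).
have q0 : 0 < q by rewrite subr_gt0.
have inB t h : nc h < q -> nc (cpt z0 r t + h - w) < rho.
  move=> hq; have -> : cpt z0 r t + h - w = (cpt z0 r t - z0) + (z0 - w) + h by ring.
  apply: le_lt_trans (ncD _ _) _; rewrite -ltrBrDl; apply: lt_le_trans hq _.
  rewrite lerB// (le_trans (ncD _ _))// nc_cpt// ltW//.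
have cF t : clim F (cpt z0 r t) (F (cpt z0 r t)).
  apply: (cderiv_clim hf); have := inB t 0; rewrite addr0 nc0; exact.
have [d d0 hd] := unif_on_circle cF e0.
exists (Num.min d q); first by rewrite lt_min d0.
move=> t h t01; rewrite lt_min => /andP[hd1 hq1].
set v := cpt z0 r t; apply: nc_le_Re => c c1.
pose phi (s : R) := Re (c * f (v + s%:C * h)).
have inB' (s : R) : 0 <= s <= 1 -> nc (s%:C * h) <= nc h.
  by move=> /andP[s0 s1]; rewrite ncM nc_real ger0_norm// ler_piMl// nc_ge0.
have dphi (s : R) : 0 <= s <= 1 -> is_derive s (1 : R) phi (Re (c * F (v + s%:C * h) * h)).
  move=> s01.
  apply: (@rdiff_Re _ (fun s => c * f (v + s%:C * h)) s (c * F (v + s%:C * h) * h)).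
  apply: (@rdiff_comp _ (fun z => c * f z) (fun s => v + s%:C * h)).
    exact: rdiff_affine.
  by apply: cdiffZ; apply: hf; apply: inB; exact: le_lt_trans (inB' _ s01) hq1.
have dphi' (s : R) : s \in `]0, 1[ -> is_derive s (1 : R) phi (Re (c * F (v + s%:C * h) * h)).
  by rewrite in_itv/= => /andP[? ?]; apply: dphi; rewrite !ltW.
have [|s hs] := @MVT_segment R phi (fun s => Re (c * F (v + s%:C * h) * h)) 0 1 ler01
   dphi' _.
  apply: derivable_within_continuous => s; rewrite in_itv/= => /dphi hs.
  by have [] := hs.
rewrite subr0 mulr1 /phi.
have -> : v + 1%:C * h = v + h by congr (_ + _); rewrite mul1r.
have -> : v + 0%:C * h = v by rewrite mul0r addr0.
rewrite -cReB => E.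
have -> : Re (c * (f (v + h) - f v - h * F v)) = Re (c * h * (F (v + s%:C * h) - F v)).
  have -> : c * (f (v + h) - f v - h * F v) = (c * f (v + h) - c * f v) - c * h * F v by ring.
  by rewrite cReB E -cReB; congr Re; ring.
rewrite (le_trans (Re_le_nc _))// !ncM c1 mul1r mulrC ler_wpM2r ?nc_ge0//.
apply: hd => //; apply: le_lt_trans hd1; apply: inB'.
by move: hs; rewrite in_itv.
Qed.

(** Differentiation under the integral sign in Cauchy's formula for [F], allowed because the
    expansion of [f] is uniform on the circle. The derivative [G] is the mean of [F / e t] divided
    by [r]; as integrals are real, its real and imaginary parts are given separately by [J 1] and
    [J (-i)]. *)
Lemma cderiv_cdiffable f F w rho : has_cderiv f F w rho ->
  forall z, nc (z - w) < rho -> cdiffable F z.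
Proof.
move=> hf z0 hz0.
pose r := (rho - nc (z0 - w)) / 2.
have r0 : 0 < r by rewrite divr_gt0// subr_gt0.
have rr : r + r = rho - nc (z0 - w) by rewrite -splitr.
have hr2 : r + nc (z0 - w) < rho by rewrite -ltrBrDr -rr ltrDl.
have inB z t : nc (z - z0) < r -> nc (cpt z r t - w) < rho.
  move=> hz; have -> : cpt z r t - w = (cpt z r t - z) + (z - z0) + (z0 - w) by ring.
  apply: le_lt_trans (ncD _ _) _; rewrite -ltrBrDr -rr.
  by apply: le_lt_trans (ncD _ _) _; rewrite nc_cpt ?ltW// ltrD2l.
have cf z t : nc (z - z0) < r -> clim f (cpt z r t) (f (cpt z r t)).
  move=> hz; apply: (@cdiff_clim _ _ _ (F (cpt z r t))); apply: hf; exact: inB.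
have cF z t : nc (z - z0) < r -> clim F (cpt z r t) (F (cpt z r t)).
  by move=> hz; exact: (cderiv_clim hf (inB _ _ hz)).
have z00 : nc (z0 - z0) < r by rewrite subrr nc0.
pose J c := r^-1 * rint 0 1 (fun t => Re (c * F (cpt z0 r t) / e t)).
pose G := Complex (J 1) (J (Complex 0 (-1))).
have cJ c : {within `[(0 : R), 1], continuous (fun t => Re (c * F (cpt z0 r t) / e t))}.
  apply: (@continuous_div_unit (fun z => c * F z)) => t.
  by apply: climM; [exact: clim_cst|exact: cF].
have JE c : Re (c * G) = J c.
  rewrite cReM /G /J [Re (Complex _ _)]/complex.Re [Im (Complex _ _)]/complex.Im.
  rewrite !(mulrCA _ r^-1) -mulrBr; congr (_ * _).
  rewrite -!rintZ// -rintB; last 2 first.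
    by move=> t; apply: cvgM; [exact: cvg_cst|exact: cJ].
    by move=> t; apply: cvgM; [exact: cvg_cst|exact: cJ].
  apply: eq_rint => t _; rewrite -!mulrA; set X := F _ / _.
  by rewrite mul1r [in RHS]cReM; congr (_ - _ * _); rewrite cReM/= mul0r sub0r mulNr mul1r opprK.
exists G => eps e0.
have [d d0 hd] := unif_taylor hf r0 hr2 (mulr_gt0 e0 r0).
exists (Num.min d r); first by rewrite lt_min d0.
move=> z; rewrite lt_min => /andP[zd zr]; apply: nc_le_Re => c c1.
have hcf := has_cderivZ c hf.
have hr1 : r + nc (z - w) < rho.
  have -> : z - w = (z - z0) + (z0 - w) by ring.
  apply: le_lt_trans (lerD (lexx _) (ncD _ _)) _.
  by rewrite addrA -ltrBrDr -rr ltrD2l.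
have f1 := cderiv_formula hcf r0 hr1.
have f2 := cderiv_formula hcf r0 hr2.
have f3 : r * Re (c * (z - z0) * G) = rint 0 1 (fun t => Re (c * (z - z0) * F (cpt z0 r t) / e t)).
  by rewrite JE /J mulrA mulfV ?lt0r_neq0// mul1r.
have -> : c * (F z - F z0 - G * (z - z0)) = c * F z - c * F z0 - c * (z - z0) * G by ring.
have c1' : {within `[(0 : R), 1], continuous (fun t => Re (c * f (cpt z r t) / e t))}.
  apply: (@continuous_div_unit (fun z => c * f z)) => t.
  by apply: climM; [exact: clim_cst|exact: cf].
have c2' : {within `[(0 : R), 1], continuous (fun t => Re (c * f (cpt z0 r t) / e t))}.
  apply: (@continuous_div_unit (fun z => c * f z)) => t.
  by apply: climM; [exact: clim_cst|exact: cf].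
have c12 : {within `[(0 : R), 1], continuous (fun t => Re (c * f (cpt z r t) / e t) - Re (c * f (cpt z0 r t) / e t))}.
  by move=> t; apply: cvgB; [exact: c1'|exact: c2'].
rewrite -(ler_pM2l r0) !cReB !(mulrBr r) f3 -f1 -f2 -rintB// -rintB//.
apply: le_trans (rint_le_cst ler01 (M := eps * r * nc (z - z0)) _ _) _.
- by move=> t; apply: cvgB; [exact: c12|exact: cJ].
- move=> t t01; rewrite -!cReB (le_trans (Re_le_nc _))//.
  have -> : c * f (cpt z r t) / e t - c * f (cpt z0 r t) / e t - c * (z - z0) * F (cpt z0 r t) / e t =
    c * (f (cpt z r t) - f (cpt z0 r t) - (z - z0) * F (cpt z0 r t)) / e t by ring.
  rewrite !ncM c1 mul1r ncV nc_unit invr1 mulr1.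
  have -> : cpt z r t = cpt z0 r t + (z - z0) by rewrite /cpt; ring.
  exact: hd.
- by rewrite subr0 mulr1 [r * _]mulrCA mulrA.
Qed.

End cauchy.

(** * Taylor coefficients of all orders and the quadratic gain at a point *)

Section cauchy_coef.
Context {R : realType}.
Local Notation C := (R[i]).
Local Notation nc := (@Normc.normc R).
Local Notation Re := (@complex.Re R).
Local Notation Im := (@complex.Im R).
Local Notation "x %:C" := (Complex x 0) : ring_scope.
Local Notation e := (@unit_pt R).
Implicit Types (z w c d : C) (f g : C -> C) (u : R -> C) (r t rho : R) (D : nat -> C -> C).

Lemma climX p z d n : clim p z d -> clim (fun w => p w ^+ n) z (d ^+ n).
Proof.
move=> hp; elim: n => [|n ih]; first exact: clim_cst.
have := climM hp ih; rewrite -exprS.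
by have -> : (fun w => p w * p w ^+ n) = (fun w => p w ^+ n.+1)
  by apply/funext => w; rewrite exprS.
Qed.

Lemma cpt_neq w r t : r != 0 -> cpt w r t - w != 0.
Proof. by move=> r0; rewrite cptK mulf_neq0 ?realC_neq0 ?unit_neq0. Qed.

Lemma continuous_laurent f w r m : (forall t, clim f (cpt w r t) (f (cpt w r t))) ->
  r != 0 -> continuous (fun t => Re (f (cpt w r t) * ((cpt w r t - w)^-1) ^+ m)).
Proof.
move=> hf r0; apply: (@continuous_Re_cpt _ (fun z => f z * ((z - w)^-1) ^+ m)) => t.
apply: climM => //; apply: climX; apply: climV; first exact: cpt_neq.
apply: climD; [exact: clim_id|exact: clim_cst].
Qed.

(** The function [H] takes the same value at both ends of the parametrized circle, so its derivative
    along the circle has mean 0. The factor [k^-1], with [k = 2 pi i], compensates the speed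
    [k * (z - w)] of the parametrization. *)
Lemma mean_by_parts f F w rho r m : has_cderiv f F w rho -> 0 < r < rho ->
  rint 0 1 (fun t => Re (F (cpt w r t) * ((cpt w r t - w)^-1) ^+ m)) =
  m.+1%:R * rint 0 1 (fun t => Re (f (cpt w r t) * ((cpt w r t - w)^-1) ^+ m.+1)).
Proof.
move=> hf /andP[r0 rrho]; have rn0 := lt0r_neq0 r0.
have inB t : nc (cpt w r t - w) < rho by rewrite nc_cpt// ltW.
have pi2 : 2 * pi != 0 :> R by rewrite mulf_neq0// gt_eqF// pi_gt0.
pose k : C := Complex 0 (2 * pi).
have k0 : k != 0 by rewrite eq_complex/= negb_and pi2 orbT.
pose H z := k^-1 * (f z * ((z - w)^-1) ^+ m.+1).
pose g1 t := Re (F (cpt w r t) * ((cpt w r t - w)^-1) ^+ m).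
pose g2 t := Re (f (cpt w r t) * ((cpt w r t - w)^-1) ^+ m.+1).
have cg1 : continuous g1.
  by apply: continuous_laurent => // t; exact: (cderiv_clim hf).
have cg2 : continuous g2.
  by apply: continuous_laurent => // t; exact: cdiff_clim (hf _ (inB t)).
have cg2' : continuous (fun t => m.+1%:R * g2 t).
  by move=> t; apply: cvgM; [exact: cvg_cst|exact: cg2].
have dH t : is_derive t (1 : R) (fun t => Re (H (cpt w r t))) (g1 t - m.+1%:R * g2 t).
  have zw := cpt_neq w t rn0.
  have h1 : cdiff (fun z => z - w) (cpt w r t) (1 - 0).
    by apply: cdiffB; [exact: cdiff_id|exact: cdiff_cst].
  have h2 := @cdiffX _ (fun z => (z - w)^-1) _ _ m (@cdiffV _ (fun z => z - w) _ _ zw h1).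
  have h3 := cdiffZ k^-1 (cdiffM (hf _ (inB t)) h2).
  have := rdiff_Re (rdiff_comp (rdiff_cpt w r t) h3).
  rewrite /g1 /g2 -(cptK w) -/k.
  have -> : m.+1%:R * Re (f (cpt w r t) * (cpt w r t - w)^-1 ^+ m.+1) =
     Re (m.+1%:R * (f (cpt w r t) * (cpt w r t - w)^-1 ^+ m.+1)).
    rewrite -cReZ; congr (Re (_ * _)); elim: m.+1 => // n ih.
    by rewrite -!natr1 -ih; apply/eqP; rewrite eq_complex/= addr0 !eqxx.
  rewrite -cReB.
  suff -> : F (cpt w r t) * (cpt w r t - w)^-1 ^+ m -
      m.+1%:R * (f (cpt w r t) * (cpt w r t - w)^-1 ^+ m.+1) =
    k^-1 * (F (cpt w r t) * (cpt w r t - w)^-1 ^+ m.+1 +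
      f (cpt w r t) * (m.+1%:R * (cpt w r t - w)^-1 ^+ m *
        (- (1 - 0) / (cpt w r t - w) ^+ 2))) * (k * (cpt w r t - w)) by [].
  rewrite !exprS; set x := cpt w r t - w in zw *; set X := x^-1 ^+ m.
  by rewrite subr0; field; rewrite zw k0.
have := rint_FTC ler01 dH _.
rewrite cpt1 subrr.
have cB : continuous (fun t => g1 t - m.+1%:R * g2 t).
  by move=> t; apply: cvgB; [exact: cg1|exact: cg2'].
move=> /(_ cB); rewrite rintB; [|exact: continuous_subspaceT|exact: continuous_subspaceT].
rewrite rintZ; last exact: continuous_subspaceT.
by move=> /eqP; rewrite subr_eq0 => /eqP.
Qed.

(** The derivatives of all orders are carried as one sequence, so that a statement about [D 0] and
    [D m] applies at once to [D j] and [D (j + m)] by a shift. *)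
Definition hol_seq D w rho := forall j, has_cderiv (D j) (D j.+1) w rho.

(** Each integration by parts trades one negative power of [z - w] for one derivative and a factor
    of the factorial; the case [m = 0] is the mean value property. *)
Lemma cauchy_coef D w rho r m j : hol_seq D w rho -> 0 < r < rho ->
  rint 0 1 (fun t => Re (D j (cpt w r t) * ((cpt w r t - w)^-1) ^+ m)) =
  Re (D (j + m)%N w) / m`!%:R.
Proof.
move=> hD rr; elim: m j => [|m ih] j.
  rewrite addn0 fact0 divr1 -(@mean_value _ (D j) w rho _ r rr); last first.
    by move=> z hz; exists (D j.+1 z); exact: hD.
  by apply: eq_rint => t _; rewrite expr0 mulr1.
have := ih j.+1; rewrite (mean_by_parts m (hD j) rr) addSnnS => H.
apply: (mulfI (x := m.+1%:R)); first by rewrite pnatr_eq0.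
by rewrite H factS natrM invfM [RHS]mulrCA [_ * (_ * m`!%:R^-1)]mulrA divff ?pnatr_eq0// mul1r.
Qed.

Lemma hol_seqZ c D w rho : hol_seq D w rho -> hol_seq (fun j z => c * D j z) w rho.
Proof. by move=> hD j; apply: has_cderivZ. Qed.

Lemma inv_conj z : nc z = 1 -> z^-1 = Complex (Re z) (- Im z).
Proof.
move=> z1; have z0 : z != 0 by apply/eqP => E; move: z1; rewrite E nc0 => /eqP; rewrite eq_sym oner_eq0.
apply: (mulfI z0); rewrite mulfV//; apply/eqP.
rewrite eq_complex cReM cImM/= mulrN opprK -!expr2 -nc_sqr z1 expr1n.
by rewrite mulrN [Im z * _]mulrC addrC subrr !eqxx.
Qed.

(* Duality: [D 0] is integrated against [K = al + be u^-m - conj (be) u^m], where [u = e t].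
   As [be u^-m - conj (be u^-m)] is imaginary, [al^2 + 4 |be|^2 = 1] gives [|K| <= 1], and
   the term in [u^m] integrates to 0. *)
Lemma mean_nc_ge D w rho r m : hol_seq D w rho -> 0 < r < rho -> (0 < m)%N ->
  nc (D 0%N w) ^+ 2 + 4^-1 * (r ^+ m / m`!%:R * nc (D m w)) ^+ 2 <=
  rint 0 1 (fun t => nc (D 0%N (cpt w r t))) ^+ 2.
Proof.
move=> hD rr m0; have /andP[r0 rrho] := rr.
have inB t : nc (cpt w r t - w) < rho by rewrite nc_cpt// ltW.
have cD t : clim (D 0%N) (cpt w r t) (D 0%N (cpt w r t)) by exact: cdiff_clim (hD 0%N _ (inB t)).
set A := nc (D 0%N w); set B := _ * nc (D m w).
have A0 : 0 <= A := nc_ge0 _.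
have B0 : 0 <= B by rewrite mulr_ge0 ?nc_ge0// divr_ge0// exprn_ge0// ltW.
set I := rint _ _ _.
have I0 : 0 <= I by apply: rint_ge0 => t _; exact: nc_ge0.
set S2 := A ^+ 2 + _.
have S20 : 0 <= S2 by rewrite addr_ge0 ?sqr_ge0// mulr_ge0 ?sqr_ge0// invr_ge0.
have [S0|Sp] := leP S2 0; first by rewrite (le_trans S0)// sqr_ge0.
pose S := Num.sqrt S2; have Spos : 0 < S by rewrite sqrtr_gt0.
have SS : S ^+ 2 = S2 by rewrite sqr_sqrtr.
rewrite -SS ler_sqr ?nnegrE ?(ltW Spos)//.
have [c0 c01 c0E] := nc_rot (D 0%N w).
have [c1 c11 c1E] := nc_rot (c0 * D m w).
pose al := A / S; pose b := B / (4 * S).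
have al0 : 0 <= al by rewrite divr_ge0// ltW.
have b0 : 0 <= b by rewrite divr_ge0// mulr_ge0// ltW.
have ab1 : al ^+ 2 + 4 * b ^+ 2 = 1.
  have -> : al ^+ 2 + 4 * b ^+ 2 = S2 / S ^+ 2 by rewrite /al /b /S2; field; rewrite lt0r_neq0.
  by rewrite SS divff// lt0r_neq0.
have abS : al * A + b * B = S.
  have -> : al * A + b * B = S2 / S by rewrite /al /b /S2; field; rewrite lt0r_neq0.
  by rewrite -SS expr2 mulfK// lt0r_neq0.
pose be := b%:C * c1; pose be' := Complex (Re be) (- Im be).
pose K t := al%:C + be * (e t ^+ m)^-1 - be' * e t ^+ m.
have K1 t : nc (K t) <= 1.
  have em : nc (e t ^+ m) = 1 by rewrite ncX nc_unit expr1n.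
  have Ke : K t = Complex al (2 * Im (be * (e t ^+ m)^-1)).
    apply/eqP; rewrite /K /be' /be inv_conj// eq_complex.
    rewrite !(cReD, cImD, cReN, cImN, cReM, cImM)/=.
    apply/andP; split; apply/eqP; ring.
  rewrite -(expr_le1 (n := 2))// ?nc_ge0// nc_sqr Ke/= -[leRHS]ab1 lerD2l exprMn.
  have -> : (2 : R) ^+ 2 = 4 by rewrite -natrX.
  rewrite ler_pM2l// -[leLHS]real_normK ?num_real// ler_sqr ?nnegrE//.
  rewrite (le_trans (normIm_le _))// ncM ncV em invr1 mulr1 ncM c11 mulr1.
  by rewrite nc_real ger0_norm.
have hc k : hol_seq (fun j z => k * D j z) w rho by exact: hol_seqZ.
have ck (k : C) t : clim (fun z => k * D 0%N z) (cpt w r t) (k * D 0%N (cpt w r t)).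
  by apply: climM; [exact: clim_cst|exact: cD].
pose h1 t := Re (c0 * al%:C * D 0%N (cpt w r t)).
pose h2 t := Re (c0 * be * D 0%N (cpt w r t) * ((cpt w r t - w)^-1) ^+ m).
pose h3 t := Re (c0 * be' * D 0%N (cpt w r t) * e t ^+ m).
have I1 : rint 0 1 h1 = al * A.
  rewrite (@mean_value _ (fun z => c0 * al%:C * D 0%N z) w rho)//.
    by rewrite [c0 * _]mulrC -mulrA c0E cReZ.
  by move=> z hz; exists (c0 * al%:C * D 1%N z); exact: (hc (c0 * al%:C)) 0%N z hz.
have I2 : r ^+ m * rint 0 1 h2 = b * B.
  rewrite (@cauchy_coef (fun j z => c0 * be * D j z) w rho r m 0)//.
  have -> : c0 * be * D (0 + m)%N w = b%:C * (c1 * (c0 * D m w)) by rewrite /be add0n; ring.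
  by rewrite c1E cReZ ncM c01 mul1r /B /=; ring.
have I3 : rint 0 1 h3 = 0.
  have := @mean_pos _ (fun z => c0 * be' * D 0%N z) w rho m.-1 _ r rr.
  rewrite prednK//; apply=> z hz.
  by exists (c0 * be' * D 1%N z); exact: (hc (c0 * be')) 0%N z hz.
have ch1 : continuous h1.
  by apply: (@continuous_Re_cpt _ (fun z => c0 * al%:C * D 0%N z)) => t; exact: ck.
have ch2 : continuous h2.
  by apply: (@continuous_laurent (fun z => c0 * be * D 0%N z)); [move=> t; exact: ck|exact: lt0r_neq0].
have ch3 : continuous h3.
  have -> : h3 = fun t => Re ((fun z => c0 * be' * D 0%N z * ((z - w) / r%:C) ^+ m) (cpt w r t)).
    by apply/funext => t; rewrite /h3 -unit_cpt// lt0r_neq0.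
  apply: (@continuous_Re_cpt _ (fun z => c0 * be' * D 0%N z * ((z - w) / r%:C) ^+ m)) => t.
  apply: (@climM _ (fun z => c0 * be' * D 0%N z)); first exact: ck.
  apply: climX; apply: climM; last exact: clim_cst.
  by apply: climD; [exact: clim_id|exact: clim_cst].
have ch2' : continuous (fun t => r ^+ m * h2 t).
  by move=> t; apply: cvgM; [exact: cvg_cst|exact: ch2].
have ch12 : continuous (fun t => h1 t + r ^+ m * h2 t).
  by move=> t; apply: cvgD; [exact: ch1|exact: ch2'].
have -> : S = rint 0 1 (fun t => h1 t + r ^+ m * h2 t - h3 t).
  have cT (u : R -> R) : continuous u -> {within `[(0 : R), 1], continuous u}.
    exact: continuous_subspaceT.
  have E1 := rintB (cT _ ch12) (cT _ ch3).
  have E2 := rintD (cT _ ch1) (cT _ ch2').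
  have E3 := rintZ (r ^+ m) (cT _ ch2).
  by rewrite E1 E2 I3 subr0 -abS -I1 -I2; congr (_ + _).
apply: le_rint.
- by apply: continuous_subspaceT => t; apply: cvgB; [exact: ch12|exact: ch3].
- by apply: continuous_subspaceT; exact: continuous_nc_cpt.
move=> t _; rewrite /h1 /h2 /h3 -cReZ -cReD -cReB.
have -> : c0 * al%:C * D 0%N (cpt w r t) +
   (r ^+ m)%:C * (c0 * be * D 0%N (cpt w r t) * (cpt w r t - w)^-1 ^+ m) -
   c0 * be' * D 0%N (cpt w r t) * e t ^+ m = c0 * D 0%N (cpt w r t) * K t.
  rewrite cptK exprVn exprMn realCX invfM /K.
  have rm0 : (r ^+ m)%:C != 0 by rewrite realC_neq0// expf_neq0// lt0r_neq0.
  have em0 : e t ^+ m != 0 by rewrite expf_neq0// unit_neq0.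
  by field; rewrite rm0 em0.
by rewrite (le_trans (Re_le_nc _))// !ncM c01 mul1r ler_piMr// nc_ge0.
Qed.

Lemma complex_gt0 (x : C) : 0 < x -> exists2 y : R, 0 < y & x = y%:C.
Proof.
case: x => a b; rewrite ltcE/= => /andP[/eqP -> a0].
by exists a.
Qed.

Lemma derivable_cdiff (f : C^o -> C^o) (z : C) :
  derivable f z 1 -> cdiff f z (derive1 f z).
Proof.
move=> df eps e0.
have h : (h^-1 *: ((f \o shift z) (h *: (1 : C^o)) - f z) @[h --> (0 : C^o)^']) --> (derive1 f z : C^o).
  by rewrite derive1E; exact: df.
have e0' : (0 : C) < eps%:C by rewrite ltcE/= eqxx.
move/cvgrPdist_le : h => /(_ _ e0').
move=> /nbhs_ballP[del0 /= /complex_gt0[del d0 ->] hd]; exists del => // w wz.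
have [->|wz0] := eqVneq w z; first by rewrite !subrr mulr0 subr0 nc0 mulr0.
have wz0' : w - z != 0 by rewrite subr_eq0.
have := hd (w - z); rewrite /ball/= sub0r normrN.
have H : `|w - z| < del%:C by rewrite ltcE/= eqxx.
move=> /(_ H wz0').
rewrite /shift/= /GRing.scale/= mulr1 subrK lecE/= eqxx /= => k.
have -> : f w - f z - derive1 f z * (w - z) = - ((derive1 f z - (w - z)^-1 * (f w - f z)) * (w - z)).
  by rewrite mulrBl mulrAC mulVf// mul1r opprB.
by rewrite ncN ncM ler_wpM2r ?nc_ge0.
Qed.

Lemma cdiff_derivable (f : C^o -> C^o) (z d : C) : cdiff f z d ->
  derivable f z 1 /\ derive1 f z = d.
Proof.
move=> h.
have dF : (h^-1 *: ((f \o shift z) (h *: (1 : C^o)) - f z) @[h --> (0 : C^o)^']) --> (d : C^o).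
  apply/cvgrPdist_le => eps0 /complex_gt0[eps e0 ->]; have [del d0 hd] := h _ e0.
  have d0' : (0 : C) < del%:C by rewrite ltcE/= eqxx.
  apply/nbhs_ballP; exists del%:C => //= t; rewrite /ball/= sub0r normrN => td t0.
  have td' : nc t < del by move: td; rewrite ltcE/= => /andP[].
  have := hd (t + z); rewrite addrK => /(_ td').
  rewrite /shift/= /GRing.scale/= mulr1 lecE/= eqxx/=.
  have -> : f (t + z) - f z - d * t = - ((d - t^-1 * (f (t + z) - f z)) * t).
    by rewrite mulrBl mulrAC mulVf// mul1r opprB.
  by rewrite ncN ncM ler_pM2r// nc_gt0.
split; first by apply/cvg_ex; exists d.
by rewrite derive1E; exact: cvg_lim dF.
Qed.

(** Complex differentiability on the open disc alone yields derivatives of all orders, since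
    [cderiv_cdiffable] can be applied repeatedly. *)
Lemma holo_hol_seq (f : C^o -> C^o) : holo f -> hol_seq (fun j => derive1n j f : C -> C) 0 1.
Proof.
move=> hf; elim => [|j ih] z hz.
  apply: derivable_cdiff; apply: hf; rewrite /openDisc/=; by rewrite subr0 in hz.
have [d hd] := cderiv_cdiffable ih hz.
have [h1 h2] := cdiff_derivable hd.
by rewrite -h2 in hd; apply: hd.
Qed.

End cauchy_coef.

(** * Iterated integrals *)

Section tonelli_on.
Context d1 d2 (T1 : measurableType d1) (T2 : measurableType d2) (R : realType).
Variables (m1 : {sigma_finite_measure set T1 -> \bar R}) (m2 : {sigma_finite_measure set T2 -> \bar R}).
Variables (A : set T1) (B : set T2) (h : T1 * T2 -> R).
Hypotheses (mA : measurable A) (mB : measurable B).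
Hypotheses (mh : measurable_fun setT h) (h0 : forall z, 0 <= h z).
Local Open Scope ereal_scope.

Lemma measurable_section_integral :
  measurable_fun setT (fun x => \int[m2]_(y in B) (h (x, y))%:E).
Proof.
pose f (z : T1 * T2) : \bar R := ((h z * \1_B z.2)%R)%:E.
have f0 z : 0 <= f z by rewrite lee_fin mulr_ge0.
have mf : measurable_fun setT f.
  apply/measurable_EFinP; apply: measurable_funM => //.
  by apply: measurableT_comp => //; exact: measurable_indic.
have -> : (fun x => \int[m2]_(y in B) (h (x, y))%:E) = fubini_F m2 f.
  apply/funext => x; rewrite /fubini_F [LHS]integral_mkcond; apply: eq_integral => y _.
  by rewrite patchE /f/= indicE; case: ifPn => yB; rewrite ?mulr1 ?mulr0.
exact: measurable_fun_fubini_tonelli_F.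
Qed.

Lemma tonelli_on : \int[m1]_(x in A) \int[m2]_(y in B) (h (x, y))%:E =
  \int[m2]_(y in B) \int[m1]_(x in A) (h (x, y))%:E.
Proof.
pose f (z : T1 * T2) : \bar R := ((h z * (\1_A z.1 * \1_B z.2))%R)%:E.
have f0 z : 0 <= f z by rewrite lee_fin !mulr_ge0.
have mf : measurable_fun setT f.
  apply/measurable_EFinP; apply: measurable_funM => //.
  by apply: measurable_funM; apply: measurableT_comp => //; exact: measurable_indic.
transitivity (\int[m1]_x \int[m2]_y f (x, y)); last transitivity (\int[m2]_y \int[m1]_x f (x, y)).
- rewrite integral_mkcond; apply: eq_integral => x _.
  rewrite patchE; case: ifPn => xA.
    rewrite integral_mkcond; apply: eq_integral => y _.
    by rewrite patchE /f/= indicE xA mul1r indicE; case: ifPn => yB; rewrite ?mulr1 ?mulr0.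
  by rewrite integral0_eq// => y _; rewrite /f/= indicE (negbTE xA) mul0r mulr0.
- exact: fubini_tonelli.
rewrite [RHS]integral_mkcond; apply: eq_integral => y _.
rewrite patchE; case: ifPn => yB.
  rewrite [RHS]integral_mkcond; apply: eq_integral => x _.
  by rewrite patchE /f/= [\1_B y]indicE yB mulr1 indicE; case: ifPn => xA; rewrite ?mulr1 ?mulr0.
by rewrite integral0_eq// => x _; rewrite /f/= [\1_B y]indicE (negbTE yB) !mulr0.
Qed.

End tonelli_on.

(** * Borel sets of the plane, parameter integrals, polar coordinates and Jensen's inequality *)

Section plane.
Context {R : realType}.
Implicit Types (p s t : R).
Local Notation mu := (@lebesgue_measure R).

(** The plane carries the product sigma-algebra, in which an open set is measurable as the countable
    union of the boxes with rational centre and radius [1 / (n + 1)] that it contains. *)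
Lemma open_measurable2 (U : set (R * R)) : open U -> measurable U.
Proof.
move=> oU.
pose box (q : rat * rat * nat) : set (R * R) :=
  ball (ratr q.1.1 : R) (q.2.+1%:R^-1) `*` ball (ratr q.1.2 : R) (q.2.+1%:R^-1).
have -> : U = \bigcup_(q in [set: rat * rat * nat]) (if pselect (box q `<=` U) then box q else set0).
  apply/seteqP; split=> [[x y] Uxy|z [q _]]; last by case: pselect => // h; exact: h.
  have [e /= e0 he] := (nbhs_ballP _ _).1 (open_nbhs_nbhs (conj oU Uxy)).
  have [n hn] : exists n : nat, n.+1%:R^-1 < e / 2.
    exists (Num.truncn (e / 2)^-1).
    by rewrite invf_plt ?posrE ?divr_gt0// truncnS_gt.
  have n0 : 0 < (n.+1%:R^-1 : R) by rewrite invr_gt0.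
  have [a] : exists a, ball x (n.+1%:R^-1) (ratr a : R).
    have /rat_in_itvoo[a] : x - n.+1%:R^-1 < x + n.+1%:R^-1 by rewrite ltrD2l gtrN.
    rewrite in_itv/= => ha; by exists a; rewrite /ball/= ltr_distlC.
  move=> ha; have [b] : exists b, ball y (n.+1%:R^-1) (ratr b : R).
    have /rat_in_itvoo[b] : y - n.+1%:R^-1 < y + n.+1%:R^-1 by rewrite ltrD2l gtrN.
    rewrite in_itv/= => hb; by exists b; rewrite /ball/= ltr_distlC.
  move=> hb; exists (a, b, n) => //.
  have hbox : box (a, b, n) `<=` U.
    move=> [x' y'] [/= h1 h2]; apply: he; split => /=.
      by rewrite (splitr e); apply: ball_triangle (le_ball (ltW hn) ha) (le_ball (ltW hn) h1).
    by rewrite (splitr e); apply: ball_triangle (le_ball (ltW hn) hb) (le_ball (ltW hn) h2).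
  by case: pselect => [h|//]; split; exact: ball_sym.
apply: countable_bigcupT_measurable => [|q]; first exact: countableP.
case: pselect => [h|h] //=; apply: measurableX; apply: open_measurable; exact: ball_open.
Qed.

Lemma closed_measurable2 (U : set (R * R)) : closed U -> measurable U.
Proof. by move=> cU; rewrite -[U]setCK; apply: measurableC; apply: open_measurable2; exact: closed_openC. Qed.

Lemma within_continuous_measurable2 (D : set (R * R)) (f : R * R -> R) :
  measurable D -> {within D, continuous f} -> measurable_fun D f.
Proof.
move=> mD /continuousP cf; apply: (measurability _ (RGenOpens.measurableE R)).
move=> _ [_ [a [b ->] <-]].
have oab : open (`]a, b[%classic : set R) by exact: interval_open.
have [V oV VE] := (open_subspaceP _ _).1 (cf _ oab).
by rewrite setIC -VE; apply: measurableI => //; exact: open_measurable2.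
Qed.

Lemma continuous_measurable2 (f : R * R -> R) : continuous f -> measurable_fun setT f.
Proof.
by move=> cf; apply: within_continuous_measurable2 => //; exact: continuous_subspaceT.
Qed.

(** The parameter is confined to [D] because radii are: the means are also needed at radius 1, which
    is approached from inside only. *)
Lemma rint_param_within (h : R -> R -> R) (D : R -> Prop) x0 : D x0 ->
  (forall x, D x -> {within `[(0 : R), 1], continuous (h x)}) ->
  (forall t0, 0 <= t0 <= 1 -> forall eps : R, 0 < eps -> exists2 d : R, 0 < d &
    forall x t, D x -> `|x - x0| < d -> `|t - t0| < d -> `|h x t - h x0 t0| <= eps) ->
  forall eps : R, 0 < eps -> exists2 d : R, 0 < d & forall x, D x -> `|x - x0| < d ->
    `|rint 0 1 (h x) - rint 0 1 (h x0)| <= eps.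
Proof.
move=> Dx0 ch jh eps e0.
have [|d d0 hd] := @tube _ (fun d t => forall x, D x -> `|x - x0| < d -> `|h x t - h x0 t| <= eps).
  move=> t0 t01; have [d d0 hd] := jh t0 t01 _ (divr_gt0 e0 (ltr0Sn R 1)).
  exists d => // t d' _ td /andP[_ d'd] x Dx xd'.
  have k1 : `|h x t - h x0 t0| <= eps / 2 by apply: hd => //; exact: lt_trans d'd.
  have k2 : `|h x0 t - h x0 t0| <= eps / 2 by apply: hd => //; rewrite subrr normr0.
  have -> : h x t - h x0 t = (h x t - h x0 t0) - (h x0 t - h x0 t0) by ring.
  by rewrite (le_trans (ler_normB _ _))// [leRHS]splitr lerD.
exists d => // x Dx xd; rewrite -rintB; [|exact: ch|exact: ch].
rewrite -[eps]mulr1 -[X in _ * X]subr0; apply: rint_norm_le => //.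
  by move=> t; apply: cvgB; exact: ch.
by move=> t t01; apply: hd.
Qed.

Lemma rint_param_continuous (h : R -> R -> R) :
  continuous (fun z : R * R => h z.1 z.2) -> continuous (fun x => rint 0 1 (h x)).
Proof.
move=> ch.
have ch1' x : continuous (h x).
  move=> y; by apply: (@continuous2_cvg _ _ _ _ _ _ (fun=> x) id h); [exact: (ch (x, y))|exact: cvg_cst|exact: cvg_id].
move=> x0; apply: continuous_pointP => eps e0.
have h1 (x : R) : True -> {within `[(0 : R), 1], continuous (h x)}.
  by move=> _; exact: continuous_subspaceT.
have h2 (t0 : R) : 0 <= t0 <= 1 -> forall e1 : R, 0 < e1 -> exists2 d : R, 0 < d &
    forall x t, True -> `|x - x0| < d -> `|t - t0| < d -> `|h x t - h x0 t0| <= e1.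
  move=> _ e1 e10.
  have /cvgrPdist_le/(_ _ e10)/nbhs_ballP[d /= d0 hd] := ch (x0, t0).
  exists d => // x t _ xd td; rewrite distrC.
  by apply: (hd (x, t)); split; rewrite /ball/= distrC.
have [d d0 hd] := rint_param_within I h1 h2 e0.
by exists d => // x xd; exact: hd.
Qed.

Lemma rint_param_continuous2 (h : R -> R -> R) :
  continuous (fun z : R * R => h z.1 z.2) -> continuous (fun y => rint 0 1 (h ^~ y)).
Proof.
move=> ch; apply: (@rint_param_continuous (fun y x => h x y)) => z.
by apply: (@continuous2_cvg _ _ _ _ _ _ snd fst h); [exact: (ch (z.2, z.1))|exact: cvg_snd|exact: cvg_fst].
Qed.

Lemma rint_tonelli (h : R -> R -> R) : (forall x y, 0 <= h x y) ->
  continuous (fun z : R * R => h z.1 z.2) ->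
  rint 0 1 (fun x => rint 0 1 (h x)) = rint 0 1 (fun y => rint 0 1 (h ^~ y)).
Proof.
move=> h0 ch; have ch1 := rint_param_continuous ch.
have ch2 := rint_param_continuous2 ch.
pose D : set R := `[0, 1]%classic.
have mD : measurable D by exact: measurable_itv.
have ch1' x : continuous (h x).
  move=> y; by apply: (@continuous2_cvg _ _ _ _ _ _ (fun=> x) id h); [exact: (ch (x, y))|exact: cvg_cst|exact: cvg_id].
have ch2' y : continuous (h ^~ y).
  move=> x; by apply: (@continuous2_cvg _ _ _ _ _ _ id (fun=> y) h); [exact: (ch (x, y))|exact: cvg_id|exact: cvg_cst].
have iE (g : R -> R) : continuous g -> (\int[mu]_(x in D) (g x)%:E = (rint 0 1 g)%:E)%E.
  move=> cg; rewrite /rint /Rintegral fineK//; apply: integrable_fin_num => //.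
  exact/integrable_itv/continuous_subspaceT.
have := tonelli_on mu mu mD mD (continuous_measurable2 ch) (fun z => h0 z.1 z.2).
have -> : (\int[mu]_(x in D) \int[mu]_(y in D) (h x y)%:E)%E = (rint 0 1 (fun x => rint 0 1 (h x)))%:E.
  by rewrite -iE//; apply: eq_integral => x _; rewrite iE.
have -> : (\int[mu]_(y in D) \int[mu]_(x in D) (h x y)%:E)%E = (rint 0 1 (fun y => rint 0 1 (h ^~ y)))%:E.
  by rewrite -iE//; apply: eq_integral => y _; rewrite iE.
by case.
Qed.

Lemma rint_shift (h : R -> R) a b s : continuous h -> a <= b ->
  rint (a + s) (b + s) h = rint a b (fun t => h (t + s)).
Proof.
move=> ch ab; rewrite /rint /Rintegral; congr fine.
have dF x : is_derive x (1 : R) (fun t => t + s) 1.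
  apply: eps_is_derive => eps e0; exists 1 => // t _.
  have -> : t + s - (x + s) - 1 * (t - x) = 0 by ring.
  by rewrite normr0 mulr_ge0// ltW.
have F'E : (fun t : R => t + s)^`()%classic = cst 1.
  by apply/funext => x; rewrite derive1E; have [_ ->] := dF x.
rewrite (@integration_by_substitution_increasing R (fun t => t + s) h a b ab)//.
- by apply: eq_integral => x _; rewrite F'E/= mulr1.
- by move=> x y _ _ xy; rewrite ltrD2r.
- by rewrite F'E => x _; exact: cvg_cst.
- by rewrite F'E; exact: is_cvg_cst.
- by rewrite F'E; exact: is_cvg_cst.
- have cF : continuous (fun t : R => t + s).
    by move=> x; apply: cvgD; [exact: cvg_id|exact: cvg_cst].
  split; first by move=> x _; have [] := dF x.
  + by apply: cvg_at_right_filter; exact: cF.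
  + by apply: cvg_at_left_filter; exact: cF.
- exact: continuous_subspaceT.
Qed.

Lemma rint_periodic (h : R -> R) s : continuous h -> (forall t, h (t + 1) = h t) ->
  0 <= s <= 1 -> rint 0 1 (fun t => h (t + s)) = rint 0 1 h.
Proof.
move=> ch h1 /andP[s0 s1]; rewrite -rint_shift// add0r.
rewrite (@rint_cat _ s 1); [|by rewrite s1 lerDl|exact: continuous_subspaceT].
rewrite [1 + s]addrC -{2}[1]add0r rint_shift//.
rewrite (@rint_cat _ 0 s 1); [|by rewrite s0|exact: continuous_subspaceT].
by rewrite addrC; congr (_ + _); apply: eq_rint => t _; rewrite h1.
Qed.

Lemma unit_surj (z : R[i]) : exists2 s, 0 <= s <= 1 &
  z = Complex (Normc.normc z) 0 * unit_pt s.
Proof.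
have pi0 := pi_gt0 R; have pi20 : 0 < 2 * pi :> R by rewrite mulr_gt0.
have [->|z0] := eqVneq z 0.
  by exists 0; rewrite ?lexx ?ler01// nc0 mul0r.
have n0 := nc_gt0 z0; set n := Normc.normc z in n0 *.
suff [s s01 hs] : exists2 s, 0 <= s <= 1 & z / Complex n 0 = unit_pt s.
  by exists s => //; rewrite -hs mulrCA mulfV ?mulr1// realC_neq0// lt0r_neq0.
set w := z / _; have w1 : Normc.normc w = 1.
  by rewrite ncM ncV nc_real (gtr0_norm n0) divff// lt0r_neq0.
case: w w1 => a b ab1.
have ab : a ^+ 2 + b ^+ 2 = 1 by have := nc_sqr (Complex a b); rewrite ab1 expr1n/=.
have a1 : -1 <= a <= 1.
  rewrite -ler_norml -(@expr_le1 _ 2)// real_normK ?num_real// -ab lerDl sqr_ge0//.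
have [/andP[ac0 ac1] cac] := acos_def a1.
have sb : sin (acos a) = `|b|.
  by rewrite sin_acos// -ab addrAC subrr add0r sqrtr_sqr.
have twopi (x : R) : 2 * pi * (x / (2 * pi)) = x by rewrite mulrC divfK// lt0r_neq0.
have [b0|b0] := leP 0 b.
  exists (acos a / (2 * pi)).
    rewrite divr_ge0 ?(ltW pi20)//= ler_pdivrMr// mul1r (le_trans ac1)//.
    by lra.
  by rewrite /unit_pt twopi cac sb ger0_norm.
exists (1 - acos a / (2 * pi)).
  apply/andP; split; last by rewrite gerBl divr_ge0 // ltW.
  rewrite subr_ge0 ler_pdivrMr// mul1r (le_trans ac1)//.
  by lra.
have := unitD 1 (- (acos a / (2 * pi))).
rewrite unit1 mul1r => ->; rewrite /unit_pt mulrN twopi cosN sinN cac sb.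
by rewrite ltr0_norm// opprK.
Qed.

(** Convexity in tangent form: the graph of [x ^ p] lies above its tangent at [a]. By homogeneity
    this reduces to [p y <= y ^ p + (p - 1)], which is Young's inequality with second factor 1. *)
Lemma bernoulli_powR p (x a : R) : 1 <= p -> 0 <= x -> 0 < a ->
  a `^ p + p * a `^ (p - 1) * (x - a) <= x `^ p.
Proof.
move=> p1 x0 a0; have p0 : 0 < p by exact: lt_le_trans p1.
have an0 := lt0r_neq0 a0.
have key (y : R) : 0 <= y -> p * y <= y `^ p + (p - 1).
  move=> y0; move: p1; rewrite le_eqVlt => /predU1P[<-|p1].
    by rewrite mul1r subrr addr0 powRr1.
  have q0 : 0 < p / (p - 1) by rewrite divr_gt0// subr_gt0.
  have p10 : p - 1 != 0 by rewrite subr_eq0 gt_eqF.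
  have pq : p^-1 + (p / (p - 1))^-1 = 1.
    by field; rewrite p10 lt0r_neq0.
  have := @conjugate_powR R y 1 p (p / (p - 1)) y0 ler01 p0 q0 pq.
  rewrite mulr1 powR1 => h.
  have := ler_wpM2l (ltW p0) h.
  have -> // : p * (y `^ p / p + 1 / (p / (p - 1))) = y `^ p + (p - 1).
  by field; rewrite p10 lt0r_neq0.
have apE : a * a `^ (p - 1) = a `^ p by rewrite mulr_powRB1// ltW.
have xE : x `^ p = a `^ p * (x / a) `^ p.
  by rewrite -powRM ?divr_ge0 ?(ltW a0)// mulrC divfK.
rewrite xE; have := ler_wpM2l (powR_ge0 a p) (key (x / a) (divr_ge0 x0 (ltW a0))).
rewrite -apE; set P := a `^ (p - 1); set Y := (x / a) `^ p.
have -> : a * P * (p * (x / a)) = p * P * x by field.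
lra.
Qed.

(** The tangent inequality at the mean [a] is integrated; its linear term has integral 0. *)
Lemma rint_jensen p (u : R -> R) : 1 <= p -> (forall t, 0 <= u t) ->
  {within `[(0 : R), 1], continuous u} ->
  {within `[(0 : R), 1], continuous (fun t => u t `^ p)} ->
  rint 0 1 u `^ p <= rint 0 1 (fun t => u t `^ p).
Proof.
move=> p1 u0 cu cup; have p0 : 0 < p by exact: lt_le_trans p1.
set a := rint 0 1 u.
have : 0 <= a by apply: rint_ge0.
rewrite le_eqVlt => /predU1P[<-|a0].
  by rewrite powR0 ?gt_eqF//; apply: rint_ge0 => t _; exact: powR_ge0.
have cst (k : R) : {within `[(0 : R), 1], continuous (fun=> k : R)}.
  exact/continuous_subspaceT/cst_continuous.
have c1 : {within `[(0 : R), 1], continuous (fun t => u t - a)}.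
  by move=> t; apply: cvgB; [exact: cu|exact: cst].
have c2 : {within `[(0 : R), 1], continuous (fun t => p * a `^ (p - 1) * (u t - a))}.
  by move=> t; apply: cvgM; [exact: cst|exact: c1].
have -> : a `^ p = rint 0 1 (fun t => a `^ p + p * a `^ (p - 1) * (u t - a)).
  rewrite rintD// rintZ// rintB// !rint_cst// subr0 !mulr1.
  by rewrite -/a subrr mulr0 addr0.
apply: le_rint => //; last by move=> t _; exact: bernoulli_powR.
by move=> t; apply: cvgD; [exact: cst|exact: c2].
Qed.

Lemma cvg_powR (T : Type) (F : set_system T) {FF : Filter F} (u : T -> R) (l p : R) :
  0 < p -> (forall x, 0 <= u x) -> 0 <= l -> u x @[x --> F] --> l ->
  u x `^ p @[x --> F] --> l `^ p.
Proof.
move=> p0 u0 l0 ul; move: l0; rewrite le_eqVlt => /predU1P[l0|l0]; last first.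
  apply: (@cvg_comp _ _ _ u (fun x => x `^ p)); first exact: ul.
  have : differentiable (fun x : R => x `^ p) l.
    by apply/derivable1_diffP; have [] := is_derive1_powR p l0.
  exact: differentiable_continuous.
rewrite -l0 powR0 ?gt_eqF//; rewrite -l0 in ul.
apply/cvgrPdist_le => eps e0.
have e1 : 0 < eps `^ p^-1 by rewrite powR_gt0.
move/cvgrPdist_le : ul => /(_ _ e1); apply: filterS => x.
rewrite !sub0r !normrN !ger0_norm ?powR_ge0// => h.
rewrite -[leRHS]powRr1 ?(ltW e0)// -(mulVf (lt0r_neq0 p0)) powRrM.
by rewrite ge0_ler_powR// ?nnegrE ?powR_ge0// ltW.
Qed.

Lemma powR_epsdelta p (l eps : R) : 0 < p -> 0 <= l -> 0 < eps ->
  exists2 d : R, 0 < d & forall x, 0 <= x -> `|x - l| < d -> `|x `^ p - l `^ p| <= eps.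
Proof.
move=> p0 l0 e0.
have h : `|x| @[x --> l] --> l.
  by rewrite -{2}(ger0_norm l0); apply: norm_continuous.
have : (`|x| `^ p) @[x --> l] --> l `^ p by exact: cvg_powR.
move=> /cvgrPdist_le/(_ _ e0)/nbhs_ballP[d /= d0 hd].
exists d => // x x0 xl.
by rewrite distrC -{1}(ger0_norm x0); apply: hd; rewrite /ball/= distrC.
Qed.

End plane.

(** * Circle means of subharmonic functions *)

Section circle_means.
Context {R : realType}.
Local Notation C := (R[i]).
Local Notation nc := (@Normc.normc R).
Local Notation Re := (@complex.Re R).
Local Notation Im := (@complex.Im R).
Local Notation "x %:C" := (Complex x 0) : ring_scope.
Local Notation e := (@unit_pt R).
Implicit Types (z w c d : C) (f : C -> C) (u : R -> C) (r t rho p : R) (D : nat -> C -> C) (g : C -> R) (S : C -> Prop).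

Definition ccontS S g := forall z, S z -> forall eps : R, 0 < eps ->
  exists2 d : R, 0 < d & forall w, S w -> nc (w - z) < d -> `|g w - g z| <= eps.

Definition cavg g r := rint 0 1 (fun t => g (cpt 0 r t)).

Lemma ccontS_comp S g u : ccontS S g -> (forall t, S (u t)) -> (forall t, rcont u t) ->
  continuous (fun t => g (u t)).
Proof.
move=> cg Su cu t; apply: continuous_pointP => eps e0.
have [d d0 hd] := cg _ (Su t) _ e0.
have [d1 d10 hd1] := cu t _ (divr_gt0 d0 (ltr0Sn R 1)).
exists d1 => // s /hd1 h; apply: hd => //; apply: le_lt_trans h _.
by rewrite ltr_pdivrMr// mulrDr mulr1 ltrDl.
Qed.

Lemma nc_cpt0 r t : nc (cpt 0 r t) = `|r|.
Proof. by rewrite /cpt add0r ncM nc_real nc_unit mulr1. Qed.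

Lemma cpt_joint (x x0 t t0 : R) :
  nc (cpt 0 x t - cpt 0 x0 t0) <= `|x - x0| + `|x0| * nc (e t - e t0).
Proof.
have -> : cpt 0 x t - cpt 0 x0 t0 = (x - x0)%:C * e t + x0%:C * (e t - e t0).
  have -> : (x - x0)%:C = x%:C - x0%:C by apply/eqP; rewrite eq_complex/= subr0 !eqxx.
  by rewrite /cpt; ring.
by rewrite (le_trans (ncD _ _))// !ncM !nc_real nc_unit mulr1.
Qed.

Lemma cavg_within S g (Dr : R -> Prop) x0 : ccontS S g -> Dr x0 ->
  (forall x, Dr x -> forall t, S (cpt 0 x t)) ->
  forall eps : R, 0 < eps -> exists2 d : R, 0 < d & forall x, Dr x -> `|x - x0| < d ->
    `|cavg g x - cavg g x0| <= eps.
Proof.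
move=> cg Dx0 DS; apply: (@rint_param_within _ (fun x t => g (cpt 0 x t)) Dr) => //.
  move=> x Dx; apply: continuous_subspaceT; apply: (ccontS_comp cg) => t; first exact: DS.
  exact: rcont_cpt.
move=> t0 _ eps e0; have [d d0 hd] := cg _ (DS _ Dx0 t0) _ e0.
have k0 : 0 < 1 + `|x0| by rewrite ltr_pwDl.
have d20 : 0 < d / 2 by rewrite divr_gt0.
have [d1 d10 hd1] := rdiff_rcont (rdiff_unit t0) (divr_gt0 d20 k0).
exists (Num.min (d / 2) d1); first by rewrite lt_min d20.
move=> x t Dx; rewrite !lt_min => /andP[k1 _] /andP[_ /hd1 k2].
apply: hd; first exact: DS.
apply: le_lt_trans (cpt_joint _ _ _ _) _; rewrite [ltRHS]splitr ltr_leD//.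
rewrite -[leRHS](divfK (lt0r_neq0 k0)) mulrC ler_pM ?nc_ge0//.
by rewrite lerDr.
Qed.

Let disc z : Prop := nc z < 1.

Lemma within_continuous_epsP (A : set R) (h : R -> R) :
  (forall x0, A x0 -> forall eps : R, 0 < eps -> exists2 d : R, 0 < d &
    forall x, A x -> `|x - x0| < d -> `|h x - h x0| <= eps) ->
  {within A, continuous h}.
Proof.
move=> H; apply/subspace_continuousP => x0 Ax0.
apply/cvgrPdist_le => eps /(H _ Ax0)[d d0 hd].
apply/nbhs_ballP; exists d => //= x; rewrite /ball/= => xd Ax.
by rewrite distrC; apply: hd => //; rewrite distrC.
Qed.

Lemma plane_continuousP (h : R -> R -> R) :
  (forall x0 y0 (eps : R), 0 < eps -> exists2 d : R, 0 < d &
    forall x y, `|x - x0| < d -> `|y - y0| < d -> `|h x y - h x0 y0| <= eps) ->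
  continuous (fun z : R * R => h z.1 z.2).
Proof.
move=> H [x0 y0]; apply/cvgrPdist_le => eps /(H x0 y0)[d d0 hd].
exists (ball x0 d, ball y0 d); first by split; exact: nbhsx_ballx.
move=> [x y] [/= h1 h2].
by rewrite distrC; apply: hd; rewrite distrC.
Qed.

Lemma cavg_rot_point g z : ccontS disc g -> nc z < 1 ->
  rint 0 1 (fun t => g (e t * z)) = cavg g (nc z).
Proof.
move=> cg hz; have [s s01 zs] := unit_surj z.
rewrite /cavg -[RHS](@rint_periodic _ (fun t => g (cpt 0 (nc z) t)) s)//.
- apply: eq_rint => t _; congr g; rewrite /cpt add0r unitD {1}zs; ring.
- apply: (ccontS_comp cg) => t; last exact: rcont_cpt.
  by rewrite /disc nc_cpt0 ger0_norm ?nc_ge0.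
- by move=> t; rewrite /cpt unitD unit1 mulr1.
Qed.

Section rot.
Variables (g : C -> R) (r del : R).
Hypotheses (cg : ccontS disc g) (r0 : 0 <= r) (del0 : 0 <= del) (rd : r + del < 1).
Hypothesis g0 : forall z, 0 <= g z.

Let c (y : R) := cpt r%:C del y.
Let nc_c y : nc (c y) < 1.
Proof.
apply: le_lt_trans rd; apply: le_trans (ncD _ _) _.
by rewrite ncM !nc_real nc_unit mulr1 !ger0_norm.
Qed.

Let h x y := g (e x * c y).

Let ch : continuous (fun z : R * R => h z.1 z.2).
Proof.
apply: plane_continuousP => x0 y0 eps e0.
have dz : disc (e x0 * c y0) by rewrite /disc ncM nc_unit mul1r.
have [d d0 hd] := cg dz e0.
have d20 : 0 < d / 2 by rewrite divr_gt0.
have [d1 d10 h1] := rdiff_rcont (rdiff_unit x0) (divr_gt0 d20 (ltr0Sn R 1)).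
have [d2 d20' h2] := rcont_cpt r%:C del y0 (divr_gt0 d20 (ltr0Sn R 1)).
exists (Num.min d1 d2); first by rewrite lt_min d10.
move=> x y; rewrite !lt_min => /andP[/h1 k1 _] /andP[_ /h2 k2]; apply: hd.
  by rewrite /disc ncM nc_unit mul1r.
have -> : e x * c y - e x0 * c y0 = e x * (c y - c y0) + (e x - e x0) * c y0 by ring.
apply: le_lt_trans (ncD _ _) _; rewrite !ncM nc_unit mul1r.
have k3 : nc (e x - e x0) * nc (c y0) <= d / 2 / 2.
  by apply: le_trans (ler_piMr (nc_ge0 _) (ltW (nc_c _))) _.
apply: le_lt_trans (lerD k2 k3) _; rewrite -splitr ltr_pdivrMr//.
by rewrite mulrDr mulr1 ltrDl.
Qed.

Lemma cavg_nc_continuous : continuous (fun y => cavg g (nc (cpt r%:C del y))).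
Proof.
have -> : (fun y => cavg g (nc (cpt r%:C del y))) = (fun y => rint 0 1 (h ^~ y)).
  by apply/funext => y; rewrite -cavg_rot_point.
exact: rint_param_continuous2 ch.
Qed.

Lemma rint_rot t : 0 <= t <= 1 ->
  rint 0 1 (fun y => g (cpt (cpt 0 r t) del y)) = rint 0 1 (h t).
Proof.
move=> t01; rewrite -(@rint_periodic _ _ t)//.
- apply: eq_rint => y _; rewrite /h /c /cpt add0r unitD; congr g; ring.
- apply: (ccontS_comp cg) => y; last exact: rcont_cpt.
  rewrite /disc; apply: le_lt_trans rd; apply: le_trans (ncD _ _) _.
  by rewrite nc_cpt0 ncM nc_real nc_unit mulr1 !ger0_norm.
- by move=> y; rewrite /cpt unitD unit1 mulr1.
Qed.

(** Both sides average [h x y], the value of [g] at the point [c y] of the small circle about [r]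
    rotated by [x]. Averaging over [y] first gives small circles with centres on the circle of
    radius [r]; averaging over [x] first gives circles about the origin. *)
Lemma cavg_tonelli :
  rint 0 1 (fun t => rint 0 1 (fun y => g (cpt (cpt 0 r t) del y))) =
  rint 0 1 (fun y => cavg g (nc (cpt r%:C del y))).
Proof.
transitivity (rint 0 1 (fun t => rint 0 1 (h t))).
  by apply: eq_rint => t t01; rewrite rint_rot.
have h0 x y : 0 <= h x y by exact: g0.
rewrite (rint_tonelli h0 ch).
by apply: eq_rint => y _; exact: (cavg_rot_point cg (nc_c y)).
Qed.

Lemma rint_h_continuous : continuous (fun t => rint 0 1 (h t)).
Proof. exact: rint_param_continuous. Qed.

Lemma rint_rot_continuous :
  {within `[(0 : R), 1], continuous (fun t => rint 0 1 (fun y => g (cpt (cpt 0 r t) del y)))}.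
Proof.
apply: (@subspace_eq_continuous _ _ _ (fun t => rint 0 1 (h t))).
  by move=> t; rewrite inE/= in_itv/= => t01; rewrite /from_subspace rint_rot.
by apply: continuous_subspaceT; exact: rint_h_continuous.
Qed.

End rot.

Section mono.
Variable g : C -> R.
Hypotheses (cg : ccontS disc g) (g0 : forall z, 0 <= g z).
Hypothesis sub : forall z (del : R), 0 < del -> nc z + del < 1 ->
  g z <= rint 0 1 (fun y => g (cpt z del y)).

Let disc_cpt x : 0 <= x < 1 -> forall t, disc (cpt 0 x t).
Proof. by move=> /andP[x0 x1] t; rewrite /disc nc_cpt0 ger0_norm. Qed.

(** The radial function [cavg g (nc z)] inherits the sub-mean value property of [g]; this is the
    form in which the maximum principle uses it. *)
Lemma cavg_le_circle r (del : R) : 0 <= r -> 0 < del -> r + del < 1 ->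
  cavg g r <= rint 0 1 (fun y => cavg g (nc (cpt r%:C del y))).
Proof.
move=> r0 d0 rd; rewrite -cavg_tonelli//; last exact: ltW.
have r1 : r < 1 by apply: lt_trans rd; rewrite ltrDl.
apply: le_rint.
- apply: continuous_subspaceT; apply: (ccontS_comp cg) => t; last exact: rcont_cpt.
  by apply: disc_cpt; rewrite r0.
- exact: rint_rot_continuous (ltW d0) rd.
- by move=> t _; apply: sub => //; rewrite nc_cpt0 ger0_norm.
Qed.

(** The excess [del ^+ 2] over the value at the centre makes [eps * nc z ^+ 2] strictly subharmonic,
    which forbids an interior maximum. *)
Lemma rint_nc2 r (del : R) : 0 < del ->
  rint 0 1 (fun y => nc (cpt r%:C del y) ^+ 2) = r ^+ 2 + del ^+ 2.
Proof.
move=> d0.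
have E : (fun y => nc (cpt r%:C del y) ^+ 2) =
    (fun y => 2 * r * Re (cpt r%:C del y) + (del ^+ 2 - r ^+ 2)).
  apply/funext => y; rewrite nc_sqr /cpt cReD cImD cReM cImM.
  rewrite [Re (Complex _ _)]/complex.Re [Im (Complex _ _)]/complex.Im.
  rewrite [Re (Complex _ _)]/complex.Re [Im (Complex _ _)]/complex.Im.
  have : Re (e y) ^+ 2 + Im (e y) ^+ 2 = 1 by rewrite -nc_sqr nc_unit expr1n.
  move: (Re (e y)) (Im (e y)) => a b ab.
  have -> : (r + (del * a - 0 * b)) ^+ 2 + (0 + (del * b + 0 * a)) ^+ 2 =
    r ^+ 2 + 2 * r * del * a + del ^+ 2 * (a ^+ 2 + b ^+ 2) by ring.
  by rewrite ab; ring.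
have cRe : continuous (fun y => Re (cpt r%:C del y)).
  by apply: (@continuous_Re_cpt _ id) => t; exact: clim_id.
have cRe2 : continuous (fun y => 2 * r * Re (cpt r%:C del y)).
  by move=> y; apply: cvgM; [exact: cvg_cst|exact: cRe].
have cst (k : R) : {within `[(0 : R), 1], continuous (fun=> k : R)}.
  exact/continuous_subspaceT/cst_continuous.
rewrite E rintD//; last exact: continuous_subspaceT.
rewrite rintZ ?rint_cst//; last exact: continuous_subspaceT.
rewrite (@mean_value _ id r%:C (del + 1))//; last 2 first.
- by move=> z _; exists 1; exact: cdiff_id.
- by rewrite d0 ltrDl ltr01.
by rewrite /= subr0 mulr1; ring.
Qed.

(* Maximum principle for [cavg g + eps r^2], whose circle averages strictly exceed it. *)
Lemma cavg_mono r1 r2 : 0 <= r1 -> r1 <= r2 -> r2 < 1 -> cavg g r1 <= cavg g r2.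
Proof.
move=> r10 r12 r21; have r20 := le_trans r10 r12.
apply/ler_addgt0Pr => eps e0.
pose B x := cavg g x + eps * x ^+ 2.
have cB : {within `[0, r2], continuous B}.
  have cA : {within `[0, r2], continuous (cavg g)}.
    apply: within_continuous_epsP => x0 x0r eps1 e10.
    have [] := @cavg_within disc g (fun x => 0 <= x <= r2) x0 cg _ _ eps1 e10.
    - by move: x0r; rewrite /= in_itv.
    - move=> x /andP[x1 x2]; apply: disc_cpt; rewrite x1/=; exact: le_lt_trans r21.
    - move=> d d0 hd; exists d => // x; rewrite /= in_itv; exact: hd.
  have cq : {within `[0, r2], continuous (fun x : R => eps * x ^+ 2)}.
    apply: continuous_subspaceT => x; apply: cvgM; first exact: cvg_cst.
    exact: exprn_continuous.
  by move=> x; apply: cvgD; [exact: cA|exact: cq].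
have [xm] := EVT_max r20 cB; rewrite in_itv/= => /andP[xm0 xmr] Bmax.
have xmE : xm = r2.
  apply/eqP; rewrite eq_le xmr leNgt; apply/negP => xlt.
  (* The largest circle about [xm] on which the moduli stay at most [r2], so that [B xm] still
     dominates [B] there. *)
  pose del := (r2 - xm).
  have d0 : 0 < del by rewrite subr_gt0.
  have xd : xm + del < 1 by rewrite /del addrC subrK.
  have nb y : 0 <= nc (cpt xm%:C del y) <= r2.
    apply/andP; split; first exact: nc_ge0.
    apply: le_trans (ncD _ _) _; rewrite ncM !nc_real nc_unit mulr1.
    by rewrite !ger0_norm ?(ltW d0)// /del addrC subrK.
  have := cavg_le_circle xm0 d0 xd.
  have cc := cavg_nc_continuous cg xm0 (ltW d0) xd.
  have cn : continuous (fun y => nc (cpt xm%:C del y) ^+ 2).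
    move=> y; apply: cvgM; apply: (@continuous_nc_cpt _ id) => t; exact: clim_id.
  have cn2 : continuous (fun y => eps * nc (cpt xm%:C del y) ^+ 2).
    by move=> y; apply: cvgM; [exact: cvg_cst|exact: cn].
  have : rint 0 1 (fun y => cavg g (nc (cpt xm%:C del y)) + eps * nc (cpt xm%:C del y) ^+ 2) <= B xm.
    rewrite -[leRHS]mulr1 -[X in _ <= _ * X]subr0; apply: rint_le_cst => //.
      by apply: continuous_subspaceT => y; apply: cvgD; [exact: cc|exact: cn2].
    by move=> y _; apply: Bmax; rewrite in_itv/= nb.
  rewrite rintD; [|exact: continuous_subspaceT|exact: continuous_subspaceT].
  rewrite rintZ; last exact: continuous_subspaceT.
  rewrite rint_nc2// /B => h1 h2.
  have : 0 < eps * del ^+ 2 by rewrite mulr_gt0// exprn_gt0.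
  rewrite mulrDr in h1; lra.
have := Bmax r1; rewrite in_itv/= r10 r12 => /(_ isT).
rewrite /B xmE => h.
have h1 : 0 <= eps * r1 ^+ 2 by rewrite mulr_ge0 ?(ltW e0)// sqr_ge0.
have h2 : eps * r2 ^+ 2 <= eps.
  by rewrite -[leRHS]mulr1 ler_wpM2l ?(ltW e0)// exprn_ile1// ltW.
lra.
Qed.

End mono.
End circle_means.

(** * Growth of the means of a holomorphic function *)

Section powR_ineq.
Context {R : realType}.
Implicit Types (x y a b p q th : R).

(** Write [(x + y) ^ th] as [(x + y) * (x + y) ^ (th - 1)], distribute, and use that the power
    [th - 1] is nondecreasing. *)
Lemma powR_superadd x y th : 0 <= x -> 0 <= y -> 1 <= th ->
  x `^ th + y `^ th <= (x + y) `^ th.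
Proof.
move=> x0 y0 th1; have th0 : 0 < th by exact: lt_le_trans th1.
rewrite -(mulr_powRB1 x0 th0) -(mulr_powRB1 y0 th0) -(mulr_powRB1 (addr_ge0 x0 y0) th0) mulrDl.
by apply: lerD; apply: ler_wpM2l => //; apply: ge0_ler_powR;
   rewrite ?subr_ge0 ?nnegrE ?addr_ge0 ?lerDl ?lerDr.
Qed.

(** Hölder's inequality with exponents [1 / th] and [1 / (1 - th)]. Equality holds at
    [la = a / (a + b)], so the right side is a maximum of expressions linear in [a ^ th] and
    [b ^ th], and these can be integrated. *)
Lemma powR_weighted a b th la : 0 <= a -> 0 <= b -> 0 < th < 1 -> 0 <= la <= 1 ->
  la `^ (1 - th) * a `^ th + (1 - la) `^ (1 - th) * b `^ th <= (a + b) `^ th.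
Proof.
move=> a0 b0 /andP[th0 th1] /andP[la0 la1].
have t1 : 0 < 1 - th by rewrite subr_gt0.
have tn : th != 0 by rewrite gt_eqF.
have tn1 : 1 - th != 0 by rewrite gt_eqF.
have := @hoelder2 R (a `^ th) (b `^ th) (la `^ (1 - th)) ((1 - la) `^ (1 - th))
  th^-1 (1 - th)^-1 (powR_ge0 _ _) (powR_ge0 _ _) (powR_ge0 _ _) (powR_ge0 _ _).
rewrite !invr_gt0 !invrK => /(_ th0 t1).
have -> : th + (1 - th) = 1 by ring.
move=> /(_ erefl); rewrite -!powRrM !mulfV// !powRr1 ?subr_ge0//.
have -> : la + (1 - la) = 1 by ring.
by rewrite powR1 mulr1 [la `^ _ * _]mulrC [(1 - la) `^ _ * _]mulrC.
Qed.

Lemma rint01_le (f : R -> R) (M : R) : {within `[(0 : R), 1], continuous f} ->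
  (forall x, 0 <= x <= 1 -> f x <= M) -> rint 0 1 f <= M.
Proof. by move=> cf /(rint_le_cst ler01 cf); rewrite subr0 mulr1. Qed.

(** [powR_weighted] is integrated with the constant weight [la] equal to the share of the first term
    in the left side [S]; the weighted combination of the two integrals is then exactly [S ^ th]. *)
Lemma rint_rev_minkowski (u v : R -> R) th : 0 < th < 1 ->
  (forall t, 0 <= u t) -> (forall t, 0 <= v t) ->
  {within `[(0 : R), 1], continuous (fun t => u t `^ th)} ->
  {within `[(0 : R), 1], continuous (fun t => v t `^ th)} ->
  {within `[(0 : R), 1], continuous (fun t => (u t + v t) `^ th)} ->
  rint 0 1 (fun t => u t `^ th) `^ th^-1 + rint 0 1 (fun t => v t `^ th) `^ th^-1 <=
  rint 0 1 (fun t => (u t + v t) `^ th) `^ th^-1.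
Proof.
move=> th01 u0 v0 cu cv cuv; have /andP[th0 th1] := th01.
have tn : th != 0 by rewrite gt_eqF.
set X := rint 0 1 (fun t => u t `^ th); set Y := rint 0 1 (fun t => v t `^ th).
set Z := rint 0 1 _.
have X0 : 0 <= X by apply: rint_ge0 => t _; exact: powR_ge0.
have Y0 : 0 <= Y by apply: rint_ge0 => t _; exact: powR_ge0.
have Z0 : 0 <= Z by apply: rint_ge0 => t _; exact: powR_ge0.
set S := X `^ _ + _.
have : 0 <= S by rewrite addr_ge0 ?powR_ge0.
rewrite le_eqVlt => /predU1P[<-|S0]; first exact: powR_ge0.
have Sn : S != 0 by rewrite gt_eqF.
pose la := X `^ th^-1 / S.
have la0 : 0 <= la by rewrite divr_ge0 ?powR_ge0 ?ltW.
have la1 : la <= 1 by rewrite ler_pdivrMr// mul1r lerDl powR_ge0.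
have la' : 1 - la = Y `^ th^-1 / S by rewrite /la -{1}(divff Sn) -mulrBl /S [_ + Y `^ _]addrC addrK.
have inv x : 0 <= x -> (x `^ th^-1) `^ th = x by move=> ?; rewrite -powRrM mulVf// powRr1.
have XE : X = (la * S) `^ th by rewrite /la divfK// inv.
have YE : Y = ((1 - la) * S) `^ th by rewrite la' divfK// inv.
suff h : S `^ th <= Z.
  rewrite -[leLHS]powRr1 ?(ltW S0)// -(divff tn) powRrM.
  by rewrite ge0_ler_powR ?nnegrE ?powR_ge0// invr_ge0 ltW.
have pw k x : 0 <= x -> 0 <= k <= 1 -> k `^ (1 - th) * (k * x) `^ th = k * x `^ th.
  move=> x0 /andP[k0 k1]; rewrite powRM// mulrA.
  have [->|kn] := eqVneq k 0; first by rewrite [0 `^ th]powR0// mulr0 !mul0r.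
  by rewrite -powRD ?kn ?implybT// subrK powRr1.
have -> : S `^ th = rint 0 1 (fun t => la `^ (1 - th) * u t `^ th + (1 - la) `^ (1 - th) * v t `^ th).
  rewrite rintD ?rintZ//; last 2 first.
    by move=> t; apply: cvgM; [exact: cvg_cst|exact: cu].
    by move=> t; apply: cvgM; [exact: cvg_cst|exact: cv].
  rewrite -/X -/Y XE YE !pw ?(ltW S0) ?la0 ?la1 ?subr_ge0 ?la1 ?gerBl//.
  by rewrite -mulrDl addrC subrK mul1r.
apply: le_rint => //.
  move=> t; apply: cvgD; apply: cvgM; try exact: cvg_cst; [exact: cu|exact: cv].
by move=> t _; apply: powR_weighted => //; rewrite la0.
Qed.

End powR_ineq.

(** * From the gain at a point to the gain of the circle means *)

Section growth.
Context {R : realType}.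
Local Notation C := (R[i]).
Local Notation nc := (@Normc.normc R).
Local Notation Re := (@complex.Re R).
Local Notation "x %:C" := (Complex x 0) : ring_scope.
Variables (D : nat -> C -> C) (p : R).
Hypotheses (hD : hol_seq D 0 1) (p1 : 1 <= p).
Let p0 : 0 < p. Proof. exact: lt_le_trans p1. Qed.
Let disc (z : C) : Prop := nc z < 1.

Lemma ccontS_powR (S : C -> Prop) (f : C -> C) q : 0 < q ->
  (forall z, S z -> forall eps : R, 0 < eps -> exists2 d : R, 0 < d &
     forall w, S w -> nc (w - z) < d -> nc (f w - f z) <= eps) ->
  ccontS S (fun z => nc (f z) `^ q).
Proof.
move=> q0 cf z Sz eps e0.
have [d d0 hd] := powR_epsdelta q0 (nc_ge0 (f z)) e0.
have [d1 d10 h1] := cf z Sz _ (divr_gt0 d0 (ltr0Sn R 1)).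
exists d1 => // w Sw /(h1 _ Sw) k; apply: hd; first exact: nc_ge0.
apply: le_lt_trans (nc_dist_le _ _) _; apply: le_lt_trans k _.
by rewrite ltr_pdivrMr// mulrDr mulr1 ltrDl.
Qed.

Lemma hol_clim j z : disc z -> clim (D j) z (D j z).
Proof. by move=> hz; apply: cdiff_clim (@hD j _ _); rewrite subr0. Qed.

Lemma ccont_hol j q : 0 < q -> ccontS disc (fun z => nc (D j z) `^ q).
Proof.
move=> q0; apply: ccontS_powR => // z hz eps /(hol_clim j hz)[d d0 hd].
by exists d => // w _; exact: hd.
Qed.

Lemma hol_seq_at j (w : C) : disc w -> hol_seq (fun i => D (j + i)) w (1 - nc w).
Proof.
move=> hw i z hz; have := @has_cderiv_shrink _ _ _ 0 1 w (@hD (j + i)%N).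
by rewrite subr0 addnS => /(_ hw); apply.
Qed.

Lemma disc_cpt z (del : R) t : 0 <= del -> nc z + del < 1 -> disc (cpt z del t).
Proof.
move=> d0 h; rewrite /disc; apply: le_lt_trans (ncD _ _) _.
by rewrite ncM nc_real nc_unit mulr1 ger0_norm.
Qed.

Lemma continuous_nc_hol j q z (del : R) : 0 < q -> 0 <= del -> nc z + del < 1 ->
  continuous (fun t => nc (D j (cpt z del t)) `^ q).
Proof.
move=> q0 d0 h; apply: (ccontS_comp (ccont_hol j q0)) => t; first exact: disc_cpt.
exact: rcont_cpt.
Qed.

Lemma nc_mean_le j z (del : R) : 0 < del -> nc z + del < 1 ->
  nc (D j z) <= rint 0 1 (fun t => nc (D j (cpt z del t))).
Proof.
move=> d0 h; have hz : disc z by apply: lt_trans h; rewrite ltrDl.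
have cn : continuous (fun t => nc (D j (cpt z del t))).
  by apply: continuous_nc_cpt => t; apply: hol_clim; apply: disc_cpt => //; exact: ltW.
apply: nc_le_Re => c c1.
rewrite -(@mean_value _ (fun z => c * D j z) z (1 - nc z) _ del); last 2 first.
- move=> w hw; exists (c * D j.+1 w); apply: cdiffZ.
  by have := hol_seq_at j hz 0%N hw; rewrite addn0 addn1.
- by rewrite d0 ltrBrDl.
apply: le_rint; [|exact: continuous_subspaceT|].
  apply: continuous_subspaceT; apply: (@continuous_Re_cpt _ (fun z => c * D j z)) => t.
  by apply: climM; [exact: clim_cst|apply: hol_clim; apply: disc_cpt => //; exact: ltW].
by move=> t _; rewrite (le_trans (Re_le_nc _))// ncM c1 mul1r.
Qed.

Lemma nc_powR_sub j z (del : R) : 0 < del -> nc z + del < 1 ->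
  nc (D j z) `^ p <= rint 0 1 (fun t => nc (D j (cpt z del t)) `^ p).
Proof.
move=> d0 h.
have c1 : continuous (fun t => nc (D j (cpt z del t))).
  by apply: continuous_nc_cpt => t; apply: hol_clim; apply: disc_cpt => //; exact: ltW.
apply: le_trans (rint_jensen p1 _ _ _).
- rewrite ge0_ler_powR ?nnegrE ?nc_ge0 ?(ltW p0)//; last exact: nc_mean_le.
  by apply: rint_ge0 => t _; exact: nc_ge0.
- by move=> t; exact: nc_ge0.
- exact: continuous_subspaceT.
- by apply: continuous_subspaceT; apply: continuous_nc_hol => //; exact: ltW.
Qed.

Lemma cavg_hol_mono j r1 r2 : 0 <= r1 -> r1 <= r2 -> r2 < 1 ->
  cavg (fun z => nc (D j z) `^ p) r1 <= cavg (fun z => nc (D j z) `^ p) r2.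
Proof.
apply: cavg_mono; first exact: ccont_hol.
- by move=> z; exact: powR_ge0.
- by move=> z del d0 h; exact: nc_powR_sub.
Qed.

(** [mean_nc_ge] for the shifted sequence, raised to the power [p / 2] and followed by Jensen's
    inequality. The 2 in the denominator is the square root of the factor [4^-1] there, moved into
    the square. *)
Lemma growth_point j m z (del : R) : (0 < m)%N -> 0 < del -> nc z + del < 1 ->
  (nc (D j z) ^+ 2 + (del ^+ m / (2 * m`!%:R) * nc (D (j + m) z)) ^+ 2) `^ (p / 2) <=
  rint 0 1 (fun t => nc (D j (cpt z del t)) `^ p).
Proof.
move=> m0 d0 h; have hz : disc z by apply: lt_trans h; rewrite ltrDl.
have c1 : continuous (fun t => nc (D j (cpt z del t))).
  by apply: continuous_nc_cpt => t; apply: hol_clim; apply: disc_cpt => //; exact: ltW.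
have I0 : 0 <= rint 0 1 (fun t => nc (D j (cpt z del t))) by apply: rint_ge0 => t _; exact: nc_ge0.
apply: le_trans (rint_jensen p1 _ _ _); last 3 first.
- by move=> t; exact: nc_ge0.
- exact: continuous_subspaceT.
- by apply: continuous_subspaceT; apply: continuous_nc_hol => //; exact: ltW.
have -> : rint 0 1 (fun t => nc (D j (cpt z del t))) `^ p =
    (rint 0 1 (fun t => nc (D j (cpt z del t))) ^+ 2) `^ (p / 2).
  by rewrite -powR_mulrn// -powRrM mulrCA divff// mulr1.
rewrite ge0_ler_powR ?divr_ge0 ?(ltW p0)// ?nnegrE ?addr_ge0 ?sqr_ge0//.
have := @mean_nc_ge _ (fun i => D (j + i)%N) z (1 - nc z) del m (hol_seq_at j hz) _ m0.
rewrite addn0 d0 ltrBrDl => /(_ h); apply: le_trans; rewrite lerD2l.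
rewrite le_eqVlt; apply/orP; left; apply/eqP.
by rewrite invfM; field; rewrite pnatr_eq0 -lt0n fact_gt0.
Qed.

Definition Qexp (q : R) := Num.max q 2.

(* The two terms of [growth_point] are separated by superadditivity of [x ^ (p/2)] when
   [p >= 2], and by the reverse Minkowski inequality with exponent [p/2] when [p < 2]. *)
Lemma growth_cavg j m r (del : R) : (0 < m)%N -> 0 <= r -> 0 < del -> r + del < 1 ->
  cavg (fun z => nc (D j z) `^ p) r `^ (Qexp p / p) +
  cavg (fun z => (del ^+ m / (2 * m`!%:R) * nc (D (j + m) z)) `^ p) r `^ (Qexp p / p) <=
  cavg (fun z => nc (D j z) `^ p) (r + del) `^ (Qexp p / p).
Proof.
move=> m0 r0 d0 rd; have r1 : r < 1 by apply: lt_trans rd; rewrite ltrDl.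
set k := del ^+ m / _.
have k0 : 0 <= k by rewrite divr_ge0 ?mulr_ge0// exprn_ge0// ltW.
pose g z := nc (D j z) `^ p.
have cg : ccontS disc g by exact: ccont_hol.
pose A t := nc (D j (cpt 0 r t)) ^+ 2.
pose B t := (k * nc (D (j + m) (cpt 0 r t))) ^+ 2.
have ncr t : nc (cpt 0 r t) = r by rewrite nc_cpt0 ger0_norm.
have dr t : disc (cpt 0 r t) by rewrite /disc ncr.
have c1 i : continuous (fun t => nc (D i (cpt 0 r t))).
  by apply: continuous_nc_cpt => t; apply: hol_clim; exact: dr.
have cA : continuous A by move=> t; apply: cvgM; exact: c1.
have ckB : continuous (fun t => k * nc (D (j + m) (cpt 0 r t))).
  by move=> t; apply: cvgM; [exact: cvg_cst|exact: c1].
have cB : continuous B by move=> t; apply: cvgM; exact: ckB.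
have cAB : continuous (fun t => A t + B t) by move=> t; apply: cvgD; [exact: cA|exact: cB].
have p20 : 0 < p / 2 by rewrite divr_gt0.
have cpw (u : R -> R) : (forall t, 0 <= u t) -> continuous u ->
    {within `[(0 : R), 1], continuous (fun t => u t `^ (p / 2))}.
  move=> u0 cu; apply: continuous_subspaceT => t.
  by apply: cvg_powR => //; exact: cu.
have cAp := cpw A (fun t => sqr_ge0 _) cA.
have cBp := cpw B (fun t => sqr_ge0 _) cB.
have cABp := cpw (fun t => A t + B t) (fun t => addr_ge0 (sqr_ge0 _) (sqr_ge0 _)) cAB.
have sq x : 0 <= x -> (x ^+ 2) `^ (p / 2) = x `^ p.
  by move=> x0; rewrite -powR_mulrn// -powRrM mulrCA divff// mulr1.
have EA : cavg g r = rint 0 1 (fun t => A t `^ (p / 2)).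
  by apply: eq_rint => t _; rewrite /A (sq _ (nc_ge0 _)).
have EB : cavg (fun z => (k * nc (D (j + m) z)) `^ p) r = rint 0 1 (fun t => B t `^ (p / 2)).
  by apply: eq_rint => t _; rewrite /B (sq _ (mulr_ge0 k0 (nc_ge0 _))).
have Q0 : 0 <= Qexp p by rewrite /Qexp le_max (ltW p0).
have Qp0 : 0 <= Qexp p / p := divr_ge0 Q0 (ltW p0).
rewrite -/g EA EB.
have I0 (u : R -> R) : 0 <= rint 0 1 (fun t => u t `^ (p / 2)).
  by apply: rint_ge0 => t _; exact: powR_ge0.
have step : rint 0 1 (fun t => A t `^ (p / 2)) `^ (Qexp p / p) +
    rint 0 1 (fun t => B t `^ (p / 2)) `^ (Qexp p / p) <=
    rint 0 1 (fun t => (A t + B t) `^ (p / 2)) `^ (Qexp p / p).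
  have [p2|p2] := leP 2 p.
    have -> : Qexp p / p = 1 by rewrite /Qexp (max_l p2) divff ?lt0r_neq0.
    have IAB := rintD cAp cBp; have := I0 (fun t => A t + B t).
    have le_AB : rint 0 1 (fun t => A t `^ (p / 2) + B t `^ (p / 2)) <=
        rint 0 1 (fun t => (A t + B t) `^ (p / 2)).
      apply: le_rint; [|exact: cABp|].
      - by move=> t; apply: cvgD; [exact: cAp|exact: cBp].
      - have p2' : 1 <= p / 2 by rewrite ler_pdivlMr ?mul1r.
        by move=> t _; exact: (powR_superadd (sqr_ge0 _) (sqr_ge0 _) p2').
    move: (I0 A) (I0 B) le_AB; rewrite IAB.
    move: (rint 0 1 (fun t => A t `^ (p / 2))) (rint 0 1 (fun t => B t `^ (p / 2))).
    move: (rint 0 1 (fun t => (A t + B t) `^ (p / 2))) => z x y x0 y0 xyz z0.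
    by rewrite !powRr1.
  have -> : Qexp p / p = (p / 2)^-1 by rewrite /Qexp (max_r (ltW p2)) invf_div.
  have p22 : 0 < p / 2 < 1 by rewrite p20 ltr_pdivrMr ?mul1r.
  exact: (rint_rev_minkowski p22 (fun t => sqr_ge0 _) (fun t => sqr_ge0 _) cAp cBp cABp).
(* [growth_point] is integrated over the centres on the circle of radius [r]. After exchanging the
   averages, every circle about the origin that occurs has radius at most [r + del], and the means
   are monotone in the radius. *)
have hmain : rint 0 1 (fun t => (A t + B t) `^ (p / 2)) <= cavg g (r + del).
  apply: (@le_trans _ _ (rint 0 1 (fun t => rint 0 1 (fun y => g (cpt (cpt 0 r t) del y))))).
    apply: (le_rint cABp).
      exact: (rint_rot_continuous cg r0 (ltW d0) rd).
    by move=> t _; apply: (growth_point j m0 d0); rewrite ncr.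
  rewrite (cavg_tonelli cg r0 (ltW d0) rd (fun z => powR_ge0 _ _)).
  apply: rint01_le.
    by apply: continuous_subspaceT; exact: (cavg_nc_continuous cg r0 (ltW d0) rd).
  move=> y _; apply: (cavg_hol_mono j (nc_ge0 _) _ rd).
  apply: le_trans (ncD _ _) _; rewrite ncM !nc_real nc_unit mulr1.
  by rewrite (ger0_norm r0) (ger0_norm (ltW d0)).
apply: (le_trans step); apply: (ge0_ler_powR Qp0 _ _ hmain); rewrite nnegrE.
  exact: I0.
by apply: rint_ge0 => t _; exact: powR_ge0.
Qed.

End growth.

(** * Summation of the growth inequality over dyadic radii *)

Section dyadic.
Context {R : realType}.
Variables (F G : R -> R) (W Q : R) (m : nat).
Hypotheses (F0 : forall r, 0 <= F r) (G0 : forall r, 0 <= G r) (W0 : 0 <= W) (Q0 : 0 < Q).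
Hypothesis FW : forall r, 0 <= r < 1 -> F r <= W.
Hypothesis growth : forall r del, 0 <= r -> 0 < del -> r + del < 1 ->
  (del ^+ m / (2 * m`!%:R) * G r) `^ Q <= F (r + del) `^ Q - F r `^ Q.

(** A single increment of [F ^ Q] cannot exceed the upper bound [W ^ Q]. This settles [q = +oo], and
    it bounds the individual terms when the exponent is raised from [Q] to [q]. *)
Lemma growth_bound r del : 0 <= r -> 0 < del -> r + del < 1 ->
  del ^+ m / (2 * m`!%:R) * G r <= W.
Proof.
move=> r0 d0 rd.
have k0 : 0 <= del ^+ m / (2 * m`!%:R) * G r.
  apply: mulr_ge0 => //; apply: divr_ge0; last exact: mulr_ge0.
  by apply: exprn_ge0; exact: ltW.
have h := growth r0 d0 rd.
have rd0 : 0 <= r + del < 1 by rewrite rd andbT; apply: addr_ge0 => //; exact: ltW.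
rewrite leNgt; apply/negP => hlt.
have h1 : F (r + del) `^ Q <= W `^ Q.
  by apply: ge0_ler_powR (FW rd0); rewrite ?nnegrE// ltW.
have h2 : W `^ Q < (del ^+ m / (2 * m`!%:R) * G r) `^ Q by apply: gt0_ltr_powR hlt.
have := lt_le_trans h2 h; rewrite ltrBrDr => h3.
have := lt_le_trans h3 h1; rewrite gtrDl => h4.
by have := powR_ge0 (F r) Q; rewrite leNgt h4.
Qed.

Definition dyad (k : nat) : R := 1 - (2 ^+ k)^-1.

Lemma dyad_ge0 k : 0 <= dyad k.
Proof. by rewrite subr_ge0 invf_le1 ?exprn_gt0// exprn_ege1// ler1n. Qed.

Lemma dyad_lt1 k : dyad k < 1.
Proof. by rewrite gtrBl invr_gt0 exprn_gt0. Qed.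

Lemma dyadS k : dyad k + (2 ^+ k.+1)^-1 = dyad k.+1.
Proof. by rewrite /dyad exprS; field; rewrite expf_neq0. Qed.

(** The gain between the radii [dyad k.+1] and [dyad k.+2], whose distance is [2 ^- k.+2]. The value
    of [G] at [dyad k.+1] is the one that controls [G] on the preceding annulus, means being
    monotone. *)
Let x (k : nat) := (2 ^+ k.+2)^-1 ^+ m / (2 * m`!%:R) * G (dyad k.+1).

Let x0 k : 0 <= x k.
Proof.
rewrite /x; apply: mulr_ge0; last exact: G0.
by apply: divr_ge0; [apply: exprn_ge0; rewrite invr_ge0; exact: exprn_ge0|exact: mulr_ge0].
Qed.

Let xW k : x k <= W.
Proof.
by apply: growth_bound; rewrite ?dyadS ?dyad_ge0 ?dyad_lt1// invr_gt0 exprn_gt0.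
Qed.

(* The growth hypothesis telescopes along the dyadic radii. *)
Lemma dyad_sum_Q n : \sum_(k < n) x k `^ Q <= W `^ Q.
Proof.
apply: (@le_trans _ _ (F (dyad n.+1) `^ Q - F (dyad 1) `^ Q)).
  elim: n => [|n ih]; first by rewrite big_ord0 subrr.
  rewrite big_ord_recr/=.
  have h : x n `^ Q <= F (dyad n.+2) `^ Q - F (dyad n.+1) `^ Q.
    rewrite -(dyadS n.+1); apply: growth; rewrite ?dyadS ?dyad_ge0 ?dyad_lt1//.
  by apply: le_trans (lerD ih h) _; rewrite addrC addrA subrK.
rewrite lerBlDr; apply: (@le_trans _ _ (W `^ Q)); last by rewrite lerDl powR_ge0.
by apply: ge0_ler_powR; rewrite ?nnegrE ?(ltW Q0) ?FW ?dyad_ge0 ?dyad_lt1.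
Qed.

(** Since each term is at most [W], its [q]-th power is at most [W ^ (q - Q)] times its [Q]-th
    power. *)
Lemma dyad_sum n q : Q <= q -> \sum_(k < n) x k `^ q <= W `^ q.
Proof.
move=> Qq; have q0 : 0 < q := lt_le_trans Q0 Qq.
have split (y : R) : 0 <= y -> y `^ q = y `^ (q - Q) * y `^ Q.
  move=> y0; have [->|yn] := eqVneq y 0.
    by rewrite (powR0 (lt0r_neq0 q0)) (powR0 (lt0r_neq0 Q0)) mulr0.
  by rewrite -powRD ?yn ?implybT// subrK.
rewrite split// (le_trans _ (ler_wpM2l (powR_ge0 _ _) (dyad_sum_Q n)))//.
rewrite mulr_sumr; apply: ler_sum => k _; rewrite split//.
rewrite ler_wpM2r ?powR_ge0//; apply: ge0_ler_powR (xW k); rewrite ?nnegrE ?subr_ge0//.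
Qed.

End dyadic.

Lemma powR_root_sum (R : realType) (a b c k p Q : R) : 0 < p -> 0 <= k -> 0 <= b ->
  a `^ (Q / p) + (k `^ p * b) `^ (Q / p) <= c `^ (Q / p) ->
  (k * b `^ p^-1) `^ Q <= (c `^ p^-1) `^ Q - (a `^ p^-1) `^ Q.
Proof.
move=> p0 k0 b0; have E (x : R) : (x `^ p^-1) `^ Q = x `^ (Q / p) by rewrite -powRrM mulrC.
rewrite !E lerBrDl powRM ?powR_ge0// -powRrM mulrCA divff ?lt0r_neq0// mulr1.
by rewrite powRM ?powR_ge0// E.
Qed.

(** * Circle means up to the boundary circle *)

Section hardy.
Context {R : realType}.
Local Notation C := (R[i]).
Local Notation nc := (@Normc.normc R).
Local Notation "x %:C" := (Complex x 0) : ring_scope.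
Local Notation mu := (@lebesgue_measure R).

(* Locked so that unification does not unfold the integral. *)
Definition pmean (p : R) (f : C -> C) (r : R) : R :=
  locked (cavg (fun z => nc (f z) `^ p) r).

Lemma pmeanE p f r : pmean p f r = cavg (fun z => nc (f z) `^ p) r.
Proof. by rewrite /pmean -lock. Qed.

Lemma pmean_ge0 p f r : 0 <= pmean p f r.
Proof. by rewrite pmeanE; apply: rint_ge0 => t _; exact: powR_ge0. Qed.

Lemma circ_LpE (p : R) (h : C^o -> C^o) r : circ_Lp p h r = pmean p h r `^ p^-1.
Proof.
rewrite /circ_Lp; apply: (congr1 (fun x => x `^ p^-1)).
rewrite pmeanE /cavg /rint /Rintegral; apply: (congr1 fine).
by apply: eq_integral => t _; rewrite polarE /cpt add0r.
Qed.

Lemma within_closedDisc (f : C^o -> C^o) : {within @closedDisc R, continuous f} ->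
  forall z : C, nc z <= 1 -> forall eps : R, 0 < eps -> exists2 d : R, 0 < d &
  forall w : C, nc w <= 1 -> nc (w - z) < d -> nc (f w - f z) <= eps.
Proof.
move=> /subspace_continuousP cf z z1 eps e0.
have e0' : (0 : C) < eps%:C by rewrite ltcE/= eqxx.
have /cvgrPdist_le/(_ _ e0') := cf z z1.
move=> /nbhs_ballP[d0 /= /complex_gt0[d dpos ->] hd]; exists d => // w w1 wz.
have := hd w; rewrite /ball/= => /(_ _ w1).
have H : `|z - w| < d%:C by rewrite ltcE/= eqxx /= nc_distC.
by move=> /(_ H); rewrite lecE/= eqxx/= nc_distC.
Qed.

Lemma pmean_closed (p : R) (f : C -> C) : 0 < p ->
  (forall z : C, nc z <= 1 -> forall eps : R, 0 < eps -> exists2 d : R, 0 < d &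
    forall w : C, nc w <= 1 -> nc (w - z) < d -> nc (f w - f z) <= eps) ->
  forall eps : R, 0 < eps -> exists2 d : R, 0 < d & forall r, 0 <= r <= 1 ->
    `|r - 1| < d -> `|pmean p f r - pmean p f 1| <= eps.
Proof.
move=> p0 cf eps e0.
have [d d0 hd] : exists2 d : R, 0 < d & forall r, 0 <= r <= 1 -> `|r - 1| < d ->
  `|cavg (fun z => nc (f z) `^ p) r - cavg (fun z => nc (f z) `^ p) 1| <= eps; last first.
  by exists d => // r r01 rd; rewrite !pmeanE; exact: hd.
move: eps e0; apply: (@cavg_within _ (fun z => nc z <= 1) _ (fun r => 0 <= r <= 1)).
- exact: ccontS_powR.
- by rewrite ler01 lexx.
- by move=> x /andP[x0 x1] t; rewrite nc_cpt0 ger0_norm.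
Qed.

Section bound.
Variables (f : C^o -> C^o) (p : R).
Hypotheses (hf : holo f) (cf : {within @closedDisc R, continuous f}) (p1 : 1 <= p).
Let p0 : 0 < p. Proof. exact: lt_le_trans p1. Qed.
Let D j : C -> C := derive1n j f.
Let hD : hol_seq D 0 1. Proof. exact: holo_hol_seq. Qed.

(** The means increase for radii below 1, and continuity of [f] on the closed disc lets the larger
    radius tend to 1. *)
Lemma pmean_le_bnd r : 0 <= r < 1 -> pmean p f r <= pmean p f 1.
Proof.
move=> /andP[r0 r1]; apply/ler_addgt0Pr => eps e0.
have [d d0 hd] := pmean_closed p0 (within_closedDisc cf) e0.
pose s := Num.max r (1 - d / 2).
have rs : r <= s by rewrite le_max lexx.
have s1 : s < 1 by rewrite gt_max r1/= gtrBl divr_gt0.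
have s0 : 0 <= s := le_trans r0 rs.
apply: (@le_trans _ _ (pmean p f s)).
  by rewrite !pmeanE; exact: (cavg_hol_mono hD p1 0 r0 rs s1).
rewrite addrC -lerBlDr; apply: le_trans (ler_norm _) _; apply: hd.
  by rewrite s0 ltW.
rewrite distrC ger0_norm ?subr_ge0 ?(ltW s1)// ltrBlDr -ltrBlDl.
apply: (@lt_le_trans _ _ (1 - d / 2)); last by rewrite le_max lexx orbT.
by rewrite ltrD2l ltrN2 ltr_pdivrMr// mulrDr mulr1 ltrDl.
Qed.

Lemma pmean_hol_mono j r1 r2 : 0 <= r1 -> r1 <= r2 -> r2 < 1 ->
  pmean p (derive1n j f) r1 <= pmean p (derive1n j f) r2.
Proof. by move=> r10 r12 r21; rewrite !pmeanE; exact: (cavg_hol_mono hD p1 j r10 r12 r21). Qed.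

Lemma circ_Lp_growth m r del : (0 < m)%N -> 0 <= r -> 0 < del -> r + del < 1 ->
  (del ^+ m / (2 * m`!%:R) * circ_Lp p (derive1n m f) r) `^ Qexp p <=
  circ_Lp p f (r + del) `^ Qexp p - circ_Lp p f r `^ Qexp p.
Proof.
move=> m0 r0 d0 rd; rewrite !circ_LpE; set k := del ^+ m / _.
have k0 : 0 <= k.
  by apply: divr_ge0; [apply: exprn_ge0; exact: ltW|exact: mulr_ge0].
apply: (powR_root_sum p0 k0 (pmean_ge0 _ _ _)).
have := growth_cavg hD p1 0 m0 r0 d0 rd; rewrite add0n -!pmeanE -/k.
have <- // : cavg (fun z => (k * nc (D m z)) `^ p) r = k `^ p * pmean p (D m) r.
rewrite pmeanE -rintZ; last first.
  apply: continuous_subspaceT; apply: (ccontS_comp (ccont_hol hD m p0)).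
    by move=> t; rewrite nc_cpt0 (ger0_norm r0); apply: lt_trans rd; rewrite ltrDl.
  by move=> t; exact: rcont_cpt.
by apply: eq_rint => t _; rewrite (powRM _ k0 (nc_ge0 _)).
Qed.

Lemma circ_Lp_le_bnd r : 0 <= r < 1 -> circ_Lp p f r <= pmean p f 1 `^ p^-1.
Proof.
move=> hr; rewrite circ_LpE; have := pmean_le_bnd hr.
apply: ge0_ler_powR; rewrite ?nnegrE ?pmean_ge0//.
by rewrite invr_ge0 (ltW p0).
Qed.

(** [growth_point] at the origin with radius 1/2, keeping one of its two squares: the value for
    [j = 0], the derivative otherwise. The radius accounts for [2 ^+ j]. *)
Lemma coef_bound j : nc (derive1n j f 0) <= (2 ^+ j * (2 * j`!%:R)) * pmean p f 1 `^ p^-1.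
Proof.
set W := _ `^ p^-1.
have h12 : nc 0 + 2^-1 < 1 by rewrite nc0 add0r invf_lt1// ltr1n.
have h120 : (0 : R) < 2^-1 by rewrite invr_gt0.
have key k : (0 < k)%N -> (nc (D 0 0) ^+ 2 + (2^-1 ^+ k / (2 * k`!%:R) * nc (D k 0)) ^+ 2) `^ (p / 2) <= pmean p f 1.
  move=> k0; have := growth_point hD p1 0 k0 h120 h12; rewrite add0n => /le_trans; apply.
  have := @pmean_le_bnd 2^-1; rewrite (pmeanE _ _ 2^-1); apply.
  by rewrite (ltW h120) invf_lt1// ltr1n.
have root x : 0 <= x -> (x ^+ 2) `^ (p / 2) <= pmean p f 1 -> x <= W.
  move=> x0; rewrite -powR_mulrn// -powRrM mulrCA divff// mulr1 => h.
  rewrite -[leLHS]powRr1// -(divff (lt0r_neq0 p0)) powRrM.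
  by apply: ge0_ler_powR h; rewrite ?nnegrE ?powR_ge0 ?pmean_ge0// invr_ge0 (ltW p0).
have p20 : 0 <= p / 2 by rewrite divr_ge0 ?(ltW p0).
case: j => [|j].
  rewrite expr0 mul1r fact0 mulr1; apply: (@le_trans _ _ W); last first.
    by rewrite ler_peMl ?ler1n// powR_ge0.
  apply: root; first exact: nc_ge0.
  apply: le_trans (key 1%N isT); apply: ge0_ler_powR => //; rewrite ?nnegrE ?addr_ge0 ?sqr_ge0//.
  by rewrite lerDl sqr_ge0.
set K := 2 ^+ _ * _; have K0 : 0 < K.
  by apply: mulr_gt0; [exact: exprn_gt0|apply: mulr_gt0 => //; rewrite ltr0n fact_gt0].
rewrite -ler_pdivrMl//; apply: root; first by rewrite mulr_ge0 ?nc_ge0// invr_ge0 ltW.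
apply: le_trans (key j.+1 isT); apply: ge0_ler_powR => //; rewrite ?nnegrE ?addr_ge0 ?sqr_ge0//.
by rewrite /K invfM exprVn lerDr sqr_ge0.
Qed.

End bound.
End hardy.

(** * Besov norms of functions continuous up to the boundary *)

Section besov.
Context {R : realType}.
Local Notation C := (R[i]).
Local Notation nc := (@Normc.normc R).
Local Notation mu := (@lebesgue_measure R).

Lemma le_powR (a x y : R) : 0 <= a -> 0 <= x -> x <= y -> x `^ a <= y `^ a.
Proof. by move=> a0 x0 xy; apply: ge0_ler_powR => //; rewrite nnegrE// (le_trans x0). Qed.

Lemma lee_poweR (a : R) (x y : \bar R) : 0 <= a -> (0 <= x)%E -> (x <= y)%E -> (x `^ a <= y `^ a)%E.
Proof.
move=> a0 x0 xy; apply: gt0_ler_poweR => //; rewrite in_itv/= leey andbT//.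
exact: le_trans xy.
Qed.

(** The factor [2 ^+ k.+1] is the inverse length of the interval from [dyad k] to [dyad k.+1], so
    this interval contributes at most [b k]; monotone convergence along [[0, dyad n[] exhausts the
    domain. *)
Lemma dyad_integral (h : R -> R) (b : nat -> R) (B : R) :
  measurable_fun `[(0 : R), 1[ h -> (forall r, 0 <= r < 1 -> 0 <= h r) ->
  (forall k r, dyad k <= r < dyad k.+1 -> h r <= 2 ^+ k.+1 * b k) ->
  (forall n, \sum_(k < n) b k <= B) ->
  (\int[mu]_(r in `]0%R, 1%R[) (h r)%:E <= B%:E)%E.
Proof.
move=> mh h0 hb hB; pose F n := [set` `[(0 : R), dyad n[].
have dS n : dyad n <= dyad n.+1 :> R by rewrite -dyadS lerDl invr_ge0 exprn_ge0.
have mF n : measurable (F n) by exact: measurable_itv.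
have F01 n : F n `<=` `[(0 : R), 1[.
  move=> r; rewrite /F /= !in_itv/= => /andP[-> rn]/=; apply: lt_trans rn _; exact: dyad_lt1.
have mf n : measurable_fun (F n) (EFin \o h).
  by apply/measurable_EFinP; apply: measurable_funS mh => //; exact: F01.
have f0 n r : F n r -> (0 <= (EFin \o h) r)%E.
  by move=> /F01; rewrite /= in_itv/= lee_fin; exact: h0.
have part n : (\int[mu]_(r in F n) (EFin \o h) r <= (\sum_(k < n) b k)%:E)%E.
  elim: n => [|n ih].
    have -> : F 0%N = set0.
      by apply/seteqP; split=> // r; rewrite /F /= in_itv/= /dyad expr0 invr1 subrr leNgt andNb.
    by rewrite integral_set0 big_ord0.
  have FS : F n.+1 = F n `|` [set` `[dyad n, dyad n.+1[].
    apply/seteqP; split=> r; rewrite /F /= !in_itv/=.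
      by case/andP=> r0 ->; rewrite r0 andbT /=; case: (ltP r (dyad n)) => _; [left|right].
    case=> /andP[r1 r2]; rewrite ?r1 ?r2/= ?andbT; first exact: lt_le_trans (dS n).
    by apply: le_trans r1; exact: dyad_ge0.
  rewrite FS ge0_integral_setU//; last 4 first.
  - exact: mF.
  - by rewrite -FS; exact: mf.
  - by rewrite -FS; exact: f0.
  - apply/eqP; rewrite -subset0 => r [/=]; rewrite /F/= !in_itv/= => /andP[_ r1] /andP[r2 _].
    by move: r1; rewrite ltNge r2.
  rewrite big_ord_recr/= EFinD; apply: leeD ih _.
  have L : ((\int[mu]_(r in `[dyad n, dyad n.+1[) (2 ^+ n.+1 * b n)%:E)%E = (b n)%:E :> \bar R)%E.
    rewrite integral_cst//= lebesgue_measure_itv/= lte_fin.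
    have lt : dyad n < dyad n.+1 :> R by rewrite -dyadS ltrDl invr_gt0 exprn_gt0.
    by rewrite lt -EFinD -EFinM -dyadS addrAC subrr add0r mulrAC divff ?mul1r// expf_neq0.
  rewrite -[leRHS]L; apply: ge0_le_integral => //=.
  - by move=> r rn; apply: (f0 n.+1); rewrite FS; right.
  - by apply: measurable_funS (mf n.+1) => //; rewrite FS; exact: subsetUr.
  - by move=> r; rewrite in_itv/= lee_fin; exact: hb.
have ndF : nondecreasing_seq F.
  apply/nondecreasing_seqP => n; rewrite subsetEset => r; rewrite /F/= !in_itv/= => /andP[-> h1].
  exact: lt_le_trans (dS n).
have UF : \bigcup_n F n = [set` `[(0 : R), 1[].
  apply/seteqP; split=> [r [n _ /F01//]|r]; rewrite /= in_itv/= => /andP[r0 r1].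
  pose k := (Num.bound ((1 - r)^-1)); exists k => //; rewrite /F/= in_itv/= r0/=.
  have r10 : 0 < 1 - r by rewrite subr_gt0.
  rewrite /dyad ltrBrDr -ltrBrDl -[ltRHS]invrK ltf_pV2 ?posrE ?exprn_gt0 ?invr_gt0//.
  have := archi_boundP (ltW (_ : 0 < (1 - r)^-1)); rewrite invr_gt0 => /(_ r10) h1.
  apply: lt_trans h1 _; rewrite -/k -natrX ltr_nat; exact: ltn_expl.
have cv := @ge0_nondecreasing_set_cvg_integral _ (measurableTypeR R) R F (EFin \o h) mu ndF mF mf f0.
rewrite UF in cv.
apply: (@le_trans _ _ (\int[mu]_(r in `[0%R, 1%R[) (EFin \o h) r)%E).
  apply: ge0_subset_integral => //=.
    by apply/measurable_EFinP.
  by move=> r; rewrite /= !in_itv/= => /andP[/ltW -> ->].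
have cv' := cvg_lim (@ereal_hausdorff R) cv; rewrite -cv'.
apply: lime_le; first by apply/cvg_ex; eexists; exact: cv.
by near=> n; apply: le_trans (part n) _; rewrite lee_fin.
Unshelve. all: by end_near. Qed.

(** Raised to the power [q], the weight with exponent [a - 1/q] splits into [(1 - r) ^ (a q)] and
    [1 / (1 - r)]; the latter is at most the inverse length of the dyadic interval. *)
Lemma besov_integrand_le (N M a q r : R) k : 0 < q -> 0 <= a -> 0 <= N <= M ->
  dyad k <= r < dyad k.+1 ->
  (N * (1 - r) `^ (a - q^-1)) `^ q <= 2 ^+ k.+1 * (M * ((2 ^+ k)^-1) `^ a) `^ q.
Proof.
move=> q0 a0 /andP[N0 NM] /andP[r1 r2].
have u0 : 0 < (2 ^+ k)^-1 :> R by rewrite invr_gt0 exprn_gt0.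
have v0 : 0 < (2 ^+ k.+1)^-1 :> R by rewrite invr_gt0 exprn_gt0.
have d1 : 1 - r <= (2 ^+ k)^-1 by move: r1; rewrite /dyad lerBlDr addrC -lerBlDr.
have d2 : (2 ^+ k.+1)^-1 < 1 - r by move: r2; rewrite /dyad ltrBrDr -ltrBrDl.
have d0 : 0 < 1 - r := lt_trans v0 d2.
rewrite !powRM ?powR_ge0 ?(le_trans N0)// mulrCA.
have -> : ((1 - r) `^ (a - q^-1)) `^ q = ((1 - r) `^ a) `^ q * (1 - r)^-1.
  rewrite -!powRrM mulrBl mulVf ?lt0r_neq0// powRD ?(lt0r_neq0 d0) ?implybT//.
  by rewrite powR_inv1 ?(ltW d0).
apply: ler_pM; rewrite ?mulr_ge0 ?powR_ge0 ?invr_ge0 ?(ltW d0)//.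
  by apply: ge0_ler_powR; rewrite ?nnegrE ?(ltW q0) ?(le_trans N0).
rewrite mulrC; have i0 : 0 <= (1 - r)^-1 by rewrite invr_ge0 ltW.
apply: (ler_pM i0 (powR_ge0 _ _)).
  by rewrite -[leRHS]invrK; apply: ltW; rewrite ltf_pV2// posrE.
exact: (le_powR (ltW q0) (powR_ge0 _ _) (le_powR a0 (ltW d0) d1)).
Qed.

Section tail.
Variables (f : C^o -> C^o) (p : R).
Hypotheses (hf : holo f) (p1 : 1 <= p).

Lemma measurable_circ_Lp j : measurable_fun `[(0 : R), 1[ (circ_Lp p (derive1n j f)).
Proof.
have p0 : 0 < p by exact: lt_le_trans p1.
have -> : circ_Lp p (derive1n j f) = (@powR R ^~ p^-1) \o pmean p (derive1n j f).
  by apply/funext => r; rewrite circ_LpE.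
apply: measurableT_comp; first exact: measurable_powR.
apply: subspace_continuous_measurable_fun => //.
apply: within_continuous_epsP => x0 /=; rewrite in_itv/= => x0r eps e0.
have [] := @cavg_within R _ _ (fun x => 0 <= x < 1) x0 (ccont_hol (holo_hol_seq hf) j p0) x0r _ eps e0.
  by move=> x /andP[x1 x2] t; rewrite nc_cpt0 ger0_norm.
move=> d d0 hd; exists d => // x; rewrite in_itv/= => xr xd.
by rewrite !pmeanE; exact: hd.
Qed.

Lemma circ_Lp_ge0 (g : C^o -> C^o) r : 0 <= circ_Lp p g r.
Proof. exact: powR_ge0. Qed.

Lemma measurable_besov_integrand m a q : measurable_fun `[(0 : R), 1[
  (fun r => (circ_Lp p (derive1n m f) r * (1 - r) `^ a) `^ q).
Proof.
apply: (measurableT_comp (measurable_powR q)); apply: measurable_funM; first exact: measurable_circ_Lp.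
apply: (measurableT_comp (measurable_powR a)); exact: measurable_funB.
Qed.

Lemma besov_tail_le (s q B : R) m (M : nat -> R) : 0 < q -> s <= m%:R -> 0 <= B ->
  (forall k r, dyad k <= r < dyad k.+1 -> circ_Lp p (derive1n m f) r <= M k) ->
  (forall n, \sum_(k < n) (M k * ((2 ^+ k)^-1) `^ (m%:R - s)) `^ q <= B `^ q) ->
  (besov_tail s p q%:E m f <= B%:E)%E.
Proof.
move=> q0 sm B0 hM hB; rewrite /besov_tail.
have -> : B = (B `^ q) `^ q^-1 by rewrite -powRrM divff ?powRr1// lt0r_neq0.
rewrite -poweR_EFin; apply: lee_poweR; first by rewrite invr_ge0 ltW.
  by apply: integral_ge0 => r _; rewrite lee_fin powR_ge0.
apply: (@dyad_integral _ (fun k => (M k * ((2 ^+ k)^-1) `^ (m%:R - s)) `^ q)) => //.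
- exact: measurable_besov_integrand.
- by move=> r _; exact: powR_ge0.
- move=> k r kr; apply: besov_integrand_le => //; first by rewrite subr_ge0.
  by rewrite circ_Lp_ge0 hM.
Qed.

End tail.

Section hardy_besov.
Variables (f : C^o -> C^o) (p : R) (m : nat).
Hypotheses (hf : holo f) (cf : {within @closedDisc R, continuous f}) (p1 : 1 <= p).
Hypothesis m0 : (0 < m)%N.
Let W := pmean p f 1 `^ p^-1.
Let W0 : 0 <= W. Proof. exact: powR_ge0. Qed.
Let G := circ_Lp p (derive1n m f).
Let Q0 : 0 < Qexp p. Proof. by rewrite /Qexp lt_max ltr0n orbT. Qed.
Let G0 r : 0 <= G r. Proof. exact: powR_ge0. Qed.
Let F0 r : 0 <= circ_Lp p f r. Proof. exact: powR_ge0. Qed.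
(** The factor [4 ^+ m] compares the step [2 ^- k.+2] with the weight [2 ^- k]; the factor [2 * m!]
    is the denominator of the growth inequality. *)
Let K : R := 4 ^+ m * (2 * m`!%:R).
Let K0 : 0 < K. Proof. by apply: mulr_gt0; [exact: exprn_gt0|apply: mulr_gt0 => //; rewrite ltr0n fact_gt0]. Qed.
Let fact0 : (2 * m`!%:R) != 0 :> R.
Proof. by apply: mulf_neq0 => //; rewrite pnatr_eq0 -lt0n fact_gt0. Qed.

Lemma hardy_tail_fin q : Qexp p <= q -> (besov_tail 0 p q%:E m f <= (K * W)%:E)%E.
Proof.
move=> Qq; have q0 : 0 < q := lt_le_trans Q0 Qq.
apply: (besov_tail_le hf p1 q0 _ _ (M := fun k => G (dyad k.+1))).
- exact: ler0n.
- by rewrite mulr_ge0// ltW.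
- move=> k r /andP[r1 r2]; rewrite /G !circ_LpE.
  have pV : 0 <= p^-1 by rewrite invr_ge0 (le_trans ler01).
  apply: (le_powR pV (pmean_ge0 _ _ _)).
  apply: (pmean_hol_mono hf p1); [exact: le_trans (dyad_ge0 k) r1|exact: ltW|exact: dyad_lt1].
move=> n; rewrite powRM ?(ltW K0)//.
have := dyad_sum F0 G0 W0 Q0 (circ_Lp_le_bnd hf cf p1) (fun r d => circ_Lp_growth hf p1 m0) n Qq.
move=> /(ler_wpM2l (powR_ge0 K q)); apply: le_trans.
rewrite mulr_sumr; apply: ler_sum => k _; rewrite -powRM ?(ltW K0)//; last first.
  by rewrite mulr_ge0// divr_ge0 ?exprn_ge0 ?invr_ge0 ?exprn_ge0// mulr_ge0.
have -> : K * ((2 ^+ k.+2)^-1 ^+ m / (2 * m`!%:R) * G (dyad k.+1)) = G (dyad k.+1) * (2 ^+ k)^-1 `^ (m%:R - 0) => //.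
rewrite subr0 powR_mulrn ?invr_ge0 ?exprn_ge0// /K.
have -> : (2 ^+ k.+2)^-1 = 4^-1 * (2 ^+ k)^-1 :> R.
  by rewrite !exprS mulrA invfM; congr (_^-1 * _); rewrite -natrM.
have a0 : (4 : R) ^+ m != 0 by rewrite expf_neq0// pnatr_eq0.
rewrite exprMn exprVn; move: fact0 a0; move: (4 ^+ m) ((2 ^- k) ^+ m) (2 * m`!%:R) (G _) => a b c g c0 a0.
by field; rewrite a0 c0.
Qed.

Lemma hardy_tail_inf : (besov_tail 0 p +oo m f <= (K * W)%:E)%E.
Proof.
apply: ge_ereal_sup => y [r /=]; rewrite in_itv/= => /andP[r0 r1] <-.
rewrite lee_fin subr0 powR_mulrn ?subr_ge0 ?(ltW r1)//.
(* Going halfway to the boundary stays inside the disc and costs a factor [2 ^+ m], for which [K]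
   has room. *)
have d0 : 0 < (1 - r) / 2 by rewrite divr_gt0 ?subr_gt0.
have rd : r + (1 - r) / 2 < 1 by lra.
have := growth_bound F0 G0 W0 Q0 (circ_Lp_le_bnd hf cf p1) (fun r d => circ_Lp_growth hf p1 m0) (ltW r0) d0 rd.
move=> /(ler_wpM2l (ltW K0)); apply: le_trans.
have -> : K * (((1 - r) / 2) ^+ m / (2 * m`!%:R) * G r) = G r * (2 ^+ m * (1 - r) ^+ m).
  have a0 : (2 : R) ^+ m != 0 by rewrite expf_neq0// pnatr_eq0.
  have -> : K = 2 ^+ m * 2 ^+ m * (2 * m`!%:R) by rewrite /K; congr (_ * _); rewrite -exprMn -natrM.
  rewrite exprMn exprVn; move: fact0 a0; move: (2 ^+ m) ((1 - r) ^+ m) (2 * m`!%:R) (G _) => a b c g c0 a0.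
  by field; rewrite a0 c0.
rewrite -/G; apply: ler_wpM2l => //; rewrite ler_peMl ?exprn_ge0 ?subr_ge0 ?(ltW r1)//.
by rewrite exprn_ege1// ler1n.
Qed.

(** The embedding of the Hardy space [H^p] into [HB_0^{p,q}], here for functions continuous up to
    the boundary, whose Hardy norm is the boundary mean [W]. *)
Lemma hardy_besov q : ((Qexp p)%:E <= q)%E -> (besov_norm 0 p q m f <=
  ((\sum_(j < m) 2 ^+ j * (2 * j`!%:R) + K) * W)%:E)%E.
Proof.
move=> Qq; rewrite mulrDl EFinD; apply: leeD.
  rewrite mulr_suml -sumEFin; apply: lee_sum => j _; rewrite lee_fin; exact: coef_bound.
case: q Qq => [q||//]; last by move=> _; exact: hardy_tail_inf.
by rewrite lee_fin; exact: hardy_tail_fin.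
Qed.

End hardy_besov.
End besov.

(** * Measures charging arcs *)

Section disc_measure.
Context {R : realType}.
Local Notation C := (R[i]).
Local Notation nc := (@Normc.normc R).
Local Notation e := (@unit_pt R).
Local Notation arc := (@Defs.arc R).
Local Notation cdisc := (fun z : C => nc z <= 1).

Lemma nc_cplxB (x y : R * R) :
  nc (cplx_of y - cplx_of x : C) <= `|x.1 - y.1| + `|x.2 - y.2|.
Proof.
by case: x y => a b [c d]; apply: le_trans (nc_le _) _; rewrite /= (distrC a) (distrC b).
Qed.

Lemma nbhs_cplx (x : R * R) (d : R) : 0 < d ->
  \forall y \near x, nc (cplx_of y - cplx_of x : C) < d.
Proof.
move=> d0; have d20 : 0 < d / 2 by rewrite divr_gt0.
exists (ball x.1 (d / 2), ball x.2 (d / 2)); first by split; exact: nbhsx_ballx.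
move=> y [/= h1 h2]; apply: le_lt_trans (nc_cplxB _ _) _.
by rewrite [ltRHS]splitr; apply: ltrD.
Qed.

Lemma measurable_closedDisc2 : measurable (@closedDisc2 R).
Proof.
apply: closed_measurable2.
have -> : @closedDisc2 R = (fun x : R * R => nc (cplx_of x : C)) @^-1` [set` `]-oo, (1 : R)]].
  by apply/seteqP; split=> x; rewrite /closedDisc2/= in_itv.
apply: preimage_closed; last exact: interval_closed.
move=> x _; apply/cvgrPdist_le => eps e0.
apply: filterS (nbhs_cplx x e0) => y h; apply: ltW; apply: le_lt_trans h.
by rewrite distrC nc_dist_le.
Qed.

Lemma measurable_disc_fun (g : C -> R) : ccontS cdisc g ->
  measurable_fun (@closedDisc2 R) (fun x => g (cplx_of x)).
Proof.
move=> cg; apply: within_continuous_measurable2; first exact: measurable_closedDisc2.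
apply/subspace_continuousP => x Dx; apply/cvgrPdist_le => eps e0.
have [d d0 hd] := cg _ Dx _ e0.
apply: filterS (nbhs_cplx x d0) => y yd Dy; rewrite distrC; exact: hd.
Qed.

Lemma ccontS_unif_circle (g : C -> R) : ccontS cdisc g -> forall eps : R, 0 < eps ->
  exists2 d : R, 0 < d & forall t s, 0 <= t <= 1 -> `|s - t| < d -> `|g (e s) - g (e t)| <= eps.
Proof.
move=> cg eps e0.
have [|d d0 hd] := @tube R (fun d t => forall s, `|s - t| < d -> `|g (e s) - g (e t)| <= eps); last first.
  by exists d => // t s t01; exact: hd.
move=> t0 _; have e20 : 0 < eps / 2 by rewrite divr_gt0.
have [d1 d10 h1] := cg (e t0) (eq_ind_r (fun x => x <= 1) (lexx 1) (nc_unit t0)) _ e20.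
have [d2 d20 h2] := rdiff_rcont (rdiff_unit t0) (divr_gt0 d10 (ltr0Sn R 1)).
have near s : `|s - t0| < d2 -> `|g (e s) - g (e t0)| <= eps / 2.
  move=> /h2 hs; apply: h1; first by rewrite nc_unit.
  by apply: le_lt_trans hs _; rewrite ltr_pdivrMr// mulr_natr mulr2n ltrDl.
exists (d2 / 2); first by rewrite divr_gt0.
move=> t d _ td /andP[d0 dd] s sd.
have -> : g (e s) - g (e t) = (g (e s) - g (e t0)) - (g (e t) - g (e t0)) by ring.
rewrite [leRHS]splitr; apply: le_trans (ler_normB _ _) _; apply: lerD; apply: near.
  have -> : s - t0 = (s - t) + (t - t0) by ring.
  by apply: le_lt_trans (ler_normD _ _) _; rewrite [ltRHS]splitr; apply: ltrD => //; exact: lt_trans dd.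
by apply: lt_trans td _; rewrite ltr_pdivrMr// mulr_natr mulr2n ltrDl.
Qed.

(** [cos (2 pi x) = 1 - 2 sin (pi x) ^ 2], and the sine is positive strictly between 0 and [pi]. *)
Lemma unit_eq1 (x : R) : `|x| < 1 -> e x = 1 -> x = 0.
Proof.
move=> x1 ex; apply/eqP; rewrite -normr_le0 leNgt; apply/negP => x0.
have {ex} : cos (2 * pi * `|x|) = 1.
  have [h] : e `|x| = 1.
    have [x0'|x0'] := leP 0 x; first by rewrite ger0_norm.
    by rewrite ltr0_norm//; apply: (mulIf (unit_neq0 x)); rewrite -unitD addNr unit0 mul1r.
  by move=> _; rewrite h.
have -> : 2 * pi * `|x| = pi * `|x| + pi * `|x| by ring.
rewrite cosD; have := cos2Dsin2 (pi * `|x|); rewrite !expr2 => h1 h2.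
have p0 := pi_gt0 R.
have : 0 < sin (pi * `|x|).
  by apply: sin_gt0_pi; rewrite mulr_gt0//= -[ltRHS]mulr1 ltr_pM2l.
move=> s0; have := mulr_gt0 s0 s0; lra.
Qed.

Lemma unit_inj (s t : R) : `|s - t| < 1 -> e s = e t -> s = t.
Proof.
move=> st h; apply/eqP; rewrite -subr_eq0; apply/eqP; apply: unit_eq1 => //.
by rewrite unitD h -unitD subrr unit0.
Qed.

Lemma arcP (a l : R) x : arc a l x <-> exists2 t, a <= t <= a + l & cplx_of x = e t.
Proof.
split=> [[t /= ]|[t tal]].
  by rewrite in_itv/= => tal <-; exists t.
by case: x => x1 x2 [-> ->]; exists t => //=; rewrite in_itv/=.
Qed.

Lemma arc_closedDisc (a l : R) : arc a l `<=` @closedDisc2 R.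
Proof. by move=> x /arcP[t _ xt]; rewrite /closedDisc2/=; have <- : nc (e t) = 1 := nc_unit t; rewrite -xt. Qed.

Lemma measurable_arc (a l : R) : measurable (arc a l).
Proof.
apply: closed_measurable2; apply: compact_closed; first exact: norm_hausdorff.
apply: continuous_compact; last exact: segment_compact.
apply: continuous_subspaceT => t; apply/cvg_ballP => eps e0.
have [d d0 hd] := rdiff_rcont (rdiff_unit t) (divr_gt0 e0 (ltr0Sn R 1)).
apply/nbhs_ballP; exists d => // s; rewrite /ball/= distrC => /hd h.
have e2 : eps / 2 < eps by rewrite ltr_pdivrMr// mulr_natr mulr2n ltrDl.
by split; rewrite /ball/= distrC; apply: le_lt_trans e2; apply: le_trans h;
  [exact: (normRe_le (e s - e t))|exact: (normIm_le (e s - e t))].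
Qed.

Variables (mu : {finite_measure set (R * R)%type -> \bar R}) (c : R).
Hypotheses (c0 : 0 < c) (hc : forall a l : R, 0 < l <= 1 -> ((c * l)%:E <= mu (arc a l))%E).
Variable g : C -> R.
Hypotheses (cg : ccontS cdisc g) (g0 : forall z, 0 <= g z).

Let cge : continuous (fun t => g (e t)).
Proof.
apply: (@ccontS_comp _ _ g e cg) => t; first by rewrite nc_unit.
exact: rdiff_rcont (rdiff_unit t).
Qed.

(* The arcs of length [1/(2n)] starting at [k/n], [k < n], are pairwise disjoint, and [g]
   oscillates by at most [eps] on the arc of length [1/n] starting at [k/n]. *)
Lemma arc_sum_mean (eps : R) (n : nat) : (0 < n)%N -> 0 < eps ->
  (forall t s, 0 <= t <= 1 -> `|s - t| <= n%:R^-1 -> `|g (e s) - g (e t)| <= eps) ->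
  ((c / 2 * (cavg g 1 - 2 * eps))%:E <= \int[mu]_(x in @closedDisc2 R) (g (cplx_of x))%:E)%E.
Proof.
move=> n0 e0 he; pose l : R := n%:R^-1; pose A k := arc (k%:R * l) (l / 2).
pose U k := \big[setU/set0]_(j < k) A j.
have nr0 : 0 < n%:R :> R by rewrite ltr0n.
have l0 : 0 < l by rewrite invr_gt0.
have l1 : l <= 1 by rewrite invf_le1// ler1n.
have mA k : measurable (A k) by exact: measurable_arc.
have mU k : measurable (U k) by apply: bigsetU_measurable => j _.
have UD k : U k `<=` @closedDisc2 R.
  by rewrite /U -bigcup_mkord => x [j _]; exact: arc_closedDisc.
have mg : measurable_fun (@closedDisc2 R) (EFin \o (fun x => g (cplx_of x))).
  by apply/measurable_EFinP; exact: measurable_disc_fun.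
have mgS (B : set (R * R)) : measurable B -> B `<=` @closedDisc2 R ->
    measurable_fun B (EFin \o (fun x => g (cplx_of x))).
  by move=> mB BD; apply: measurable_funS mg => //; exact: measurable_closedDisc2.
have kl1 k : (k <= n)%N -> k%:R * l <= 1.
  by move=> kn; rewrite ler_pdivrMr// mul1r ler_nat.
have step k : (k <= n)%N ->
  ((c / 2 * (rint 0 (k%:R * l) (fun t => g (e t)) - 2 * eps * (k%:R * l)))%:E <=
    \int[mu]_(x in U k) (g (cplx_of x))%:E)%E.
  elim: k => [_|k ih kn].
    rewrite /U big_ord0 integral_set0 mul0r mulr0 subr0 /rint set_itv1.
    by rewrite Rintegral_set1 mulr0.
  have kn' := ltnW kn.
  have US : U k.+1 = U k `|` A k by rewrite /U big_ord_recr.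
  rewrite US ge0_integral_setU//; last 3 first.
  - by rewrite -US; apply: mgS.
  - by move=> x _; rewrite lee_fin.
  - apply/eqP; rewrite -subset0 => x []; rewrite /U -bigcup_mkord.
    move=> [j /= jk /arcP[t tj xt]] /arcP[s sj]; rewrite xt => ets.
    have kl := kl1 _ kn; have j0 : 0 <= j%:R * l by rewrite mulr_ge0 // ltW.
    have jk1 : j%:R * l + l <= k%:R * l.
      by rewrite -{2}[l]mul1r -mulrDl ler_pM2r// natr1 ler_nat.
    rewrite -natr1 mulrDl mul1r in kl.
    move: tj sj => /andP[t1 t2] /andP[s1 s2].
    suff : t = s by lra.
    by apply: unit_inj ets; rewrite ltr_norml; apply/andP; split; lra.
  set a := k%:R * l in ih *.
  have a0 : 0 <= a by rewrite mulr_ge0// ltW.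
  have a1 : a + l <= 1 by have := kl1 _ kn; rewrite -natr1 mulrDl mul1r.
  have -> : k.+1%:R * l = a + l by rewrite -natr1 mulrDl mul1r.
  have cgw u v : {within `[u, v], continuous (fun t => g (e t))} by exact: continuous_subspaceT.
  have -> : rint 0 (a + l) (fun t => g (e t)) = rint 0 a (fun t => g (e t)) + rint a (a + l) (fun t => g (e t)).
    by apply: rint_cat; rewrite ?a0 ?lerDl ?(ltW l0).
  have -> : c / 2 * (rint 0 a (fun t => g (e t)) + rint a (a + l) (fun t => g (e t)) - 2 * eps * (a + l))
    = c / 2 * (rint 0 a (fun t => g (e t)) - 2 * eps * a) +
      c / 2 * (rint a (a + l) (fun t => g (e t)) - 2 * eps * l) by ring.
  rewrite EFinD; apply: leeD; first exact: ih.
  have ga t : a <= t <= a + l -> `|g (e t) - g (e a)| <= eps.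
    move=> /andP[t1 t2]; apply: he; first by apply/andP; split; lra.
    by rewrite ger0_norm ?subr_ge0// -/l; lra.
  have i1 : rint a (a + l) (fun t => g (e t)) <= (g (e a) + eps) * l.
    have -> : (g (e a) + eps) * l = (g (e a) + eps) * (a + l - a) by ring.
    apply: rint_le_cst => //; first by rewrite lerDl ltW.
    by move=> t /ga; rewrite ler_norml => /andP[_]; lra.
  have mu1 := hc a (l := l / 2).
  (* If [g (e a) <= eps], the left side is nonpositive. Otherwise [g] is at least the positive
     constant [g (e a) - eps] on [A k]; one [eps] is lost here and one in the bound [i1], which
     explains [2 * eps]. *)
  have [gs|gs] := leP (g (e a)) eps.
    apply: (@le_trans _ _ 0%E); last by apply: integral_ge0 => x _; rewrite lee_fin.
    rewrite lee_fin; apply: mulr_ge0_le0; first by rewrite divr_ge0// ltW.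
    have : (g (e a) + eps) * l <= 2 * eps * l by rewrite ler_pM2r//; lra.
    lra.
  apply: (@le_trans _ _ (\int[mu]_(x in A k) (g (e a) - eps)%:E)%E); last first.
    apply: ge0_le_integral => //=.
    - by move=> x _; rewrite lee_fin subr_ge0 ltW.
    - by apply: mgS => //; exact: arc_closedDisc.
    - move=> x /arcP[t tA ->]; rewrite lee_fin.
      have : a <= t <= a + l by move/andP: tA => []; rewrite -/a => *; apply/andP; split; lra.
      by move=> /ga; rewrite ler_norml => /andP[+ _]; lra.
  rewrite integral_cst//.
  apply: (@le_trans _ _ ((g (e a) - eps)%:E * (c * (l / 2))%:E)%E); last first.
    by apply: lee_wpmul2l; rewrite ?lee_fin ?subr_ge0 ?(ltW gs)//; apply: mu1; apply/andP; split; lra.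
  rewrite -EFinM lee_fin.
  have -> : (g (e a) - eps) * (c * (l / 2)) = c / 2 * ((g (e a) - eps) * l) by ring.
  by apply: ler_wpM2l; [rewrite divr_ge0// ltW|lra].
have nl : n%:R * l = 1 by rewrite mulfV// lt0r_neq0.
have := step n (leqnn n); rewrite nl mulr1.
have -> : rint 0 1 (fun t => g (e t)) = cavg g 1.
  by rewrite /cavg /cpt; apply: eq_rint => t _; rewrite add0r mul1r.
move=> /le_trans; apply; apply: ge0_subset_integral => //.
- exact: measurable_closedDisc2.
- by move=> x _; rewrite lee_fin.
Qed.

Lemma arc_mean :
  ((c / 2 * cavg g 1)%:E <= \int[mu]_(x in @closedDisc2 R) (g (cplx_of x))%:E)%E.
Proof.
apply/lee_addgt0Pr => eps e0.
(* The error [c / 2 * (2 * (eps / c))] of [arc_sum_mean] is then exactly [eps]. *)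
have ec : 0 < eps / c by rewrite divr_gt0.
have [d d0 hd] := ccontS_unif_circle cg ec.
pose n := (Num.bound d^-1).+1.
have nd : n%:R^-1 < d.
  rewrite -[ltRHS]invrK ltf_pV2 ?posrE ?invr_gt0 ?ltr0n//.
  have := archi_boundP (ltW (_ : 0 < d^-1)); rewrite invr_gt0 => /(_ d0) h.
  by apply: lt_trans h _; rewrite ltr_nat.
have := @arc_sum_mean (eps / c) n isT ec.
have he t s : 0 <= t <= 1 -> `|s - t| <= n%:R^-1 -> `|g (e s) - g (e t)| <= eps / c.
  by move=> t01 st; apply: hd => //; exact: le_lt_trans nd.
move=> /(_ he); have -> : c / 2 * (cavg g 1 - 2 * (eps / c)) = c / 2 * cavg g 1 - eps.
  by field; rewrite lt0r_neq0.
by rewrite EFinB leeBlDr.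
Qed.

End disc_measure.

(** * Sufficiency of the arc condition *)

Section arc_reverse.
Context {R : realType}.
Variables (p : R) (m : nat) (q : \bar R) (mu : {finite_measure set (R * R)%type -> \bar R}).

Lemma arc_condition_reverse_carleson : 1 <= p -> ((Qexp p)%:E <= q)%E -> (0 < m)%N ->
  arc_condition mu -> reverse_carleson 0 p q m mu.
Proof.
move=> p1 Qq m0 [c [c0 hc]].
have p0 : 0 < p := lt_le_trans ltr01 p1.
set K := \sum_(j < m) 2 ^+ j * (2 * j`!%:R) + 4 ^+ m * (2 * m`!%:R) : R.
have f0 (j : nat) : 0 < 2 * j`!%:R :> R by rewrite mulr_gt0// ltr0n fact_gt0.
have K0 : 0 < K.
  apply: ltr_wpDl; last by rewrite mulr_gt0// exprn_gt0.
  by apply: sumr_ge0 => j _; rewrite mulr_ge0 ?exprn_ge0// ltW.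
have c20 : 0 < c / 2 by rewrite divr_gt0.
exists (K * ((c / 2)^-1) `^ p^-1); split.
  by apply: mulr_gt0 => //; apply: powR_gt0; rewrite invr_gt0.
move=> f [hf _] cf; have h := hardy_besov hf cf p1 m0 Qq.
apply: le_trans h _; rewrite -/K !EFinM -muleA; apply: lee_wpmul2l; first by rewrite lee_fin ltW.
have pV : 0 <= p^-1 by rewrite invr_ge0 ltW.
have I0 : (0 <= \int[mu]_(x in @closedDisc2 R) ((Normc.normc (f (cplx_of x) : R[i])) `^ p)%:E)%E.
  by apply: integral_ge0 => x _; rewrite lee_fin powR_ge0.
rewrite /Lp_mu -!poweR_EFin -poweRM//; last by rewrite lee_fin invr_ge0 ltW.
apply: lee_poweR => //; first by rewrite lee_fin pmean_ge0.
have h2 := @arc_mean _ mu c c0 hc (fun z => Normc.normc (f z) `^ p)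
  (ccontS_powR p0 (within_closedDisc cf)) (fun z => powR_ge0 _ _).
rewrite pmeanE.
have -> : cavg (fun z => Normc.normc (f z) `^ p) 1 = (c / 2)^-1 * (c / 2 * cavg (fun z => Normc.normc (f z) `^ p) 1).
  by rewrite mulrA mulVf ?mul1r// lt0r_neq0.
by rewrite EFinM; apply: lee_wpmul2l; rewrite ?lee_fin ?invr_ge0 ?(ltW c20).
Qed.

End arc_reverse.

(** * Polynomials as test functions *)

Lemma powR_le1 (R : realType) (a x : R) : 0 <= a -> 0 <= x -> x <= 1 -> x `^ a <= 1.
Proof. by move=> a0 x0 /(le_powR a0 x0); rewrite powR1. Qed.

Lemma powR_exprn (R : realType) (x p : R) n : 0 <= x -> (x ^+ n) `^ p = (x `^ p) ^+ n.
Proof.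
move=> x0; elim: n => [|n ih]; first by rewrite !expr0 powR1.
by rewrite !exprS powRM ?exprn_ge0// ih.
Qed.

Lemma powR_powV (R : realType) (a q : R) k :
  ((2 ^+ k)^-1 `^ a) `^ q = ((2^-1 `^ a) `^ q) ^+ k.
Proof. by rewrite -exprVn !powR_exprn ?powR_ge0// invr_ge0. Qed.

Section polynomials.
Context {R : realType}.
Local Notation C := (R[i]).
Local Notation nc := (@Normc.normc R).
Local Notation e := (@unit_pt R).
Local Notation "x %:C" := (Complex x 0) : ring_scope.
Implicit Types (P g : {poly C}) (p r t s : R) (q : \bar R).

Lemma nc_sum (I : Type) (l : seq I) (F : I -> C) :
  nc (\sum_(i <- l) F i) <= \sum_(i <- l) nc (F i).
Proof.
elim: l => [|i l ih]; first by rewrite !big_nil nc0.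
by rewrite !big_cons; apply: le_trans (ncD _ _) _; rewrite lerD2l.
Qed.

Definition poly_norm1 P := \sum_(i < size P) nc P`_i.

Lemma poly_norm1_ge0 P : 0 <= poly_norm1 P.
Proof. by apply: sumr_ge0 => i _; exact: nc_ge0. Qed.

Lemma nc_horner_le P (z : C) : nc z <= 1 -> nc P.[z] <= poly_norm1 P.
Proof.
move=> z1; rewrite horner_coef; apply: le_trans (nc_sum _ _) _.
apply: ler_sum => i _; rewrite ncM ncX; apply: ler_piMr; first exact: nc_ge0.
by apply: exprn_ile1 => //; exact: nc_ge0.
Qed.

Lemma cdiff_horner P (z : C) : cdiff (horner P) z P^`().[z].
Proof.
elim/poly_ind: P => [|P c ih].
  rewrite deriv0 horner0; apply: cdiff_ext (cdiff_cst 0 z).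
  by exists 1 => // w _; rewrite horner0.
rewrite derivMXaddC hornerD hornerM hornerX.
have := cdiffD (cdiffM ih (cdiff_id z)) (cdiff_cst c z).
rewrite addr0 mulr1 addrC /=.
apply: cdiff_ext; exists 1 => // w _.
by rewrite hornerMXaddC.
Qed.

Lemma clim_horner P (z : C) : clim (horner P) z P.[z].
Proof. exact: cdiff_clim (cdiff_horner P z). Qed.

Lemma ccont_poly P p : 0 < p -> ccontS (fun=> True) (fun z => nc P.[z] `^ p).
Proof.
move=> p0; apply: ccontS_powR => // z _ eps /(clim_horner P z)[d d0 hd].
by exists d => // w _; exact: hd.
Qed.

Lemma continuous_poly_cpt P p r : 0 < p -> continuous (fun t => nc P.[cpt 0 r t] `^ p).
Proof. by move=> p0; apply: (ccontS_comp (ccont_poly P p0)) => // t; exact: rcont_cpt. Qed.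

Lemma unit_mod t : exists2 s, 0 <= s <= 1 & e t = e s.
Proof.
by have [s s01] := unit_surj (e t); rewrite nc_unit mul1r => ets; exists s.
Qed.

Definition rotp P t : C^o -> C^o := fun z => P.[e t * z].

Lemma cdiff_rotp P t (z : C) : cdiff (rotp P t) z (e t * P^`().[e t * z]).
Proof.
have := cdiff_comp (cdiffZ (e t) (cdiff_id z)) (cdiff_horner P (e t * z)).
by rewrite mulr1 mulrC.
Qed.

Lemma derive1n_rotp P t j : derive1n j (rotp P t) = (fun z => e t ^+ j * P^`(j).[e t * z]) :> (C^o -> C^o).
Proof.
elim: j => [|j ih]; first by apply/funext => z; rewrite /= expr0 mul1r.
rewrite derive1nS ih; apply/funext => z.
have h : cdiff (fun z => e t ^+ j * P^`(j).[e t * z]) z (e t ^+ j.+1 * P^`(j.+1).[e t * z]).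
  by rewrite exprSr -mulrA derivnS; apply: cdiffZ; exact: cdiff_rotp.
by have [_ ->] := cdiff_derivable h.
Qed.

Lemma holo_rotp P t : holo (rotp P t).
Proof. by move=> z _; have [] := cdiff_derivable (cdiff_rotp P t z). Qed.

Lemma continuous_rotp P t : {within @closedDisc R, continuous (rotp P t)}.
Proof.
apply/subspace_continuousP => z _; apply/cvgrPdist_le => eps0 /complex_gt0[eps e0 ->].
have [del d0 hd] := cdiff_clim (cdiff_rotp P t z) e0.
have d0' : (0 : C) < del%:C by rewrite ltcE/= eqxx.
apply/nbhs_ballP; exists del%:C => //= w; rewrite /ball/= => wz _.
have := hd w; rewrite nc_distC.
have h : nc (z - w) < del by move: wz; rewrite ltcE/= => /andP[].
by move=> /(_ h); rewrite lecE/= eqxx/= nc_distC.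
Qed.

(** A rotation shifts the parameter of the circle and multiplies the derivative of order [m] by a
    unimodular factor, so the means do not depend on [t]. *)
Lemma circ_Lp_rotp P t p m r : 0 < p ->
  circ_Lp p (derive1n m (rotp P t)) r = pmean p (horner P^`(m)) r `^ p^-1.
Proof.
move=> p0; rewrite circ_LpE; suff -> : pmean p (derive1n m (rotp P t)) r = pmean p (horner P^`(m)) r by [].
have [s s01 ts] := unit_mod t; rewrite !pmeanE.
pose h x := nc P^`(m).[cpt 0 r x] `^ p.
have hc : continuous h by exact: continuous_poly_cpt.
have h1 x : h (x + 1) = h x by rewrite /h /cpt unitD unit1 mulr1.
transitivity (rint 0 1 (fun x => h (x + s))); last exact: rint_periodic hc h1 s01.
apply: eq_rint => x _; rewrite derive1n_rotp ts ncM ncX nc_unit expr1n mul1r /h /cpt !add0r unitD.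
by rewrite mulrCA (mulrC (e s)).
Qed.

Lemma circ_Lp_rotp_le P t p m r : 0 < p -> 0 <= r < 1 ->
  circ_Lp p (derive1n m (rotp P t)) r <= poly_norm1 P^`(m).
Proof.
move=> p0 /andP[r0 r1]; rewrite circ_Lp_rotp//; set M := poly_norm1 _.
have M0 : 0 <= M by exact: poly_norm1_ge0.
rewrite -[M]powRr1// -(divff (lt0r_neq0 p0)) powRrM.
apply: le_powR; rewrite ?invr_ge0 ?(ltW p0) ?pmean_ge0// pmeanE.
apply: rint01_le; first by apply: continuous_subspaceT; exact: continuous_poly_cpt.
move=> x _; apply: le_powR; [exact: ltW|exact: nc_ge0|apply: nc_horner_le].
by rewrite nc_cpt0 ger0_norm// ltW.
Qed.

Lemma geometric_le (x : R) n : 0 <= x < 1 -> \sum_(k < n) x ^+ k <= (1 - x)^-1.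
Proof.
move=> /andP[x0 x1]; have d0 : 0 < 1 - x by rewrite subr_gt0.
have h : (1 - x) * \sum_(k < n) x ^+ k = 1 - x ^+ n by rewrite -opprB mulNr -subrX1 opprB.
by rewrite -[leRHS]mul1r ler_pdivlMr// mulrC h gerBl exprn_ge0.
Qed.

(** The derivative of order [m] is bounded on the disc, and [s < m] makes the weight integrable;
    over dyadic annuli this is a geometric series of ratio [x = 2 ^ (- (m - s) q)]. *)
Lemma besov_rotp_lty P t s p q m : 0 <= s -> s < m%:R -> 1 <= p -> (0 < q)%E ->
  (besov_norm s p q m (rotp P t) < +oo)%E.
Proof.
move=> s0 sm p1 q0; have p0 : 0 < p := lt_le_trans ltr01 p1.
set M := poly_norm1 P^`(m); have M0 : 0 <= M by exact: poly_norm1_ge0.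
apply: lte_add_pinfty.
  by apply: lte_sum_pinfty => j _; exact: ltry.
case: q q0 => [q||//]; last first.
  move=> _; apply: (@le_lt_trans _ _ M%:E); last exact: ltry.
  apply: ge_ereal_sup => y [r /=]; rewrite in_itv/= => /andP[r0 r1] <-.
  rewrite lee_fin -[M]mulr1; apply: ler_pM; rewrite ?powR_ge0//.
    by apply: circ_Lp_rotp_le; rewrite // (ltW r0).
  by apply: powR_le1; rewrite ?subr_ge0 ?(ltW sm) ?(ltW r1)// gerBl ltW.
rewrite lte_fin => q0; pose a := m%:R - s.
have a0 : 0 < a by rewrite subr_gt0.
pose x := (2^-1 `^ a) `^ q : R.
have x1 : 0 <= x < 1.
  rewrite powR_ge0/= /x -powRrM.
  have := @gt0_ltr_powR R (a * q) (mulr_gt0 a0 q0) 2^-1 1.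
  rewrite !nnegrE invr_ge0 ler0n ler01 powR1 => -> //.
  by rewrite invf_lt1// ltr1n.
have x10 : 0 < 1 - x by rewrite subr_gt0; case/andP: x1.
have c0 : 0 <= M `^ q / (1 - x) by rewrite divr_ge0 ?powR_ge0// ltW.
apply: (@le_lt_trans _ _ (((M `^ q / (1 - x)) `^ q^-1)%:E)); last exact: ltry.
have hM k r : dyad k <= r < dyad k.+1 -> circ_Lp p (derive1n m (rotp P t)) r <= M.
  move=> /andP[r1 r2]; apply: circ_Lp_rotp_le => //.
  by rewrite (le_trans (dyad_ge0 k) r1) (lt_trans r2 (dyad_lt1 _)).
suff hB n : \sum_(k < n) (M * ((2 ^+ k)^-1) `^ (m%:R - s)) `^ q <= ((M `^ q / (1 - x)) `^ q^-1) `^ q.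
  exact: (besov_tail_le (@holo_rotp P t) p1 q0 (ltW sm) (powR_ge0 _ _) hM hB).
rewrite -powRrM mulVf ?lt0r_neq0// powRr1//.
apply: le_trans (ler_wpM2l (powR_ge0 M q) (geometric_le n x1)).
rewrite mulr_sumr; apply: ler_sum => k _.
rewrite powRM ?powR_ge0//; apply: ler_wpM2l; first exact: powR_ge0.
by rewrite powR_powV.
Qed.

Lemma in_HB_rotp P t s p q m : 0 <= s -> s < m%:R -> 1 <= p -> (0 < q)%E ->
  in_HB s p q m (rotp P t).
Proof. by move=> *; split; [exact: holo_rotp|exact: besov_rotp_lty]. Qed.

End polynomials.

(** * Lacunary sums *)

Section asymptotics.
Context {R : realType}.
Local Notation C := (R[i]).
Local Notation nc := (@Normc.normc R).
Local Notation e := (@unit_pt R).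
Local Notation "x %:C" := (Complex x 0) : ring_scope.
Implicit Types (P g : {poly C}) (p r t x y : R) (m n k : nat).

Lemma bernoulli_ge n x : 0 <= x <= 1 -> 1 - n%:R * x <= (1 - x) ^+ n.
Proof.
move=> /andP[x0 x1]; elim: n => [|n ih]; first by rewrite mul0r subr0 expr0.
have y0 : 0 <= 1 - x by rewrite subr_ge0.
rewrite exprS; apply: le_trans (ler_wpM2l y0 ih).
have -> : (1 - x) * (1 - n%:R * x) = 1 - n.+1%:R * x + n%:R * x * x.
  by rewrite -natr1; ring.
by rewrite lerDl !mulr_ge0.
Qed.

Lemma bernoulli_inv m y : 0 <= y <= 1 -> (1 + y) ^+ m * (1 - m%:R * y) <= 1.
Proof.
move=> y01; have := bernoulli_ge m y01; case/andP: y01 => y0 y1.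
have h0 : 0 <= (1 + y) ^+ m by rewrite exprn_ge0// addr_ge0.
move=> /(ler_wpM2l h0) /le_trans; apply; rewrite -exprMn.
have -> : (1 + y) * (1 - y) = 1 - y ^+ 2 by ring.
by apply: exprn_ile1; rewrite ?gerBl ?sqr_ge0// subr_ge0 exprn_ile1.
Qed.

Lemma ffact_le n m : (n ^_ m <= n ^ m)%N.
Proof.
elim: m => [|m ih]; first by rewrite ffactn0 expn0.
by rewrite ffactnSr expnSr leq_mul// leq_subr.
Qed.

Lemma leq_expl (a b n : nat) : (a <= b)%N -> (a ^ n <= b ^ n)%N.
Proof. by case: n => // n; rewrite leq_exp2r. Qed.

Lemma ffact_ge n m : ((n - m) ^ m <= n ^_ m)%N.
Proof.
elim: m => [|m ih]; first by rewrite ffactn0 expn0.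
rewrite ffactnSr expnSr leq_mul ?leq_sub2l//.
by apply: leq_trans ih; apply: leq_expl; exact: leq_sub2l.
Qed.

Lemma nat_bound (x : R) : exists N0 : nat, forall N, (N0 <= N)%N -> x <= N%:R.
Proof.
exists (Num.bound `|x|) => N hN; apply: (@le_trans _ _ `|x|); first exact: ler_norm.
have := archi_boundP (normr_ge0 x) => /ltW /le_trans; apply.
by rewrite ler_nat.
Qed.

(** With [x = 1 / N], the ratio lies between [(1 - m x) ^ m] and [(1 + k x) ^ m], and [r ^ k]
    between [1 - 2 k x] and 1. The first three terms of [D] are the coefficients of [x] in the
    resulting Bernoulli estimates; the last two ensure [m <= N] and [0 <= r]. The threshold
    [del / (1 + del)] appears because the upper estimate bounds an inverse. *)
Lemma ffact_ratio m k (del : R) : 0 < del -> exists N0 : nat, forall N, (N0 <= N)%N ->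
  forall r, 1 - 2 / N%:R <= r <= 1 -> `|((N + k) ^_ m)%:R / N%:R ^+ m * r ^+ k - 1| <= del.
Proof.
move=> d0; pose D : R := m%:R * m%:R + 2 * k%:R + m%:R * k%:R + m%:R + 2.
have D0 : 0 < D.
  have := mulr_ge0 (ler0n R m) (ler0n R m); have := mulr_ge0 (ler0n R m) (ler0n R k).
  by rewrite /D; have := ler0n R m; have := ler0n R k; lra.
have [N0 hN0] := nat_bound (D * (1 + del^-1)); exists N0.+1 => N hN r /andP[r1 r2].
have Npos : 0 < N%:R :> R by rewrite ltr0n; apply: leq_trans hN.
pose x : R := N%:R^-1; have x0 : 0 < x by rewrite invr_gt0.
have xD : D * x <= del / (1 + del).
  rewrite ler_pdivrMr//; have := hN0 N (ltnW hN).
  have -> : D * (1 + del^-1) = D * (1 + del) / del by field; rewrite lt0r_neq0.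
  rewrite ler_pdivrMr// => h; rewrite mulrAC ler_pdivlMr; last by rewrite addr_gt0.
  by rewrite mulrC [del * _]mulrC mulrC.
have dd : del / (1 + del) < 1 by rewrite ltr_pdivrMr ?addr_gt0// mul1r ltrDr.
have dd2 : del / (1 + del) <= del by rewrite ler_pdivrMr ?addr_gt0// mulrDr mulr1 lerDl mulr_ge0// ltW.
have mm := mulr_ge0 (mulr_ge0 (ler0n R m) (ler0n R m)) (ltW x0).
have mk := mulr_ge0 (mulr_ge0 (ler0n R m) (ler0n R k)) (ltW x0).
have mx := mulr_ge0 (ler0n R m) (ltW x0); have kx := mulr_ge0 (ler0n R k) (ltW x0).
rewrite /D !mulrDl in xD.
have mN : (m <= N)%N.
  by rewrite -(ler_nat R) -[leRHS]mul1r -ler_pdivrMr// -/x; lra.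
pose a : R := ((N + k) ^_ m)%:R / N%:R ^+ m.
have Nm0 : 0 < N%:R ^+ m :> R by rewrite exprn_gt0.
have a1 : a <= (1 + k%:R * x) ^+ m.
  rewrite /a ler_pdivrMr// -exprMn.
  have -> : (1 + k%:R * x) * N%:R = (N + k)%:R by rewrite /x natrD; field; rewrite lt0r_neq0.
  by rewrite -natrX ler_nat ffact_le.
have a2 : (1 - m%:R * x) ^+ m <= a.
  rewrite /a ler_pdivlMr// -exprMn.
  have -> : (1 - m%:R * x) * N%:R = (N - m)%:R by rewrite /x natrB//; field; rewrite lt0r_neq0.
  rewrite -natrX ler_nat; apply: leq_trans (ffact_ge _ _).
  by apply: leq_expl; rewrite leq_sub2r ?leq_addr.
have r0 : 1 - 2 * x <= r by [].
have rp : 0 <= r by lra.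
have rk1 : r ^+ k <= 1 by exact: exprn_ile1.
have rk2 : 1 - k%:R * (2 * x) <= r ^+ k.
  have h : 0 <= 1 - r <= 1 by lra.
  have := bernoulli_ge k h; rewrite opprB addrCA subrr addr0; apply: le_trans.
  by rewrite lerD2l lerN2 ler_wpM2l//; lra.
have am : 1 - m%:R * (m%:R * x) <= a.
  apply: le_trans a2; apply: bernoulli_ge; rewrite mx/=; lra.
have aa : a <= 1 + del.
  apply: (le_trans a1).
  have kx1 : 0 <= k%:R * x <= 1 by rewrite kx/=; lra.
  have := bernoulli_inv m kx1; set w := _ ^+ m => hw.
  have w0 : 0 <= w by rewrite /w exprn_ge0// addr_ge0.
  have c1 : (1 + del)^-1 <= 1 - m%:R * (k%:R * x).
    have -> : (1 + del)^-1 = 1 - del / (1 + del) by field; rewrite lt0r_neq0// addr_gt0.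
    by rewrite lerD2l lerN2; lra.
  have := le_trans (ler_wpM2l w0 c1) hw.
  by rewrite ler_pdivrMr ?addr_gt0// mul1r.
have a0 : 0 <= a by rewrite /a divr_ge0 // ltW.
rewrite -/a ler_norml; apply/andP; split; last first.
  by rewrite lerBlDl; apply: le_trans aa; rewrite ler_piMr.
rewrite lerBrDl.
have p1 : 0 <= 1 - m%:R * (m%:R * x) by rewrite subr_ge0; lra.
have p2 : 0 <= 1 - k%:R * (2 * x) by rewrite subr_ge0; lra.
apply: le_trans (ler_pM p1 p2 am rk2).
have := mulr_ge0 (mulr_ge0 (ler0n R m) mx) (mulr_ge0 (ler0n R k) (mulr_ge0 (ler0n R 2) (ltW x0))).
set u := m%:R * (m%:R * x); set v := k%:R * (2 * x) => uv.
have -> : (1 - u) * (1 - v) = 1 - u - v + u * v by ring.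
rewrite /u /v in uv *; lra.
Qed.

(** [1 - s ^ n] is [1 - s] times a sum of [n] powers, each at least [s ^ n]. It follows that [s ^ n]
    decays at least as fast as [1 / n]. *)
Lemma expr_harmonic (s : R) n : 0 <= s < 1 -> n%:R * (1 - s) * s ^+ n <= 1 - s ^+ n.
Proof.
move=> /andP[s0 s1]; elim: n => [|n ih]; first by rewrite !mul0r expr0 subrr.
have := ler_wpM2l s0 ih; rewrite exprS => h.
have t1 : s ^+ n <= 1 by rewrite exprn_ile1// ltW.
have := mulr_ge0 (_ : 0 <= 1 - s) (_ : 0 <= 1 - s * s ^+ n).
rewrite !subr_ge0 (ltW s1) (_ : s * s ^+ n <= 1); last first.
  by apply: le_trans (ltW s1); rewrite ler_piMr.
move=> /(_ isT isT); rewrite -natr1; lra.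
Qed.

(** By Bernoulli's inequality [rho <= s ^ (m + 1)] for this [s], so [rho ^ N] is bounded by [m + 1]
    factors [s ^ N], each at most [1 / (N (1 - s))]: one power of [N] more than is to be beaten. *)
Lemma expr_decay m (rho del : R) : 0 <= rho < 1 -> 0 < del ->
  exists N0 : nat, forall N, (N0 <= N)%N -> N%:R ^+ m * rho ^+ N <= del.
Proof.
move=> /andP[r0 r1] d0; pose s : R := 1 - (1 - rho) / m.+1%:R.
have q0 : 0 < (1 - rho) / m.+1%:R by rewrite divr_gt0 ?subr_gt0.
have q1 : (1 - rho) / m.+1%:R <= 1.
  by rewrite ler_pdivrMr// mul1r; apply: (@le_trans _ _ 1); rewrite ?ler1n// gerBl.
have s0 : 0 <= s by rewrite subr_ge0.
have s1 : s < 1 by rewrite gtrBl.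
have rs : rho <= s ^+ m.+1.
  apply: le_trans (bernoulli_ge m.+1 _); last by rewrite (ltW q0).
  by rewrite mulrCA divff ?mulr1 ?pnatr_eq0// opprB addrC subrK.
have c0 : 0 < 1 - s by rewrite subr_gt0.
have [N0 hN0] := nat_bound ((1 - s) ^- m.+1 / del); exists N0.+1 => N hN.
have Npos : 0 < N%:R :> R by rewrite ltr0n; apply: leq_trans hN.
have h1 : s ^+ N <= (N%:R * (1 - s))^-1.
  rewrite -[leRHS]mul1r ler_pdivlMr ?mulr_gt0// mulrC.
  apply: le_trans (expr_harmonic N _) _; first by rewrite s0.
  by rewrite gerBl exprn_ge0.
have h2 : rho ^+ N <= (N%:R * (1 - s))^-1 ^+ m.+1.
  apply: (@le_trans _ _ ((s ^+ m.+1) ^+ N)); first by rewrite lerXn2r// nnegrE ?exprn_ge0.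
  by rewrite exprAC lerXn2r// nnegrE ?exprn_ge0// invr_ge0 mulr_ge0// ltW.
apply: (le_trans (ler_wpM2l (exprn_ge0 m (ltW Npos)) h2)).
have := hN0 N (ltnW hN); rewrite ler_pdivrMr// => h3.
rewrite exprVn exprMn invfM (exprSr N%:R) invfM mulrA mulrA divff ?mul1r ?expf_neq0 ?lt0r_neq0//.
by rewrite mulrC ler_pdivrMr// mulrC.
Qed.

Lemma derivn_XnM_horner N m g (z : C) : (m <= N)%N ->
  ('X^N * g)^`(m).[z] = \sum_(k < size g) g`_k * ((N + k) ^_ m)%:R * z ^+ (N - m + k).
Proof.
move=> mN; rewrite -{1}[g]coefK poly_def mulr_sumr.
rewrite (big_morph _ (derivnD m) (_ : 0^`(m) = 0)); last by rewrite -polyC0 derivnC; case: m {mN}.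
rewrite horner_sum; apply: eq_bigr => k _.
rewrite -scalerAr -exprD derivnZ derivnXn hornerZ hornerMn hornerXn.
by rewrite addnBAC// -mulrA mulr_natl.
Qed.

End asymptotics.

(** * Derivatives of [z ^ N g] at distance about [1 / N] from the circle *)

Section scales.
Context {R : realType}.
Local Notation C := (R[i]).
Local Notation nc := (@Normc.normc R).
Local Notation e := (@unit_pt R).
Local Notation "x %:C" := (Complex x 0) : ring_scope.
Implicit Types (P g : {poly C}) (p r t eps : R) (m n k K : nat).

Lemma ffact_ratio_all m n (del : R) : 0 < del -> exists N0 : nat, forall N, (N0 <= N)%N ->
  forall k r, (k < n)%N -> 1 - 2 / N%:R <= r <= 1 ->
  `|((N + k) ^_ m)%:R / N%:R ^+ m * r ^+ k - 1| <= del.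
Proof.
move=> d0; elim: n => [|n [N1 h1]]; first by exists 0%N.
have [N2 h2] := ffact_ratio m n d0.
exists (maxn N1 N2) => N; rewrite geq_max => /andP[l1 l2] k r.
by rewrite ltnS leq_eqVlt => /predU1P[->|kn] hr; [exact: h2|exact: h1].
Qed.

Lemma nc_horner_perturb g (c : nat -> R) (del : R) (z : C) : nc z <= 1 ->
  (forall k, (k < size g)%N -> `|c k - 1| <= del) ->
  nc g.[z] - del * poly_norm1 g <= nc (\sum_(k < size g) g`_k * (c k)%:C * z ^+ k).
Proof.
move=> z1 hc; rewrite lerBlDr -lerBlDl; apply: le_trans (ncB_ge _ _) _.
rewrite horner_coef -sumrB; apply: le_trans (nc_sum _ _) _.
rewrite /poly_norm1 mulr_sumr; apply: ler_sum => k _.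
have -> : g`_k * z ^+ k - g`_k * (c k)%:C * z ^+ k = (1 - c k)%:C * (g`_k * z ^+ k).
  have -> : (1 - c k)%:C = 1 - (c k)%:C by apply/eqP; rewrite eq_complex/= subr0 !eqxx.
  ring.
rewrite !ncM ncX nc_real distrC; apply: ler_pM => //; first by rewrite mulr_ge0 ?nc_ge0// exprn_ge0// nc_ge0.
  exact: hc.
by apply: ler_piMr; [exact: nc_ge0|apply: exprn_ile1 => //; exact: nc_ge0].
Qed.

(** Origin of the constant [16^-1]: the power [2 ^ K] of [1 - 2 ^- K.+1] is at least 1/2 by
    Bernoulli's inequality, and [2 ^ K.+2] is four times that exponent. *)
Lemma dyad_expr_ge K r : dyad K.+1 <= r -> 16^-1 <= r ^+ (2 ^ K.+2).
Proof.
move=> hr; have d0 : 0 <= dyad K.+1 :> R := dyad_ge0 _.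
have h2 : (2^-1 : R) <= dyad K.+1 ^+ (2 ^ K).
  have u0 : 0 <= ((2 : R) ^+ K.+1)^-1 <= 1.
    by rewrite invr_ge0 exprn_ge0//= invf_le1 ?exprn_gt0// exprn_ege1// ler1n.
  apply: le_trans (bernoulli_ge (2 ^ K) u0).
  rewrite exprS invfM natrX mulrCA divff ?mulr1 ?expf_neq0//.
  by rewrite [leRHS](_ : _ = 2^-1)//; field.
have -> : (2 ^ K.+2 = 2 ^ K * 4)%N by rewrite mulnC !expnS mulnA.
rewrite exprM; apply: (@le_trans _ _ ((2^-1) ^+ 4)).
  by rewrite exprVn -natrX.
rewrite lerXn2r// ?nnegrE ?invr_ge0 ?exprn_ge0 ?(le_trans d0 hr)//.
by apply: (le_trans h2); rewrite lerXn2r// nnegrE (le_trans d0 hr).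
Qed.

Lemma leq_pow2S K : (K <= 2 ^ K.+1)%N.
Proof. by apply: leq_trans (ltnW (ltn_expl K (isT : 1 < 2)%N)) _; rewrite leq_exp2l. Qed.

Lemma dyad_pow2 K : dyad K = 1 - 2 / (2 ^ K.+1)%:R :> R.
Proof. by rewrite /dyad natrX exprS; congr (_ - _); field; rewrite expf_neq0. Qed.

(** On this annulus [1 - r] lies between [1 / N] and [2 / N], where [N = 2 ^ K.+1]. Each coefficient
    of [g] is multiplied by nearly [N ^ m], the powers [r ^ k] included, and the common factor
    [r ^ (N - m)] is at least [16^-1]; what remains is [g] at the boundary point [e t]. *)
Lemma scale_lower m g eps : 0 < eps -> exists K0 : nat, forall K, (K0 <= K)%N ->
  forall r, dyad K <= r < dyad K.+1 -> forall t,
  (2 ^ K.+1)%:R ^+ m * (16^-1 * nc g.[e t] - eps) <= nc ('X^(2 ^ K.+1) * g)^`(m).[cpt 0 r t].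
Proof.
move=> e0; have n0 : 0 < 1 + poly_norm1 g by rewrite ltr_pwDl// poly_norm1_ge0.
have [N0 hN0] := ffact_ratio_all m (size g) (divr_gt0 e0 n0).
(* [K >= 1] makes [dyad_expr_ge] applicable, and [m <= K <= N] gives a meaning to the exponent
   [N - m]. *)
exists (maxn 1 (maxn m N0)) => K; rewrite !geq_max => /andP[K1 /andP[mK NK]] r /andP[r1 r2] t.
set N := (2 ^ K.+1)%N.
have KN : (K <= N)%N := leq_pow2S K.
have mN := leq_trans mK KN.
have Npos : 0 < N%:R :> R by rewrite ltr0n expn_gt0.
have Nm0 : 0 < N%:R ^+ m :> R by rewrite exprn_gt0.
have r0 : 0 <= r := le_trans (dyad_ge0 K) r1.
have rle1 : r <= 1 := ltW (lt_trans r2 (dyad_lt1 _)).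
have hr : 1 - 2 / N%:R <= r <= 1 by rewrite -dyad_pow2 r1.
pose c k := ((N + k) ^_ m)%:R / N%:R ^+ m * r ^+ k.
have hc k : (k < size g)%N -> `|c k - 1| <= eps / (1 + poly_norm1 g).
  by move=> kg; apply: hN0 => //; exact: leq_trans NK KN.
have zE k : cpt 0 r t ^+ k = (r ^+ k)%:C * e t ^+ k by rewrite /cpt add0r exprMn realCX.
rewrite derivn_XnM_horner//.
have -> : \sum_(k < size g) g`_k * ((N + k) ^_ m)%:R * cpt 0 r t ^+ (N - m + k) =
    (N%:R ^+ m * r ^+ (N - m))%:C * e t ^+ (N - m) * \sum_(k < size g) g`_k * (c k)%:C * e t ^+ k.
  rewrite mulr_sumr; apply: eq_bigr => k _; rewrite zE !exprD.
  have -> : ((N + k) ^_ m)%:R = (((N + k) ^_ m)%:R : R)%:C by exact: (esym (rmorph_nat (real_complex R) _)).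
  have CM (x y : R) : (x * y)%:C = x%:C * y%:C by apply/eqP; rewrite eq_complex/= !mulr0 !mul0r subr0 addr0 !eqxx.
  have -> : ((N + k) ^_ m)%:R = N%:R ^+ m * (((N + k) ^_ m)%:R / N%:R ^+ m) :> R.
    by rewrite mulrC divfK// lt0r_neq0.
  by rewrite /c !CM; ring.
rewrite ncM ncM ncX nc_unit expr1n mulr1 nc_real ger0_norm; last by rewrite mulr_ge0 ?exprn_ge0.
rewrite -mulrA ler_pM2l//.
have u1 : nc (e t) <= 1 by rewrite nc_unit.
have hS := nc_horner_perturb u1 hc; move: hS; set S := nc (\sum_(k < _) _) => hS.
have S0 : 0 <= S by exact: nc_ge0.
have rN : 16^-1 <= r ^+ (N - m).
  have : 16^-1 <= r ^+ N by rewrite /N; case: (K) K1 r1 => // K' _; exact: dyad_expr_ge.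
  by move=> /le_trans; apply; rewrite -{1}(subnK mN) exprD ler_piMr ?exprn_ge0// exprn_ile1.
apply: le_trans (ler_wpM2r S0 rN).
have ee : eps / (1 + poly_norm1 g) * poly_norm1 g <= eps.
  by rewrite mulrAC ler_pdivrMr// ler_pM2l// lerDr.
lra.
Qed.

Lemma scale_small m g (rho eps : R) : 0 <= rho < 1 -> 0 < eps -> exists K0 : nat,
  forall K, (K0 <= K)%N -> forall z, nc z <= rho -> nc ('X^(2 ^ K.+1) * g)^`(m).[z] <= eps.
Proof.
(* The maximum with 1/2 keeps [s] positive, since the exponent [N - m + k] is completed to [N + k]
   by a factor [s ^+ m], which must be cancelled. *)
move=> rho01 e0; pose s := Num.max rho 2^-1.
have s0 : 0 < s by rewrite lt_max invr_gt0 ltr0n orbT.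
have s1 : s < 1 by rewrite gt_max (andP rho01).2 invf_lt1// ltr1n.
have n0 : 0 < 1 + poly_norm1 g by rewrite ltr_pwDl// poly_norm1_ge0.
have sm0 : 0 < s ^+ m by rewrite exprn_gt0.
have d0 : 0 < eps / (1 + poly_norm1 g) * s ^+ m by rewrite mulr_gt0// divr_gt0.
have s01 : 0 <= s < 1 by rewrite (ltW s0).
have [N0 hN0] := expr_decay m s01 d0.
exists (maxn m N0) => K; rewrite geq_max => /andP[mK NK] z zr; set N := (2 ^ K.+1)%N.
have KN : (K <= N)%N := leq_pow2S K.
have mN := leq_trans mK KN.
rewrite derivn_XnM_horner//; apply: le_trans (nc_sum _ _) _.
apply: (@le_trans _ _ (\sum_(k < size g) nc g`_k * (eps / (1 + poly_norm1 g)))); last first.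
  rewrite -mulr_suml -/(poly_norm1 g) mulrC mulrAC ler_pdivrMr//.
  by rewrite ler_pM2l// lerDr.
apply: ler_sum => k _; rewrite -mulrA ncM ler_wpM2l ?nc_ge0//.
have -> : ((N + k) ^_ m)%:R = (((N + k) ^_ m)%:R : R)%:C by exact: (esym (rmorph_nat (real_complex R) _)).
rewrite ncM nc_real ncX ger0_norm//.
have zs : nc z ^+ (N - m + k) <= s ^+ (N - m + k).
  by rewrite lerXn2r ?nnegrE ?nc_ge0 ?(ltW s0)// (le_trans zr)// le_max lexx.
have f1 : ((N + k) ^_ m)%:R <= (N + k)%:R ^+ m :> R by rewrite -natrX ler_nat ffact_le.
apply: (le_trans (ler_pM (ler0n _ _) (exprn_ge0 _ (nc_ge0 _)) f1 zs)).
rewrite -(ler_pM2r sm0) -mulrA -exprD addnAC subnK//.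
by apply: hN0; apply: leq_trans NK _; apply: leq_trans KN _; exact: leq_addr.
Qed.

(** A pair [(K, g)] stands for a term attached to the annulus from [dyad K] to [dyad K.+1], where
    its derivative is large. *)
Definition lacunary (xs : seq (nat * {poly C})) : {poly C} :=
  \sum_(x <- xs) 'X^(2 ^ x.1.+1) * x.2.

(* The exponents are chosen one after the other: on the annulus of the new term the previous
   terms are negligible against [(2 ^ K.+1) ^ m], and on the previous annuli the new term is
   small. *)
Lemma multi_scale m (gs : seq {poly C}) eps : (0 < m)%N -> 0 < eps ->
  exists xs, [/\ unzip2 xs = gs, uniq (unzip1 xs) & forall x, x \in xs ->
    forall r, dyad x.1 <= r < dyad x.1.+1 -> forall t,
    (2 ^ x.1.+1)%:R ^+ m * (16^-1 * nc x.2.[e t] - eps) <= nc (lacunary xs)^`(m).[cpt 0 r t]].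
Proof.
move=> m0; elim: gs eps => [|g gs ih] eps e0; first by exists [::].
have e20 : 0 < eps / 2 by rewrite divr_gt0.
have [xs [xs2 xs1 hxs]] := ih _ e20.
pose Kx := \max_(x <- xs) x.1.
have [K1 h1] := scale_lower m g e20.
have rho01 : 0 <= (dyad Kx.+1 : R) < 1 by rewrite dyad_ge0 dyad_lt1.
have [K2 h2] := scale_small m g rho01 e20.
pose B := poly_norm1 (lacunary xs)^`(m).
have [K3 h3] := nat_bound (B / (eps / 2)).
pose K := maxn Kx.+1 (maxn K1 (maxn K2 K3)).
have [KKx [KK1 [KK2 KK3]]] : (Kx < K /\ K1 <= K /\ K2 <= K /\ K3 <= K)%N.
  by rewrite /K !leq_max !leqnn !orbT.
have Kle x : x \in xs -> (x.1 <= Kx)%N.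
  by move=> xin; rewrite /Kx; apply: (@leq_bigmax_seq _ xs predT (fun x => x.1)).
have lacE : lacunary ((K, g) :: xs) = 'X^(2 ^ K.+1) * g + lacunary xs by rewrite /lacunary big_cons.
exists ((K, g) :: xs); split=> /=; first by rewrite xs2.
  rewrite xs1 andbT; apply/mapP => -[x /Kle xK KE].
  by move: KKx; rewrite KE ltnNge xK.
move=> x; rewrite inE lacE derivnD => /predU1P[->|xin] r hr t; rewrite hornerD.
  have := h1 K KK1 r hr t; move: hr => /= /andP[r1 r2].
  have z1 : nc (cpt 0 r t) <= 1.
    rewrite nc_cpt0 ger0_norm; first by rewrite ltW// (lt_trans r2)// dyad_lt1.
    exact: le_trans (dyad_ge0 K) r1.
  have hB : nc (lacunary xs)^`(m).[cpt 0 r t] <= B := nc_horner_le _ z1.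
  have Bn : B <= (2 ^ K.+1)%:R ^+ m * (eps / 2).
    rewrite -ler_pdivrMr//; apply: (le_trans (h3 K KK3)).
    rewrite -natrX ler_nat -(prednK m0) expnS.
    apply: leq_trans (leq_pmulr _ _); last by rewrite expn_gt0 expn_gt0.
    exact: leq_pow2S.
  set u := 'X^_ * _; set v := lacunary xs in hB *; move=> h.
  have := ncB_ge u^`(m).[cpt 0 r t] (- v^`(m).[cpt 0 r t]); rewrite ncN opprK => k.
  apply: le_trans k; rewrite lerBrDr; apply: le_trans (lerD (lexx _) (le_trans hB Bn)) _.
  by apply: le_trans h; rewrite -mulrDr -subr_ge0 -mulrBr mulr_ge0//; lra.
have := hxs x xin r hr t; move: hr => /= /andP[r1 r2].
have zr : nc (cpt 0 r t) <= dyad Kx.+1.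
  rewrite nc_cpt0 ger0_norm ?(le_trans (dyad_ge0 x.1) r1)//; apply: ltW; apply: lt_le_trans r2 _.
  rewrite /dyad lerD2l lerN2 lef_pV2 ?posrE ?exprn_gt0// ler_weXn2l ?ler1n//.
  by rewrite ltnS Kle.
have hB := h2 K KK2 _ zr.
set u := 'X^_ * _ in hB *; set v := lacunary xs; move=> h.
have := ncB_ge v^`(m).[cpt 0 r t] (- u^`(m).[cpt 0 r t]); rewrite ncN opprK => k.
rewrite (addrC u^`(m).[_]); apply: le_trans k; rewrite lerBrDr; apply: le_trans (lerD (lexx _) hB) _.
apply: le_trans h.
have n1 : 1 <= (2 ^ x.1.+1)%:R ^+ m :> R by rewrite exprn_ege1// ler1n expn_gt0.
have := ler_wpM2r (ltW e20) n1; rewrite mul1r; move: (_ ^+ m) => n h.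
have -> : n * (16^-1 * nc x.2.[e t] - eps / 2) = n * (16^-1 * nc x.2.[e t] - eps) + n * (eps / 2) by field.
by rewrite lerD2l.
Qed.

End scales.

(** * Lower bounds for Besov norms *)

Section lower_bounds.
Context {R : realType}.
Local Notation C := (R[i]).
Local Notation nc := (@Normc.normc R).
Local Notation e := (@unit_pt R).
Local Notation mu := (@lebesgue_measure R).
Implicit Types (P g : {poly C}) (p r t s : R) (m k K : nat).

Lemma powR_split_max p (a b : R) : 0 <= p -> 0 <= a -> 0 <= b ->
  (a + b) `^ p <= 2 `^ p * (a `^ p + b `^ p).
Proof.
move=> p0 a0 b0; wlog ab : a b a0 b0 / a <= b.
  by move=> h; have [/h|/ltW/h] := leP a b; [exact|rewrite addrC (addrC (b `^ p)); exact].
apply: (@le_trans _ _ ((2 * b) `^ p)).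
  by apply: le_powR; rewrite ?addr_ge0//; lra.
by rewrite powRM//; apply: ler_wpM2l; [exact: powR_ge0|rewrite lerDr powR_ge0].
Qed.

(** [(4 w) ^ p] is [2 ^ p * 2 ^ p * w ^ p], and [2 ^ p >= 2] because [p >= 1]; one of the two copies
    of [w ^ p] absorbs the error term. *)
Lemma powR_four_bound p (w I : R) : 1 <= p -> 0 <= w ->
  (4 * w) `^ p <= 2 `^ p * (I + w `^ p) -> w `^ p <= I.
Proof.
move=> p1 w0; have -> : 4 * w = 2 * (2 * w) by ring.
rewrite !powRM ?mulr_ge0// ler_pM2l ?powR_gt0//.
have : 2 `^ 1 <= 2 `^ p :> R by apply: ler_powR => //; rewrite ler1n.
rewrite powRr1// => /(ler_wpM2r (powR_ge0 w p)); lra.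
Qed.

(** Origin of the constant [64^-1]: the error subtracted in the pointwise bound is a quarter of the
    norm of the main term [16^-1 * nc g.[e t]], and [powR_four_bound] absorbs it. Powers are
    compared after moving the error to the other side, as the pointwise lower bound may be
    negative. *)
Lemma pmean_poly_ge p g (h : C -> C) (X r : R) : 1 <= p -> 0 <= X ->
  continuous (fun t => nc (h (cpt 0 r t)) `^ p) ->
  (forall t, X * (16^-1 * nc g.[e t] - 64^-1 * pmean p (horner g) 1 `^ p^-1) <= nc (h (cpt 0 r t))) ->
  X * (64^-1 * pmean p (horner g) 1 `^ p^-1) <= pmean p h r `^ p^-1.
Proof.
move=> p1 X0 ch hh; have p0 : 0 < p := lt_le_trans ltr01 p1.
have A0 := pmean_ge0 p (horner g) 1; set A := pmean p (horner g) 1 in A0 hh *.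
have AE : (A `^ p^-1) `^ p = A by rewrite -powRrM mulVf ?lt0r_neq0// powRr1.
set ep := 64^-1 * A `^ p^-1 in hh *.
have ep0 : 0 <= ep by rewrite mulr_ge0 ?powR_ge0// invr_ge0.
have w0 : 0 <= X * ep by rewrite mulr_ge0.
suff key : (X * ep) `^ p <= pmean p h r.
  have E : ((X * ep) `^ p) `^ p^-1 = X * ep by rewrite -powRrM divff ?lt0r_neq0// powRr1.
  by rewrite -E; apply: (le_powR _ (powR_ge0 _ _) key); rewrite invr_ge0 ltW.
apply: powR_four_bound => //.
have -> : 4 * (X * ep) = (X * 16^-1) * A `^ p^-1 by rewrite /ep; field.
have X160 : 0 <= X * 16^-1 by rewrite mulr_ge0// invr_ge0.
rewrite powRM ?powR_ge0// AE /A !pmeanE.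
have cg : {within `[(0 : R), 1], continuous (fun t => nc g.[cpt 0 1 t] `^ p)}.
  by apply: continuous_subspaceT; exact: continuous_poly_cpt.
have cw : {within `[(0 : R), 1], continuous (fun=> (X * ep) `^ p : R)}.
  exact/continuous_subspaceT/cst_continuous.
have ch' : {within `[(0 : R), 1], continuous (fun t => nc (h (cpt 0 r t)) `^ p)}.
  exact: continuous_subspaceT.
have cs : {within `[(0 : R), 1], continuous (fun t => nc (h (cpt 0 r t)) `^ p + (X * ep) `^ p)}.
  by move=> t; apply: cvgD; [exact: ch'|exact: cw].
have -> : 2 `^ p * (cavg (fun z => nc (h z) `^ p) r + (X * ep) `^ p) =
  rint 0 1 (fun t => 2 `^ p * (nc (h (cpt 0 r t)) `^ p + (X * ep) `^ p)).
  by rewrite rintZ// rintD// rint_cst// subr0 mulr1.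
rewrite -rintZ//; apply: le_rint.
- by move=> t; apply: cvgM; [exact: cvg_cst|exact: cg].
- by move=> t; apply: cvgM; [exact: cvg_cst|exact: cs].
move=> t _; rewrite -powRM ?nc_ge0//.
apply: le_trans (powR_split_max (ltW p0) (nc_ge0 _) w0).
apply: le_powR; [exact: ltW|by rewrite mulr_ge0 ?nc_ge0|].
have -> : cpt 0 1 t = e t by rewrite /cpt add0r mul1r.
have := hh t; lra.
Qed.

Section tail_lower.
Variables (f : C^o -> C^o) (p s : R) (m : nat).
Hypotheses (hf : holo f) (p1 : 1 <= p) (sm : s <= m%:R).

Lemma scale_powR K : (2 ^+ K.+1)^-1 `^ (m%:R - s) = ((2 ^ K.+1)%:R ^+ m)^-1 * (2 ^ K.+1)%:R `^ s :> R.
Proof.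
have n0 : (2 ^ K.+1)%:R != 0 :> R by rewrite pnatr_eq0 expn_eq0.
rewrite -natrX -powR_inv1 ?ler0n// -powRrM mulN1r opprB addrC powRD; last by rewrite n0 implybT.
by rewrite -powR_mulrn// -powRN mulrC.
Qed.

Lemma besov_integrand_ge (N X L q r : R) K : 0 < q -> 0 <= X ->
  (2 ^ K.+1)%:R ^+ m * X <= N -> 0 <= L <= (2 ^ K.+1)%:R `^ s ->
  dyad K < r < dyad K.+1 ->
  2 ^+ K * (X * L) `^ q <= (N * (1 - r) `^ (m%:R - s - q^-1)) `^ q.
Proof.
move=> q0 X0 XN /andP[L0 Ls] /andP[r1 r2].
have u0 : 0 < (2 ^+ K.+1)^-1 :> R by rewrite invr_gt0 exprn_gt0.
have d1 : 1 - r <= (2 ^+ K)^-1 by move: r1; rewrite /dyad => r1; lra.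
have d2 : (2 ^+ K.+1)^-1 <= 1 - r by move: r2; rewrite /dyad => r2; lra.
have d0 : 0 < 1 - r := lt_le_trans u0 d2.
have N0 : 0 <= N by apply: le_trans XN; rewrite mulr_ge0// exprn_ge0.
have a0 : 0 <= m%:R - s by rewrite subr_ge0.
have n0 : (2 ^ K.+1)%:R != 0 :> R by rewrite pnatr_eq0 expn_eq0.
rewrite (powRM _ N0 (powR_ge0 _ _)).
have -> : ((1 - r) `^ (m%:R - s - q^-1)) `^ q = ((1 - r) `^ (m%:R - s)) `^ q * (1 - r)^-1.
  rewrite -!powRrM mulrBl mulVf ?lt0r_neq0// powRD ?(lt0r_neq0 d0) ?implybT//.
  by rewrite powR_inv1 ?(ltW d0).
rewrite mulrA -powRM ?powR_ge0// mulrC; apply: ler_pM; rewrite ?powR_ge0 ?exprn_ge0//.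
  apply: le_powR; [exact: ltW|exact: mulr_ge0|].
  apply: (@le_trans _ _ ((2 ^ K.+1)%:R ^+ m * X * ((2 ^+ K.+1)^-1) `^ (m%:R - s))); last first.
    apply: ler_pM => //; rewrite ?powR_ge0 ?mulr_ge0 ?exprn_ge0//.
    by apply: le_powR => //; exact: ltW.
  rewrite scale_powR; have := expf_neq0 m n0; move: (_ ^+ m) => a a0'.
  have -> : a * X * (a^-1 * (2 ^ K.+1)%:R `^ s) = X * (2 ^ K.+1)%:R `^ s by field.
  exact: ler_wpM2l.
by rewrite -[leLHS]invrK lef_pV2 ?posrE// invr_gt0 exprn_gt0.
Qed.

(** The annuli are disjoint, and each contributes at least [(X L) ^ q / 2]: the integrand is at
    least [2 ^ K (X L) ^ q] on an interval of length [2 ^- K.+1]. Hence the factor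
    [(size Ks / 2) ^ (1 / q)]. *)
Lemma besov_tail_ge (q X L : R) (Ks : seq nat) : 0 < q -> 0 <= X -> 0 <= L -> uniq Ks ->
  (forall K, K \in Ks -> L <= (2 ^ K.+1)%:R `^ s) ->
  (forall K, K \in Ks -> forall r, dyad K <= r < dyad K.+1 ->
     (2 ^ K.+1)%:R ^+ m * X <= circ_Lp p (derive1n m f) r) ->
  ((((size Ks)%:R / 2) `^ q^-1 * (X * L))%:E <= besov_tail s p q%:E m f)%E.
Proof.
move=> q0 X0 L0 uK hL hK.
pose h r := (circ_Lp p (derive1n m f) r * (1 - r) `^ (m%:R - s - q^-1)) `^ q.
pose F K := [set` `](dyad K : R), dyad K.+1[].
have mF K : measurable (F K) by exact: measurable_itv.
have dS n : (dyad n : R) < dyad n.+1 by rewrite -dyadS ltrDl invr_gt0 exprn_gt0.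
have dmono j k : (j <= k)%N -> (dyad j : R) <= dyad k.
  by move=> jk; apply: (homo_leq (r := fun x y : R => x <= y)) jk => // [a b c|n]; [exact: le_trans|exact: ltW].
have F01 K : F K `<=` `](0 : R), 1[.
  move=> r; rewrite /F/= !in_itv/= => /andP[r1 r2].
  by rewrite (le_lt_trans (dyad_ge0 K) r1) (lt_trans r2 (dyad_lt1 _)).
have mh : measurable_fun `](0 : R), 1[ (EFin \o h).
  apply/measurable_EFinP; apply: measurable_funS (measurable_besov_integrand hf p1 m _ q) => //.
  by move=> r; rewrite /= !in_itv/= => /andP[/ltW -> ->].
have h0 r : (0 <= (EFin \o h) r)%E by rewrite lee_fin; exact: powR_ge0.
have tF : trivIset [set` Ks] F.
  have disj j k : (j < k)%N -> F j `&` F k = set0.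
    move=> jk; apply/seteqP; split=> // r [].
    rewrite /F/= !in_itv/= => /andP[_ r1] /andP[r2 _].
    by have := lt_trans r2 r1; rewrite ltNge dmono.
  apply/trivIsetP => j k _ _; case: (ltngtP j k) => // jk _; first exact: disj.
  by rewrite setIC; exact: disj.
pose D := \big[setU/set0]_(K <- Ks) F K.
have mD : measurable D by apply: bigsetU_measurable => K _.
have D01 : D `<=` `](0 : R), 1[.
  by rewrite /D; elim: (Ks) => [|K l ih]; rewrite ?big_nil ?big_cons// subUset; split.
have I1 : (((size Ks)%:R / 2 * (X * L) `^ q)%:E <= \int[mu]_(r in `]0%R, 1%R[) (EFin \o h) r)%E.
  apply: (@le_trans _ _ (\int[mu]_(r in D) (EFin \o h) r)%E); last first.
    by apply: ge0_subset_integral.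
  rewrite ge0_integral_bigsetU//; last by apply: measurable_funS mh.
  have -> : ((size Ks)%:R / 2 * (X * L) `^ q)%:E = (\sum_(K <- Ks) (2^-1 * (X * L) `^ q)%:E)%E.
    rewrite sumEFin; congr EFin; rewrite big_const_seq count_predT iter_addr_0.
    by rewrite -mulrA mulr_natl.
  rewrite big_seq [leRHS]big_seq; apply: lee_sum => K Kin.
  have L1 : ((\int[mu]_(r in F K) (2 ^+ K * (X * L) `^ q)%:E)%E = (2^-1 * (X * L) `^ q)%:E :> \bar R)%E.
    have muF : mu (F K) = (dyad K.+1 - dyad K)%:E.
      by rewrite /F lebesgue_measure_itv/= lte_fin dS.
    rewrite (integral_cst mu (mF K)) [X in (_ * X)%E]muF -EFinM -dyadS addrAC subrr add0r exprS; congr EFin.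
    by field; rewrite expf_neq0.
  rewrite -L1; apply: ge0_le_integral => //.
  - exact: mF.
  - by move=> r _; rewrite lee_fin mulr_ge0 ?powR_ge0// exprn_ge0.
  - by apply: measurable_funS mh => //; exact: F01.
  move=> r; rewrite /F/= in_itv/= => /andP[r1 r2]; rewrite lee_fin.
  apply: besov_integrand_ge; rewrite ?r1 ?r2 ?L0 ?hL//.
  by apply: hK => //; rewrite (ltW r1).
have E : ((size Ks)%:R / 2) `^ q^-1 * (X * L) = ((size Ks)%:R / 2 * (X * L) `^ q) `^ q^-1.
  have n20 : 0 <= (size Ks)%:R / 2 :> R by rewrite divr_ge0.
  have E2 : ((X * L) `^ q) `^ q^-1 = X * L.
    by rewrite -powRrM divff ?lt0r_neq0// powRr1// mulr_ge0.
  by rewrite (powRM _ n20 (powR_ge0 _ _)) E2.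
rewrite E -poweR_EFin /besov_tail; apply: lee_poweR I1; first by rewrite invr_ge0 ltW.
by rewrite lee_fin mulr_ge0 ?powR_ge0// divr_ge0.
Qed.

Lemma besov_tail_ge_inf (X : R) K : (0 < K)%N -> 0 <= X ->
  (forall r, dyad K <= r < dyad K.+1 -> (2 ^ K.+1)%:R ^+ m * X <= circ_Lp p (derive1n m f) r) ->
  ((X * (2 ^ K.+1)%:R `^ s)%:E <= besov_tail s p +oo m f)%E.
Proof.
move=> K0 X0 hX; have n0 : (2 ^ K.+1)%:R != 0 :> R by rewrite pnatr_eq0 expn_eq0.
(* [K > 0] places the radius [dyad K] in the open interval over which the supremum is taken. *)
have d01 : 0 < (dyad K : R) < 1.
  rewrite dyad_lt1 andbT subr_gt0 invf_lt1 ?exprn_gt0//.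
  by rewrite exprn_egt1 ?ltr1n// -lt0n.
have dS : (dyad K : R) < dyad K.+1 by rewrite -dyadS ltrDl invr_gt0 exprn_gt0.
apply: (@le_trans _ _ ((circ_Lp p (derive1n m f) (dyad K) * (1 - dyad K) `^ (m%:R - s))%:E)).
  rewrite lee_fin; apply: (@le_trans _ _ ((2 ^ K.+1)%:R ^+ m * X * ((2 ^+ K.+1)^-1) `^ (m%:R - s))); last first.
    have u0 : 0 <= (2 ^+ K.+1)^-1 :> R by rewrite invr_ge0 exprn_ge0.
    apply: ler_pM; rewrite ?powR_ge0 ?mulr_ge0 ?exprn_ge0//; first by apply: hX; rewrite lexx dS.
    apply: le_powR => //; first by rewrite subr_ge0.
    by rewrite /dyad opprB addrC subrK lef_pV2 ?posrE ?exprn_gt0// ler_weXn2l ?ler1n.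
  rewrite scale_powR; have := expf_neq0 m n0; move: (_ ^+ m) => a a0'.
  by have -> : a * X * (a^-1 * (2 ^ K.+1)%:R `^ s) = X * (2 ^ K.+1)%:R `^ s by field.
by apply: ereal_sup_ubound; exists (dyad K) => //=; rewrite in_itv.
Qed.

End tail_lower.

(** The constant of [besov_tail_ge] for a single annulus; the value 1 serves [q = +oo], where the
    tail is a supremum. *)
Definition tail_const (q : \bar R) : R := if q is q'%:E%E then (2^-1) `^ q'^-1 else 1.

Lemma tail_const_gt0 q : 0 < tail_const q.
Proof. by case: q => //= q; apply: powR_gt0; rewrite invr_gt0. Qed.

Lemma besov_tail_ge_one (f : C^o -> C^o) p s (q : \bar R) m (X : R) K : holo f -> 1 <= p -> s <= m%:R ->
  (0 < q)%E -> (0 < K)%N -> 0 <= X ->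
  (forall r, dyad K <= r < dyad K.+1 -> (2 ^ K.+1)%:R ^+ m * X <= circ_Lp p (derive1n m f) r) ->
  ((tail_const q * (X * (2 ^ K.+1)%:R `^ s))%:E <= besov_tail s p q m f)%E.
Proof.
move=> hf p1 sm q0 K0 X0 hX; case: q q0 => [q||//].
  rewrite lte_fin => q0.
  have := @besov_tail_ge f p s m hf p1 sm q X ((2 ^ K.+1)%:R `^ s) [:: K] q0 X0 (powR_ge0 _ _) isT.
  rewrite /= mul1r; apply; first by move=> K'; rewrite inE => /eqP ->.
  by move=> K'; rewrite inE => /eqP ->.
by move=> _; rewrite mul1r; exact: besov_tail_ge_inf.
Qed.

End lower_bounds.

(** * Averaging over rotations *)

Section rotation_average.
Context {R : realType}.
Local Notation C := (R[i]).
Local Notation nc := (@Normc.normc R).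
Local Notation e := (@unit_pt R).
Local Notation Re := (@complex.Re R).
Local Notation Im := (@complex.Im R).
Local Notation leb := (@lebesgue_measure R).

Definition cmeas d (T : measurableType d) (h : T -> C) :=
  measurable_fun setT (fun x => Re (h x)) /\ measurable_fun setT (fun x => Im (h x)).

Lemma cmeas_cst d (T : measurableType d) (c : C) : cmeas (fun _ : T => c).
Proof. by split; exact: measurable_cst. Qed.

Lemma cmeasD d (T : measurableType d) (g h : T -> C) :
  cmeas g -> cmeas h -> cmeas (fun x => g x + h x).
Proof.
move=> [g1 g2] [h1 h2]; split.
  have -> : (fun x => Re (g x + h x)) = (fun x => Re (g x) + Re (h x)) by apply/funext => x; rewrite cReD.
  exact: measurable_funD.
have -> : (fun x => Im (g x + h x)) = (fun x => Im (g x) + Im (h x)) by apply/funext => x; rewrite cImD.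
exact: measurable_funD.
Qed.

Lemma cmeasM d (T : measurableType d) (g h : T -> C) :
  cmeas g -> cmeas h -> cmeas (fun x => g x * h x).
Proof.
move=> [g1 g2] [h1 h2]; split.
  have -> : (fun x => Re (g x * h x)) = (fun x => Re (g x) * Re (h x) - Im (g x) * Im (h x)).
    by apply/funext => x; rewrite cReM.
  by apply: measurable_funB; exact: measurable_funM.
have -> : (fun x => Im (g x * h x)) = (fun x => Re (g x) * Im (h x) + Im (g x) * Re (h x)).
  by apply/funext => x; rewrite cImM.
by apply: measurable_funD; exact: measurable_funM.
Qed.

Lemma cmeas_horner d (T : measurableType d) (h : T -> C) (P : {poly C}) :
  cmeas h -> cmeas (fun x => P.[h x]).
Proof.
move=> ch; elim/poly_ind: P => [|P c ih].
  have -> : (fun x => (0 : {poly C}).[h x]) = (fun=> 0) by apply/funext => x; rewrite horner0.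
  exact: cmeas_cst.
have -> : (fun x => (P * 'X + c%:P).[h x]) = (fun x => P.[h x] * h x + c).
  by apply/funext => x; rewrite hornerMXaddC.
by apply: cmeasD; [exact: cmeasM|exact: cmeas_cst].
Qed.

Lemma cmeas_nc_powR d (T : measurableType d) (h : T -> C) (p : R) :
  cmeas h -> measurable_fun setT (fun x => nc (h x) `^ p).
Proof.
move=> [h1 h2].
have -> : (fun x => nc (h x) `^ p) = (fun x => (Re (h x) * Re (h x) + Im (h x) * Im (h x)) `^ (p / 2)).
  apply/funext => x; rewrite -!expr2 -nc_sqr -powR_mulrn ?nc_ge0// -powRrM.
  by rewrite mulrCA divff// mulr1.
apply: (measurableT_comp (measurable_powR _)).
by apply: measurable_funD; exact: measurable_funM.
Qed.

Lemma cmeas_rot : cmeas (fun z : R * (R * R) => e z.1 * (cplx_of z.2 : C)).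
Proof.
apply: cmeasM; last first.
  split; apply: measurableT_comp => //; apply: measurableT_comp => //.
have ce t : rcont e t := rdiff_rcont (rdiff_unit t).
split.
  apply: (@measurableT_comp _ _ _ _ _ _ (fun t => Re (e t)) _ fst) => //.
  by apply: continuous_measurable_fun => t; exact: rcont_continuous_Re.
apply: (@measurableT_comp _ _ _ _ _ _ (fun t => Im (e t)) _ fst) => //.
apply: continuous_measurable_fun => t; apply: continuous_pointP => eps /(ce t)[d d0 hd].
by exists d => // s /hd; apply: le_trans; exact: (normIm_le (e s - e t)).
Qed.

Variables (mu : {finite_measure set (R * R)%type -> \bar R}) (p : R) (P : {poly C}).
Hypothesis p0 : 0 < p.

Lemma continuous_rot (w : C) : continuous (fun t => nc P.[e t * w] `^ p).
Proof.
apply: (@ccontS_comp _ _ _ (fun t => e t * w) (ccont_poly P p0)) => // t.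
apply: (@rcont_comp _ (fun z => z * w) e t (rdiff_rcont (rdiff_unit t))).
by apply: climM; [exact: clim_id|exact: clim_cst].
Qed.

(** The bound valid for each rotation is integrated in [t], and Tonelli's theorem exchanges this
    integral with the one against [mu]. *)
Lemma rotation_average (Y a b : R) : a <= b -> 0 <= Y ->
  (forall t, (Y%:E <= \int[mu]_(w in @closedDisc2 R) (nc P.[e t * (cplx_of w : C)] `^ p)%:E)%E) ->
  (((b - a) * Y)%:E <= \int[mu]_(w in @closedDisc2 R)
     (rint a b (fun t => nc P.[e t * (cplx_of w : C)] `^ p))%:E)%E.
Proof.
move=> ab Y0 hY; pose h (z : R * (R * R)) := nc P.[e z.1 * (cplx_of z.2 : C)] `^ p.
have mh : measurable_fun setT h by apply: cmeas_nc_powR; apply: cmeas_horner; exact: cmeas_rot.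
have h0 z : 0 <= h z by exact: powR_ge0.
have mAB : measurable (`[a, b] : set R) by exact: measurable_itv.
have mD := @measurable_closedDisc2 R.
have E := tonelli_on leb mu mAB mD mh h0.
have -> : (\int[mu]_(w in @closedDisc2 R) (rint a b (fun t => nc P.[e t * (cplx_of w : C)] `^ p))%:E =
   \int[mu]_(w in @closedDisc2 R) \int[leb]_(t in `[a, b]) (h (t, w))%:E)%E.
  apply: eq_integral => w _; rewrite /rint /Rintegral fineK//.
  apply: integrable_fin_num => //; apply: integrable_itv.
  by apply: continuous_subspaceT; exact: continuous_rot.
rewrite -E; apply: (@le_trans _ _ (\int[leb]_(t in `[a, b]) Y%:E)%E).
  rewrite integral_cst//= lebesgue_measure_itv/= lte_fin.
  case: ltP => ba; first by rewrite -EFinM lee_fin mulrC.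
  have -> : b = a by apply/eqP; rewrite eq_le ba ab.
  by rewrite subrr mul0r mule0.
apply: ge0_le_integral => //.
- apply: (measurable_funS measurableT (@subsetT _ _)).
  exact: (measurable_section_integral mu mD mh h0).
- by move=> t _; exact: hY.
Qed.

End rotation_average.

(** * Consequences of a reverse Carleson inequality for rotated polynomials *)

Section tests.
Context {R : realType}.
Local Notation C := (R[i]).
Local Notation nc := (@Normc.normc R).
Local Notation e := (@unit_pt R).
Implicit Types (P g : {poly C}) (p r t s : R) (m k K : nat).

Lemma single_tail p s (q : \bar R) m g : 1 <= p -> s <= m%:R -> (0 < q)%E ->
  0 < pmean p (horner g) 1 ->
  exists K0 : nat, forall K, (K0 <= K)%N -> forall t,
  ((tail_const q * (64^-1 * pmean p (horner g) 1 `^ p^-1 * (2 ^ K.+1)%:R `^ s))%:E <=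
    besov_tail s p q m (rotp ('X^(2 ^ K.+1) * g) t))%E.
Proof.
move=> p1 sm q0 A0; have p0 : 0 < p := lt_le_trans ltr01 p1.
have e0 : 0 < 64^-1 * pmean p (horner g) 1 `^ p^-1 by rewrite mulr_gt0 ?invr_gt0 ?ltr0n// powR_gt0.
have [K0 hK0] := scale_lower m g e0; exists (maxn 1 K0) => K; rewrite geq_max => /andP[K1 KK0] t.
apply: (besov_tail_ge_one (@holo_rotp _ _ t) p1 sm q0 K1 (ltW e0)) => r hr.
rewrite circ_Lp_rotp//; apply: (pmean_poly_ge p1) => //.
- exact: continuous_poly_cpt.
- by move=> x; exact: hK0.
Qed.

(** At smoothness 0 all annuli contribute equally, whatever the exponents, hence the growth like the
    [q]-th root of the number of terms. The tolerance given to [multi_scale] is the one that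
    [pmean_poly_ge] absorbs. *)
Lemma multi_tail p q m (gs : seq {poly C}) (A : R) : 1 <= p -> 0 < q -> (0 < m)%N -> 0 < A ->
  (forall g, g \in gs -> pmean p (horner g) 1 = A) ->
  exists xs, [/\ unzip2 xs = gs, uniq (unzip1 xs) & forall t,
    ((((size gs)%:R / 2) `^ q^-1 * (64^-1 * A `^ p^-1))%:E <=
      besov_tail 0 p q%:E m (rotp (lacunary xs) t))%E].
Proof.
move=> p1 q0 m0 A0 hA; have p0 : 0 < p := lt_le_trans ltr01 p1.
have e0 : 0 < 64^-1 * A `^ p^-1 by rewrite mulr_gt0 ?invr_gt0 ?ltr0n// powR_gt0.
have [xs [xs2 xs1 hxs]] := multi_scale gs m0 e0; exists xs; split=> // t.
have := @besov_tail_ge R (rotp (lacunary xs) t) p 0 m (@holo_rotp _ _ t) p1 (ler0n _ _)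
  q (64^-1 * A `^ p^-1) 1 (unzip1 xs) q0 (ltW e0) ler01 xs1.
rewrite mulr1 size_map -(size_map snd xs) -/(unzip2 xs) xs2; apply.
  by move=> K _; rewrite powRr0.
move=> K /mapP[x xin ->] r hr.
have <- := hA x.2 _; last by rewrite -xs2 map_f.
rewrite circ_Lp_rotp//; apply: (pmean_poly_ge p1) => //.
- exact: continuous_poly_cpt.
- by move=> y; rewrite hA; [exact: hxs|rewrite -xs2 map_f].
Qed.

Lemma rot_mean p P (z : C) : 0 < p ->
  rint 0 1 (fun t => nc P.[e t * z] `^ p) = pmean p (horner P) (nc z).
Proof.
move=> p0; have [s s01 zs] := unit_surj z; rewrite pmeanE.
pose h t := nc P.[cpt 0 (nc z) t] `^ p.
have hc : continuous h by exact: continuous_poly_cpt.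
have h1 t : h (t + 1) = h t by rewrite /h /cpt unitD unit1 mulr1.
transitivity (rint 0 1 (fun t => h (t + s))); last exact: rint_periodic hc h1 s01.
apply: eq_rint => t _; rewrite /h /cpt add0r unitD; congr (nc P.[_] `^ p).
by rewrite {1}zs mulrCA.
Qed.

Lemma pmean_poly_mono p P r : 1 <= p -> 0 <= r <= 1 -> pmean p (horner P) r <= pmean p (horner P) 1.
Proof.
move=> p1 /andP[r0]; rewrite le_eqVlt => /predU1P[->//|r1].
have -> : horner P = rotp P 0 :> (C -> C) by apply/funext => z; rewrite /rotp unit0 mul1r.
by apply: (pmean_le_bnd (@holo_rotp _ P 0) (@continuous_rotp _ P 0) p1); rewrite r0.
Qed.

Lemma ccont_pmean_nc p P : 0 < p ->
  ccontS (fun z : C => nc z <= 1) (fun z => pmean p (horner P) (nc z)).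
Proof.
move=> p0 z _ eps e0.
have [] // := @cavg_within R (fun=> True) _ (fun=> True) (nc z) (ccont_poly P p0) _ _ eps e0.
move=> d d0 hd; exists d => // w _ wz; rewrite !pmeanE; apply: hd => //.
by apply: le_lt_trans wz; exact: nc_dist_le.
Qed.

Section carleson.
Variables (p s : R) (q : \bar R) (m : nat) (mu : {finite_measure set (R * R)%type -> \bar R}) (k : R).
Hypotheses (p1 : 1 <= p) (s0 : 0 <= s) (sm : s < m%:R) (q0 : (0 < q)%E) (k0 : 0 < k).
Hypothesis rc : forall f : C^o -> C^o,
  in_HB s p q m f -> {within @closedDisc R, continuous f} ->
  (besov_norm s p q m f <= k%:E * Lp_mu p mu f)%E.
Let p0 : 0 < p := lt_le_trans ltr01 p1.
Local Notation Dsk := (@closedDisc2 R).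

(** Every rotation of [P] is an admissible test function with the same lower bound [Y]; the terms of
    the quasinorm at the origin are dropped. *)
Lemma reverse_rot P (Y : R) : 0 <= Y -> (forall t, (Y%:E <= besov_tail s p q m (rotp P t))%E) ->
  forall t, (((Y / k) `^ p)%:E <= \int[mu]_(w in Dsk) (nc P.[e t * (cplx_of w : C)] `^ p)%:E)%E.
Proof.
move=> Y0 hY t; set I := (\int[mu]_(w in _) _)%E.
have I0 : (0 <= I)%E by apply: integral_ge0 => w _; rewrite lee_fin powR_ge0.
have h1 : (Y%:E <= k%:E * Lp_mu p mu (rotp P t))%E.
  apply: le_trans (rc (@in_HB_rotp _ P t s p q m s0 sm p1 q0) (@continuous_rotp _ P t)).
  apply: le_trans (hY t) _; apply: leeDr.
  by apply: sume_ge0 => j _; rewrite lee_fin nc_ge0.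
have h2 : ((Y / k)%:E <= I `^ p^-1)%E.
  have kV : (0 <= (k^-1)%:E :> \bar R)%E by rewrite lee_fin invr_ge0 ltW.
  have := lee_wpmul2l kV h1; rewrite muleA -!EFinM mulVf ?lt0r_neq0// mul1e.
  by rewrite mulrC.
have Yk0 : (0 <= (Y / k)%:E :> \bar R)%E by rewrite lee_fin divr_ge0// ltW.
have := lee_poweR (ltW p0) Yk0 h2.
by rewrite -poweRrM mulVf ?lt0r_neq0// poweRe1.
Qed.

(** Averaging over all rotations replaces the values of [P] at [w] by its mean over the circle
    through [w], which is at most the boundary mean. Only the total mass of [mu] is left, and no
    choice of [mu] can compensate a failure of this inequality. *)
Lemma reverse_mean P (Y : R) : 0 <= Y -> (forall t, (Y%:E <= besov_tail s p q m (rotp P t))%E) ->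
  (Y / k) `^ p <= pmean p (horner P) 1 * fine (mu Dsk).
Proof.
move=> Y0 hY.
have := @rotation_average R mu p P p0 ((Y / k) `^ p) 0 1 ler01 (powR_ge0 _ _) (reverse_rot Y0 hY).
rewrite subr0 mul1r -lee_fin => /le_trans; apply.
apply: (@le_trans _ _ (\int[mu]_(w in Dsk) (pmean p (horner P) 1)%:E)%E); last first.
  rewrite integral_cst; last exact: measurable_closedDisc2.
  by rewrite EFinM fineK// fin_num_measure//; exact: measurable_closedDisc2.
apply: ge0_le_integral => //=.
- exact: measurable_closedDisc2.
- by move=> w _; rewrite lee_fin; apply: rint_ge0 => t _; exact: powR_ge0.
- have -> : (fun w : R * R => (rint 0 1 (fun t => nc P.[e t * (cplx_of w : C)] `^ p))%:E) =
     (EFin \o (fun w => pmean p (horner P) (nc (cplx_of w : C)))).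
    by apply/funext => w; rewrite rot_mean.
  apply/measurable_EFinP.
  apply: (measurable_disc_fun (g := fun z => pmean p (horner P) (nc z))).
  exact: ccont_pmean_nc.
- move=> w Dw; rewrite lee_fin (rot_mean _ _ p0); apply: (pmean_poly_mono _ p1).
  by rewrite nc_ge0.
Qed.

End carleson.
End tests.

(** * Peak functions *)

Section peaks.
Context {R : realType}.
Local Notation C := (R[i]).
Local Notation nc := (@Normc.normc R).
Local Notation e := (@unit_pt R).
Implicit Types (p t y eta : R) (n : nat).

Lemma nc_two : nc 2 = 2.
Proof.
have := @nc_real R 2; rewrite ger0_norm// => <-.
by congr nc; apply/eqP; rewrite eq_complex /= ?addr0 !eqxx.
Qed.

Lemma nc_half1 y : nc (2^-1 * (1 + e y)) = `|cos (pi * y)|.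
Proof.
apply/eqP; rewrite -(@eqrXn2 _ 2)// ?nc_ge0// real_normK ?num_real//.
rewrite ncM exprMn ncV nc_two nc_sqr /unit_pt.
have -> : 2 * pi * y = (pi * y) *+ 2 by rewrite mulr2n; ring.
rewrite cos_mulr2n sin_mulr2n; have := cos2Dsin2 (pi * y).
move: (cos _) (sin _) => c s /= cs.
have -> : (2^-1 ^+ 2 * ((1 + (c ^+ 2 *+ 2 - 1)) ^+ 2 + (0 + (c * s) *+ 2) ^+ 2)) = c ^+ 2 * (c ^+ 2 + s ^+ 2).
  by rewrite !mulr2n; field.
by rewrite cs mulr1.
Qed.

Lemma le_cos_pi eta y : 0 <= eta -> eta <= `|y| -> `|y| <= 1 -> cos (pi * y) <= cos (pi * eta).
Proof.
move=> eta0 ey y1; have p0 := pi_gt0 R.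
have -> : cos (pi * y) = cos (pi * `|y|).
  by rewrite -cos_norm normrM (gtr0_norm p0).
have mem (x : R) : 0 <= x -> x <= 1 -> pi * x \in `[0, pi].
  by move=> x0 x1; rewrite in_itv/= mulr_ge0 ?(ltW p0)//= -[leRHS]mulr1 ler_pM2l.
have eta1 : eta <= 1 := le_trans ey y1.
by rewrite leNgt ltr_cos ?mem// -leNgt ler_pM2l.
Qed.

Lemma cos_pi_ge0 y : `|y| <= 2^-1 -> 0 <= cos (pi * y).
Proof.
move=> y1; apply: cos_ge0_pihalf; rewrite -ler_norml normrM (gtr0_norm (pi_gt0 R)).
by rewrite ler_pM2l ?pi_gt0.
Qed.

(* The hypothesis says that [y] is at distance at least [eta] from the integers. *)
Lemma nc_half1_far eta y : 0 <= eta -> (forall y', e y' = e y -> eta <= `|y'|) ->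
  nc (2^-1 * (1 + e y)) <= cos (pi * eta).
Proof.
move=> eta0 far; have [s /andP[s0 s1] ys] := unit_mod y.
have [y' [y'e y'2]] : exists y' : R, e y' = e y /\ `|y'| <= 2^-1.
  have [sh|sh] := leP s 2^-1; first by exists s; rewrite ger0_norm.
  exists (s - 1); rewrite -(mulr1 (e (s - 1))) -unit1 -unitD subrK; split=> //.
  by rewrite distrC ger0_norm ?subr_ge0//; lra.
rewrite -y'e nc_half1 ger0_norm; last exact: cos_pi_ge0.
by apply: le_cos_pi => //; [exact: far|lra].
Qed.

Definition peak_poly n : {poly C} := (2^-1%:P * (1 + 'X)) ^+ n.

Lemma horner_peak_poly n (z : C) : (peak_poly n).[z] = (2^-1 * (1 + z)) ^+ n.
Proof. by rewrite /peak_poly horner_exp hornerM hornerC hornerD hornerX hornerC. Qed.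

Lemma peak_poly_le1 n (z : C) : nc z <= 1 -> nc (peak_poly n).[z] <= 1.
Proof.
move=> z1; rewrite horner_peak_poly ncX; apply: exprn_ile1; first exact: nc_ge0.
rewrite ncM ncV nc_two mulrC ler_pdivrMr// mul1r; apply: le_trans (ncD _ _) _; rewrite nc1.
by have -> : 2 = 1 + 1 :> R by []; rewrite lerD2l.
Qed.

Definition peak p n := pmean p (horner (peak_poly n)) 1.

(** Only [0 <= t <= eta] is kept; there the modulus is at least its value [cos (pi * eta) ^+ n] at
    the endpoint. *)
Lemma peak_ge p n eta : 0 < p -> 0 < eta <= 2^-1 ->
  eta * (cos (pi * eta) ^+ n) `^ p <= peak p n.
Proof.
move=> p0 /andP[eta0 eta2].
have c0 : 0 <= cos (pi * eta) by apply: cos_pi_ge0; rewrite ger0_norm// ltW.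
pose h t := nc (peak_poly n).[cpt 0 1 t] `^ p.
have ch : continuous h by exact: continuous_poly_cpt.
have h0 t : 0 <= h t by exact: powR_ge0.
rewrite /peak pmeanE; have -> : cavg (fun z => nc (peak_poly n).[z] `^ p) 1 = rint 0 1 h by [].
rewrite (@rint_cat _ 0 eta 1); last 2 first.
- by rewrite (ltW eta0) (le_trans eta2)//; lra.
- exact: continuous_subspaceT.
rewrite -[leLHS]addr0; apply: lerD; last by apply: rint_ge0.
have -> : eta * (cos (pi * eta) ^+ n) `^ p = rint 0 eta (fun=> (cos (pi * eta) ^+ n) `^ p).
  by rewrite rint_cst ?(ltW eta0)// subr0 mulrC.
apply: le_rint.
- exact/continuous_subspaceT/cst_continuous.
- exact: continuous_subspaceT.
move=> t /andP[t0 te]; apply: le_powR; [exact: ltW|exact: exprn_ge0|].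
rewrite horner_peak_poly ncX /cpt add0r mul1r nc_half1.
rewrite lerXn2r ?nnegrE ?normr_ge0//; apply: le_trans (ler_norm _).
have := @le_cos_pi t eta t0; rewrite ger0_norm ?(ltW eta0)//; apply=> //.
by rewrite (le_trans eta2)//; lra.
Qed.

Lemma peak_gt0 p n : 0 < p -> 0 < peak p n.
Proof.
move=> p0; have h : 0 < (2^-1 / 2 : R) <= 2^-1 by lra.
apply: lt_le_trans (peak_ge n p0 h); apply: mulr_gt0; first by lra.
apply: powR_gt0; apply: exprn_gt0; apply: cos_gt0_pihalf.
have := pi_gt0 R => pi0; apply/andP; split; nra.
Qed.

(** Concentration at the peak: with [a] and [b] the cosines at [eta] and at [eta / 2], the left side
    is [a ^ (n p)] while the peak integral is at least [(eta / 2) b ^ (n p)], and [a < b]. *)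
Lemma peak_far p eta (del : R) : 0 < p -> 0 < eta <= 2^-1 -> 0 < del ->
  exists n0 : nat, forall n, (n0 <= n)%N -> (cos (pi * eta) ^+ n) `^ p <= del * peak p n.
Proof.
move=> p0 /andP[eta0 eta2] d0.
pose a := cos (pi * eta); pose b := cos (pi * (eta / 2)).
have a0 : 0 <= a by apply: cos_pi_ge0; rewrite ger0_norm// ltW.
have pi0 := pi_gt0 R.
have ab : a < b.
  have mem (x : R) : 0 <= x -> x <= 2^-1 -> pi * x \in `[0, pi].
    by move=> x0 x1; rewrite in_itv/= mulr_ge0 ?(ltW pi0)//= -[leRHS]mulr1 ler_pM2l//; lra.
  rewrite /a /b ltr_cos ?mem//; [|lra|lra|lra].
  by rewrite ltr_pM2l//; lra.
have b0 : 0 < b := le_lt_trans a0 ab.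
have ab1 : a / b < 1 by rewrite ltr_pdivrMr// mul1r.
have ab0 : 0 <= a / b by rewrite divr_ge0// ltW.
pose rho := (a / b) `^ p.
have rho01 : 0 <= rho < 1.
  rewrite powR_ge0/= /rho; have <- : 1 `^ p = 1 :> R by rewrite powR1.
  by apply: gt0_ltr_powR ab1; rewrite // nnegrE.
have d1 : 0 < del * (eta / 2) by rewrite mulr_gt0// divr_gt0.
have [n0 hn0] := expr_decay 0 rho01 d1; exists n0 => n /hn0; rewrite expr0 mul1r => hn.
have e2 : 0 < eta / 2 <= 2^-1 by lra.
apply: le_trans (ler_wpM2l (ltW d0) (peak_ge n p0 e2)); rewrite -/b -/a.
have -> : a = (a / b) * b by rewrite divfK// lt0r_neq0.
rewrite exprMn powRM ?exprn_ge0 ?(ltW b0)// mulrA.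
apply: ler_wpM2r; first exact: powR_ge0.
by rewrite powR_exprn.
Qed.

End peaks.

(** * Smoothness s > 0 and necessity of the arc condition *)

Section necessity.
Context {R : realType}.
Local Notation C := (R[i]).
Local Notation nc := (@Normc.normc R).
Local Notation e := (@unit_pt R).
Local Notation arc := (@Defs.arc R).
Local Notation Dsk := (@closedDisc2 R).
Local Notation leb := (@lebesgue_measure R).
Implicit Types (P g : {poly C}) (p r t s : R) (m n K N : nat).

Lemma pmean_XnM p g N : pmean p (horner ('X^N * g)) 1 = pmean p (horner g) 1.
Proof.
rewrite !pmeanE; apply: eq_rint => t _.
by rewrite hornerM hornerXn ncM ncX nc_cpt0 normr1 expr1n mul1r.
Qed.

Lemma pmean_one p : pmean p (horner 1) 1 = 1.
Proof.
rewrite pmeanE /cavg -[RHS]mulr1 -[X in _ = 1 * X](subr0 1) -rint_cst//.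
by apply: eq_rint => t _; rewrite hornerC nc1 powR1.
Qed.

Lemma powR_unbounded (c s p M : R) : 0 < c -> 0 < s -> 0 < p -> exists K0 : nat, forall K, (K0 <= K)%N ->
  M < (c * (2 ^ K.+1)%:R `^ s) `^ p.
Proof.
move=> c0 s0 p0; pose B := (`|M| + 1) `^ p^-1 / c.
have B0 : 0 <= B by rewrite divr_ge0 ?powR_ge0// ltW.
have [K0 hK0] := nat_bound (B `^ s^-1); exists K0 => K /hK0 hK.
have hN : B `^ s^-1 <= (2 ^ K.+1)%:R by apply: (le_trans hK); rewrite ler_nat leq_pow2S.
have hs : B <= (2 ^ K.+1)%:R `^ s.
  have := le_powR (ltW s0) (powR_ge0 _ _) hN.
  by rewrite -powRrM mulVf ?lt0r_neq0// powRr1.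
have cB : (`|M| + 1) `^ p^-1 <= c * (2 ^ K.+1)%:R `^ s.
  by rewrite mulrC -ler_pdivrMr.
have := le_powR (ltW p0) (powR_ge0 _ _) cB.
rewrite -powRrM mulVf ?lt0r_neq0// powRr1 ?addr_ge0//; apply: lt_le_trans.
by rewrite (le_lt_trans (ler_norm M))// ltrDl.
Qed.

Lemma no_reverse_carleson_smooth (s p : R) (q : \bar R) m (mu : {finite_measure set (R * R)%type -> \bar R}) :
  0 < s -> s < m%:R -> 1 <= p -> (0 < q)%E -> ~ reverse_carleson s p q m mu.
Proof.
move=> s0 sm p1 q0 [k [k0 rc]]; have p0 : 0 < p := lt_le_trans ltr01 p1.
have A0 : 0 < pmean p (horner (1 : {poly C})) 1 by rewrite pmean_one.
have [K0 hK0] := single_tail p1 (ltW sm) q0 A0.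
have c0 : 0 < tail_const q * 64^-1 / k :> R.
  by rewrite divr_gt0// mulr_gt0 ?tail_const_gt0// invr_gt0.
have [K1 hK1] := powR_unbounded (fine (mu Dsk)) c0 s0 p0.
pose K := maxn K0 K1; have [KK0 KK1] : (K0 <= K)%N /\ (K1 <= K)%N by rewrite !leq_max !leqnn orbT.
have := hK0 K KK0; rewrite pmean_one powR1 (mulr1 (64^-1 : R)) => hY.
have Y0 : 0 <= tail_const q * (64^-1 * (2 ^ K.+1)%:R `^ s) :> R.
  by rewrite mulr_ge0 ?(ltW (tail_const_gt0 _))// mulr_ge0 ?invr_ge0 ?powR_ge0.
have := reverse_mean p1 (ltW s0) sm q0 k0 rc Y0 hY.
rewrite pmean_XnM pmean_one mul1r leNgt => /negP; apply.
have -> : tail_const q * (64^-1 * (2 ^ K.+1)%:R `^ s) / k = tail_const q * 64^-1 / k * (2 ^ K.+1)%:R `^ s.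
  by field; rewrite lt0r_neq0.
exact: hK1.
Qed.

Lemma measurable_rot_rint p P (a b : R) : 0 < p ->
  measurable_fun setT (fun w : R * R => rint a b (fun t => nc P.[e t * (cplx_of w : C)] `^ p)).
Proof.
move=> p0; pose h (z : (R * R) * R) := nc P.[e z.2 * (cplx_of z.1 : C)] `^ p.
have mh : measurable_fun setT h.
  apply: cmeas_nc_powR; apply: cmeas_horner.
  have [h1 h2] := @cmeas_rot R; split.
    exact: (measurableT_comp h1 (@measurable_swap _ _ _ _)).
  exact: (measurableT_comp h2 (@measurable_swap _ _ _ _)).
have mAB : measurable (`[a, b] : set R) by exact: measurable_itv.
have h0 z : 0 <= h z by exact: powR_ge0.
have := measurable_section_integral leb mAB mh h0.
have -> : (fun x => \int[leb]_(y in `[a, b]) (h (x, y))%:E)%E =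
  EFin \o (fun w : R * R => rint a b (fun t => nc P.[e t * (cplx_of w : C)] `^ p)).
  apply/funext => w; rewrite /= /rint /Rintegral fineK//.
  apply: integrable_fin_num => //; apply: integrable_itv.
  by apply: continuous_subspaceT; exact: continuous_rot.
by move/measurable_EFinP.
Qed.

Lemma rot_mean_le p P (a b : R) (w : C) : 1 <= p -> a <= b <= a + 1 -> nc w <= 1 ->
  rint a b (fun t => nc P.[e t * w] `^ p) <= pmean p (horner P) 1.
Proof.
move=> p1 /andP[ab b1] w1; have p0 : 0 < p := lt_le_trans ltr01 p1.
pose h t := nc P.[e t * w] `^ p.
have ch : continuous h by exact: continuous_rot.
have h0 t : 0 <= h t by exact: powR_ge0.
apply: (@le_trans _ _ (rint a (a + 1) h)).
  rewrite (@rint_cat _ a b (a + 1)); [|by rewrite ab b1|exact: continuous_subspaceT].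
  by rewrite lerDl; apply: rint_ge0.
have -> : rint a (a + 1) h = rint 0 1 (fun t => h (t + a)).
  by rewrite -rint_shift// add0r addrC.
have -> : rint 0 1 (fun t => h (t + a)) = pmean p (horner P) (nc (e a * w)).
  rewrite -(rot_mean P (e a * w) p0); apply: eq_rint => t _.
  by rewrite /h unitD mulrA.
apply: pmean_poly_mono => //; rewrite ncM nc_unit mul1r w1 andbT; exact: nc_ge0.
Qed.

Lemma measurable_disc_power p N :
  measurable_fun setT (fun w : R * R =>
    (nc (cplx_of w : C) `^ p) ^+ N * \1_[set w : R * R | nc (cplx_of w : C) < 1] w).
Proof.
have mn r : measurable_fun setT (fun w : R * R => nc (cplx_of w : C) `^ r).
  by apply: cmeas_nc_powR; split; exact: measurableT_comp.
apply: measurable_funM; first exact: measurable_funX.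
apply: measurable_indic; set D0 := [set w | _].
have -> : D0 = setT `&` (fun w : R * R => nc (cplx_of w : C) `^ 1) @^-1` [set` `]-oo, (1 : R)[].
  by rewrite setTI; apply/seteqP; split=> w; rewrite /D0/= in_itv/= powRr1// nc_ge0.
by apply: mn => //; exact: measurable_itv.
Qed.

(** Dominated convergence: the powers tend to 0 at each point of the open disc, the indicator
    removes the circle, where they are equal to 1, and the constant 1 is integrable because [mu] is
    finite. *)
Lemma disc_power_cvg p (mu : {finite_measure set (R * R)%type -> \bar R}) (eps : R) : 0 < p -> 0 < eps ->
  exists N0 : nat, forall N, (N0 <= N)%N ->
  (\int[mu]_(w in Dsk) (((nc (cplx_of w : C) `^ p) ^+ N *
     \1_[set w : R * R | nc (cplx_of w : C) < 1] w)%:E) <= eps%:E)%E.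
Proof.
move=> p0 e0; pose x (w : R * R) := nc (cplx_of w : C) `^ p.
set D0 := [set w | _].
pose f_ n (w : R * R) := ((x w ^+ n * \1_D0 w)%:E : \bar R).
have mf n : measurable_fun Dsk (f_ n).
  apply/measurable_EFinP; apply: measurable_funS (measurableT) (@subsetT _ _) _.
  exact: measurable_disc_power.
have x01 w : Dsk w -> 0 <= x w <= 1.
  by move=> Dw; rewrite powR_ge0/=; apply: powR_le1; [exact: ltW|exact: nc_ge0|].
have cvf w : Dsk w -> f_ ^~ w @ \oo --> (0%E : \bar R).
  move=> Dw; apply: cvg_EFin; first by near=> n.
  have [D0w|D0w] := boolP (w \in D0); last first.
    by rewrite /f_/= indicE (negbTE D0w); under eq_fun do rewrite /= mulr0; exact: cvg_cst.
  rewrite /f_/= indicE D0w; under eq_fun do rewrite /= mulr1.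
  apply: cvg_expr; rewrite ger0_norm; last by case/andP: (x01 _ Dw).
  move: D0w; rewrite inE /D0/= => w1; rewrite /x; have <- : 1 `^ p = 1 :> R by rewrite powR1.
  by apply: gt0_ltr_powR w1; rewrite // nnegrE ?nc_ge0.
have mD := @measurable_closedDisc2 R.
have ig : mu.-integrable Dsk (cst (1%:E : \bar R)) by exact: finite_measure_integrable_cst.
have bd n w : Dsk w -> (`|f_ n w| <= (cst (1%:E : \bar R)) w)%E.
  move=> /x01/andP[x0 x1]; rewrite /f_/= lee_fin ger0_norm ?mulr_ge0 ?exprn_ge0//.
  rewrite indicE; case: (w \in D0); rewrite ?mulr0 ?mulr1 ?ler01//.
  exact: exprn_ile1.
have := @dominated_cvg _ _ R mu Dsk mD f_ (fun=> 0%E) (cst 1%:E) mf cvf (fun _ _ => erefl) ig bd.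
rewrite integral0 => /fine_cvgP[[N1 _ h1]] /cvgrPdist_le/(_ _ e0)[N2 _ h2].
exists (maxn N1 N2) => N; rewrite geq_max => /andP[/h1 fN /h2]; rewrite /= sub0r normrN.
move=> hN; rewrite -[leLHS]fineK// lee_fin; apply: le_trans hN; exact: ler_norm.
Unshelve. all: by end_near. Qed.

(** * From a reverse Carleson inequality to the mass of arcs *)

Section arcs.
Variables (p : R) (q : \bar R) (m : nat) (mu : {finite_measure set (R * R)%type -> \bar R}) (k : R).
Hypotheses (p1 : 1 <= p) (q0 : (0 < q)%E) (m0 : (0 < m)%N) (k0 : 0 < k).
Hypothesis rc : forall f : C^o -> C^o,
  in_HB 0 p q m f -> {within @closedDisc R, continuous f} ->
  (besov_norm 0 p q m f <= k%:E * Lp_mu p mu f)%E.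
Let p0 : 0 < p := lt_le_trans ltr01 p1.
Let c1 : R := (tail_const q * 64^-1 / k) `^ p.

Lemma peak_lower n : exists K0 : nat, forall K, (K0 <= K)%N -> forall a b : R, a <= b ->
  (((b - a) * (c1 * peak p n))%:E <= \int[mu]_(w in Dsk)
     (rint a b (fun t => nc ('X^(2 ^ K.+1) * peak_poly n).[e t * (cplx_of w : C)] `^ p))%:E)%E.
Proof.
have sm : (0 : R) < m%:R by rewrite ltr0n.
have A0 := peak_gt0 n p0; have [K0 hK0] := single_tail p1 (ltW sm) q0 A0.
exists K0 => K KK0 a b ab; have := hK0 K KK0.
rewrite -/(peak p n) powRr0 (mulr1 (64^-1 * _)) => hY.
have Y0 : 0 <= tail_const q * (64^-1 * peak p n `^ p^-1) :> R.
  by rewrite mulr_ge0 ?(ltW (tail_const_gt0 _))// mulr_ge0 ?invr_ge0 ?powR_ge0.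
have := rotation_average p0 ab (powR_ge0 _ _) (reverse_rot p1 (lexx _) sm q0 k0 rc Y0 hY).
have -> // : (tail_const q * (64^-1 * peak p n `^ p^-1) / k) `^ p = c1 * peak p n.
have -> : tail_const q * (64^-1 * peak p n `^ p^-1) / k = tail_const q * 64^-1 / k * peak p n `^ p^-1.
  by field; rewrite lt0r_neq0.
have kk : 0 <= tail_const q * 64^-1 / k :> R.
  by rewrite divr_ge0 ?(ltW k0)// mulr_ge0 ?invr_ge0 ?(ltW (tail_const_gt0 _)).
by rewrite (powRM _ kk (powR_ge0 _ _)) -(powRrM (peak p n)) mulVf ?lt0r_neq0// powRr1// ltW.
Qed.

Section one_arc.
Variables (a l : R).
Hypothesis l01 : 0 < l <= 1.
(* The rotations [t] for which [- t] lies in the middle half of the arc. *)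
Let u := - (a + 3 / 4 * l).
Let v := - (a + 4^-1 * l).
Let H n N (w : R * R) := rint u v (fun t => nc ('X^N * peak_poly n).[e t * (cplx_of w : C)] `^ p).

Let uv : u <= v <= u + 1.
Proof. by move: l01 => /andP[? ?]; rewrite /u /v; apply/andP; split; lra. Qed.

Lemma arc_integrand_peak n N w : Dsk w -> H n N w <= peak p n.
Proof.
move=> Dw; rewrite /peak -(pmean_XnM p (peak_poly n) N).
exact: rot_mean_le.
Qed.

(** In the open disc the factor [z ^ N] is decisive, the peak function being at most 1. At a point
    of the circle outside the arc, every rotation in [[u, v]] leaves a distance at least [l / 4]
    from the peak, because [- t] is that far from the ends of the arc. *)
Lemma arc_integrand_off n N w : Dsk w -> ~ arc a l w ->
  H n N w <= (nc (cplx_of w : C) `^ p) ^+ N * \1_[set w : R * R | nc (cplx_of w : C) < 1] w +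
             (cos (pi * (4^-1 * l)) ^+ n) `^ p.
Proof.
move=> Dw nw; case/andP: uv => uv1 uv2; case/andP: l01 => l0 l1.
have uvle : v - u <= 1 by rewrite lerBlDr addrC.
have uv0 : 0 <= v - u by rewrite subr_ge0.
have c0 : 0 <= (cos (pi * (4^-1 * l)) ^+ n) `^ p by exact: powR_ge0.
have ch : {within `[u, v], continuous (fun t => nc ('X^N * peak_poly n).[e t * (cplx_of w : C)] `^ p)}.
  by apply: continuous_subspaceT; exact: continuous_rot.
have hE t : nc ('X^N * peak_poly n).[e t * (cplx_of w : C)] =
    nc (cplx_of w : C) ^+ N * nc (peak_poly n).[e t * (cplx_of w : C)].
  by rewrite hornerM hornerXn ncM ncX ncM nc_unit mul1r.
have finish M : 0 <= M ->
    (forall t, u <= t <= v -> nc ('X^N * peak_poly n).[e t * (cplx_of w : C)] `^ p <= M) -> H n N w <= M.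
  move=> M0 hM; apply: le_trans (rint_le_cst uv1 ch hM) _.
  by rewrite ler_piMr.
rewrite indicE; set D0 := [set w | _]; have [w1|w1] := boolP (w \in D0).
  rewrite mulr1; apply: (@le_trans _ _ ((nc (cplx_of w : C) `^ p) ^+ N)); last by rewrite lerDl.
  apply: finish; first by rewrite exprn_ge0// powR_ge0.
  move=> t _; rewrite -powR_exprn ?nc_ge0//; apply: le_powR; [exact: ltW|exact: nc_ge0|].
  rewrite hE ler_piMr ?exprn_ge0 ?nc_ge0//; apply: peak_poly_le1.
  by rewrite ncM nc_unit mul1r.
rewrite mulr0 add0r; apply: finish => // t /andP[t1 t2].
apply: le_powR; [exact: ltW|exact: nc_ge0|rewrite hE].
have w1' : nc (cplx_of w : C) = 1.
  apply/eqP; rewrite eq_le (Dw : nc _ <= 1)/= leNgt.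
  by move: w1; apply: contra => w1; rewrite inE.
rewrite w1' expr1n mul1r horner_peak_poly ncX.
have [x _ wx] := unit_surj (cplx_of w : C); rewrite w1' mul1r in wx.
rewrite wx -unitD lerXn2r ?nnegrE ?nc_ge0//.
  apply: cos_pi_ge0; rewrite ger0_norm; first by lra.
  by rewrite mulr_ge0// ltW.
apply: nc_half1_far; first by rewrite mulr_ge0// ltW.
move=> y' y'e; rewrite leNgt; apply/negP => y'l; apply: nw.
apply/arcP; exists (y' - t).
  move: y'l; rewrite ltr_norml /u /v in t1 t2 * => /andP[y1 y2].
  by apply/andP; split; lra.
by rewrite wx unitD y'e -unitD addrAC subrr add0r.
Qed.

(** The disc is split into the arc and its complement. For fixed [n], [N] is taken so large that the
    open disc contributes at most [eps]. The factor [2^-1 * l] is the length [v - u] of the interval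
    of rotations. *)
Lemma arc_mass n (eps : R) : 0 < eps ->
  2^-1 * l * (c1 * peak p n) <= peak p n * fine (mu (arc a l)) +
    ((cos (pi * (4^-1 * l)) ^+ n) `^ p * fine (mu Dsk) + eps).
Proof.
move=> e0; have [K0 hK0] := peak_lower n.
have [N0 hN0] := disc_power_cvg mu p0 e0.
pose K := maxn K0 N0; pose N := (2 ^ K.+1)%N.
have KK0 : (K0 <= K)%N by rewrite leq_maxl.
have NN0 : (N0 <= N)%N by apply: leq_trans (leq_pow2S K); rewrite leq_maxr.
have uv1 : u <= v by case/andP: uv.
have := hK0 K KK0 u v uv1; rewrite -/N.
have -> : v - u = 2^-1 * l by rewrite /u /v; field.
move=> h1.
have mD := @measurable_closedDisc2 R; have mA := measurable_arc a l.
have AD := @arc_closedDisc R a l.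
have mH : measurable_fun setT (EFin \o H n N) by apply/measurable_EFinP; exact: measurable_rot_rint.
have H0 w : (0 <= (EFin \o H n N) w)%E by rewrite lee_fin; apply: rint_ge0 => t _; exact: powR_ge0.
pose ph w : \bar R := ((nc (cplx_of w : C) `^ p) ^+ N * \1_[set w : R * R | nc (cplx_of w : C) < 1] w)%:E.
pose kap : R := (cos (pi * (4^-1 * l)) ^+ n) `^ p.
have kap0 : 0 <= kap by exact: powR_ge0.
have ph0 w : (0 <= ph w)%E by rewrite lee_fin mulr_ge0// exprn_ge0// powR_ge0.
have mph : measurable_fun setT ph by apply/measurable_EFinP; exact: measurable_disc_power.
have fD : mu Dsk \is a fin_num by apply: fin_num_measure.
have fA : mu (arc a l) \is a fin_num by apply: fin_num_measure.
rewrite -lee_fin; apply: (le_trans h1).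
rewrite -{1}(setDUK AD) ge0_integral_setU//; last 4 first.
- exact: measurableD.
- by apply: measurable_funS mH.
- by move=> w _; exact: H0.
- by rewrite disj_set2E setDIK.
rewrite EFinD; apply: leeD.
  apply: (@le_trans _ _ (\int[mu]_(w in arc a l) (peak p n)%:E)%E).
    apply: ge0_le_integral => //.
    - by move=> w _; exact: H0.
    - by apply: measurable_funS mH.
    - by move=> w /AD Dw; rewrite lee_fin; exact: arc_integrand_peak.
  by rewrite integral_cst// EFinM fineK.
apply: (@le_trans _ _ (\int[mu]_(w in Dsk) (ph w + kap%:E))%E).
  apply: (@le_trans _ _ (\int[mu]_(w in Dsk `\` arc a l) (ph w + kap%:E))%E).
    apply: ge0_le_integral => //.
    - exact: measurableD.
    - by move=> w _; exact: H0.
    - by apply: measurable_funS mH.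
    - by apply: emeasurable_funD => //; apply: measurable_funS mph.
    - by move=> w [Dw nw]; rewrite -EFinD lee_fin; exact: arc_integrand_off.
  apply: ge0_subset_integral => //.
  - exact: measurableD.
  - by apply: emeasurable_funD => //; apply: measurable_funS mph.
  - by move=> w _; rewrite adde_ge0// lee_fin.
rewrite ge0_integralD//; last by apply: measurable_funS mph.
rewrite (integral_cst mu mD) EFinD addeC EFinM (fineK fD); apply: leeD => //.
exact: hN0.
Qed.

(** [arc_mass] is divided by the peak integral: for [n] large, [peak_far] makes the cosine term
    small relative to it, and the error allowed in [arc_mass] is taken proportional to it. *)
Lemma arc_ge : c1 / 2 * l <= fine (mu (arc a l)).
Proof.
case/andP: l01 => l0 l1.
have M0 : 0 <= fine (mu Dsk) by apply: fine_ge0.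
(* The added 1 keeps [M] positive and pays for the error of [arc_mass], so that both errors together
   amount to [eps] times the peak integral. *)
pose M := fine (mu Dsk) + 1; have M1 : 0 < M by rewrite ltr_wpDl.
have eta0 : 0 < 4^-1 * l <= 2^-1 by lra.
apply/ler_addgt0Pr => eps e0.
have d0 : 0 < eps / M by rewrite divr_gt0.
have [n0 hn0] := peak_far p0 eta0 d0.
have A0 := peak_gt0 n0 p0; have := hn0 n0 (leqnn _).
set A := peak p n0 in A0 *; set kap := _ `^ p => hkap.
have eA : 0 < eps / M * A by rewrite mulr_gt0.
have := arc_mass n0 eA; rewrite -/A -/kap => h.
have h2 : kap * fine (mu Dsk) <= eps / M * A * fine (mu Dsk) by rewrite ler_wpM2r.
have h3 : A * (c1 / 2 * l) <= A * (fine (mu (arc a l)) + eps).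
  have -> : A * (fine (mu (arc a l)) + eps) = A * fine (mu (arc a l)) + (eps / M * A * fine (mu Dsk) + eps / M * A).
    by rewrite /M; field; rewrite lt0r_neq0.
  have -> : A * (c1 / 2 * l) = 2^-1 * l * (c1 * A) by field.
  by apply: (le_trans h); rewrite lerD2l lerD2r.
by move: h3; rewrite ler_pM2l.
Qed.

End one_arc.

Lemma reverse_carleson_arcs : arc_condition mu.
Proof.
have k00 : 0 < c1 by apply: powR_gt0; rewrite divr_gt0// mulr_gt0 ?tail_const_gt0// invr_gt0.
exists (c1 / 2); split; first by rewrite divr_gt0.
move=> a l l01; rewrite -[leRHS]fineK; first by rewrite lee_fin; exact: arc_ge.
by apply: fin_num_measure; exact: measurable_arc.
Qed.

End arcs.
End necessity.

(** * Small exponents q *)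

Section small_exponents.
Context {R : realType}.
Local Notation C := (R[i]).
Local Notation nc := (@Normc.normc R).
Local Notation e := (@unit_pt R).
Local Notation Re := (@complex.Re R).
Local Notation Im := (@complex.Im R).
Local Notation Dsk := (@closedDisc2 R).
Implicit Types (P g : {poly C}) (p r t s : R) (m n K N L : nat).

Lemma powR_growth (be ga B : R) : be < ga -> exists n : nat, (0 < n)%N /\ B * n%:R `^ be < (n%:R / 2) `^ ga.
Proof.
move=> bg; have c0 : 0 < 2^-1 `^ ga :> R by apply: powR_gt0; rewrite invr_gt0.
have gb0 : 0 < ga - be by rewrite subr_gt0.
have [K0 hK0] := powR_unbounded B c0 gb0 ltr01.
exists (2 ^ K0.+1)%N; split; first by rewrite expn_gt0.
have := hK0 K0 (leqnn _); rewrite powRr1; last by rewrite mulr_ge0 ?powR_ge0// ltW.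
set x : R := (2 ^ K0.+1)%:R; have x0 : 0 < x by rewrite ltr0n expn_gt0.
have xb : 0 < x `^ be by exact: powR_gt0.
move=> h; rewrite powRM ?invr_ge0 ?(ltW x0)//.
have -> : x `^ ga * 2^-1 `^ ga = (2^-1 `^ ga * x `^ (ga - be)) * x `^ be.
  rewrite mulrC -mulrA -powRD ?subrK//.
  by rewrite (lt0r_neq0 x0) implybT.
by rewrite ltr_pM2r.
Qed.

(** Frame of both counterexamples: up to constants, the [p]-th power of the tail is at least
    [n ^ (p / q) A], while the boundary mean is at most [n ^ be A]. The upper bound is asked for all
    distinct exponents, because they are dictated by [multi_tail] and depend on the polynomials
    [gs]. *)
Lemma no_reverse_carleson_lacunary p q m (mu : {finite_measure set (R * R)%type -> \bar R}) (be B : R) :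
  1 <= p -> 0 < q -> (0 < m)%N -> 0 <= B -> be < p / q ->
  (forall n, (0 < n)%N -> exists gs (A : R), [/\ size gs = n, 0 < A,
    (forall g, g \in gs -> pmean p (horner g) 1 = A) &
    forall xs, unzip2 xs = gs -> uniq (unzip1 xs) ->
      pmean p (horner (lacunary xs)) 1 <= B * n%:R `^ be * A]) ->
  ~ reverse_carleson 0 p q%:E m mu.
Proof.
move=> p1 q0 m0 B0 bq H [k [k0 rc]]; have p0 : 0 < p := lt_le_trans ltr01 p1.
pose M := fine (mu Dsk).
have M0 : 0 <= M by exact: fine_ge0.
have [n [n0 hn]] := powR_growth ((64 * k) `^ p * (B * M)) bq.
have [gs [A [gsn A0 hA hF]]] := H n n0.
have [xs [xs2 xs1 hY]] := multi_tail p1 q0 m0 A0 hA.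
have sm : (0 : R) < m%:R by rewrite ltr0n.
have n20 : 0 <= n%:R / 2 :> R by rewrite divr_ge0.
have Y0 : 0 <= ((size gs)%:R / 2) `^ q^-1 * (64^-1 * A `^ p^-1).
  by rewrite mulr_ge0 ?powR_ge0// mulr_ge0 ?powR_ge0// invr_ge0.
have q0' : (0 < q%:E)%E by rewrite lte_fin.
have := reverse_mean p1 (lexx _) sm q0' k0 rc Y0 hY; rewrite gsn -/M.
have := hF xs xs2 xs1; move/(ler_wpM2r M0) => h1 /le_trans/(_ h1).
have k640 : 0 < 64 * k by rewrite mulr_gt0.
have -> : (n%:R / 2) `^ q^-1 * (64^-1 * A `^ p^-1) / k = (n%:R / 2) `^ q^-1 * (64 * k)^-1 * A `^ p^-1.
  by field; rewrite lt0r_neq0.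
have w0 : 0 <= (n%:R / 2) `^ q^-1 * (64 * k)^-1 by rewrite mulr_ge0 ?powR_ge0// invr_ge0 ltW.
have kV : 0 <= (64 * k)^-1 by rewrite invr_ge0 ltW.
rewrite (powRM _ w0 (powR_ge0 _ _)) (powRM _ (powR_ge0 _ _) kV).
have -> : (A `^ p^-1) `^ p = A by rewrite -powRrM mulVf ?lt0r_neq0// powRr1// ltW.
have -> : ((n%:R / 2) `^ q^-1) `^ p = (n%:R / 2) `^ (p / q) by rewrite -powRrM (mulrC q^-1).
have kp0 : 0 < (64 * k) `^ p by exact: powR_gt0.
have -> : (64 * k)^-1 `^ p = ((64 * k) `^ p)^-1.
  by rewrite -powR_inv1 ?(ltW k640)// -powRrM mulN1r powRN.
move=> h2; move: hn; apply/negP; rewrite -leNgt.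
have h3 : (n%:R / 2) `^ (p / q) / (64 * k) `^ p <= B * n%:R `^ be * M.
  by rewrite -(ler_pM2r A0); apply: (le_trans h2); rewrite mulrAC.
by move: h3; rewrite ler_pdivrMr// => /le_trans; apply; rewrite le_eqVlt; apply/orP; left; apply/eqP; ring.
Qed.

Lemma rint_sum (I : Type) (l : seq I) (F : I -> R -> R) : (forall i, continuous (F i)) ->
  rint 0 1 (fun t => \sum_(i <- l) F i t) = \sum_(i <- l) rint 0 1 (F i).
Proof.
move=> cF; elim: l => [|i l ih].
  rewrite big_nil -[RHS](mul0r (1 - 0)) -rint_cst//.
  by apply: eq_rint => t _; rewrite big_nil.
rewrite big_cons -ih -rintD; last 2 first.
- exact: continuous_subspaceT.
- apply: continuous_subspaceT => t; elim: (l) => [|j l' ihl].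
    by under eq_fun do rewrite big_nil; exact: cvg_cst.
  by under eq_fun do rewrite big_cons; apply: cvgD => //; exact: cF.
by apply: eq_rint => t _; rewrite big_cons.
Qed.

(** * Peak functions at the roots of unity *)

Section disjoint_peaks.
Variables (p : R) (n L : nat).
Hypotheses (p1 : 1 <= p) (n0 : (0 < n)%N).
Let p0 : 0 < p := lt_le_trans ltr01 p1.

(** The peak is at the point [e (- t)], which is why the family [gs] of peaks at the roots of unity
    is indexed with a minus sign. *)
Definition rot_peak (t : R) : {poly C} := (2^-1%:P * (1 + (e t)%:P * 'X)) ^+ L.

Lemma horner_rot_peak t (z : C) : (rot_peak t).[z] = (2^-1 * (1 + e t * z)) ^+ L.
Proof. by rewrite /rot_peak horner_exp !hornerE. Qed.

Lemma pmean_rot_peak t : pmean p (horner (rot_peak t)) 1 = peak p L.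
Proof.
have -> : peak p L = pmean p (horner (peak_poly L)) (nc (e t)) by rewrite nc_unit.
rewrite -(rot_mean _ _ p0) pmeanE; apply: eq_rint => x _; rewrite horner_rot_peak horner_peak_poly /cpt add0r mul1r.
by rewrite (mulrC (e t)).
Qed.

Let gs := [seq rot_peak (- (j%:R / n%:R)) | j <- iota 0 n].
(** The size of a peak function at distance [1 / (2 n)] from its peak, half the spacing of the roots
    of unity. *)
Let tau : R := cos (pi * (2 * n%:R)^-1) ^+ L.

Lemma inv_double_le : 0 < (2 * n%:R : R)^-1 <= 2^-1.
Proof.
have nr0 : 0 < n%:R :> R by rewrite ltr0n.
by rewrite invr_gt0 mulr_gt0//= lef_pV2 ?posrE// ?mulr_gt0// ler_peMr// ler1n.
Qed.

Lemma tau_ge0 : 0 <= tau.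
Proof.
apply: exprn_ge0; apply: cos_pi_ge0.
by have /andP[eta0 eta2] := inv_double_le; rewrite ger0_norm ?(ltW eta0).
Qed.

(** Two roots of unity both within [1 / (2 n)] of the same point would be at distance less than
    [1 / n] modulo 1, so at most one peak function exceeds [tau] there. If none does, [j0 = 0]
    serves. *)
Lemma one_peak t : exists2 j0, (j0 < n)%N & forall j, (j < n)%N -> j != j0 ->
  nc (rot_peak (- (j%:R / n%:R))).[e t] <= tau.
Proof.
have nr0 : 0 < n%:R :> R by rewrite ltr0n.
have /andP[eta0 eta2] := inv_double_le.
pose close j := exists2 y : R, e y = e (- (j%:R / n%:R) + t) & `|y| < (2 * n%:R)^-1.
have far j : ~ close j -> nc (rot_peak (- (j%:R / n%:R))).[e t] <= tau.
  move=> nj; rewrite horner_rot_peak ncX -unitD /tau.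
  rewrite lerXn2r ?nnegrE ?nc_ge0//.
    by apply: cos_pi_ge0; rewrite ger0_norm ?(ltW eta0).
  apply: nc_half1_far; first exact: ltW.
  by move=> y ey; rewrite leNgt; apply/negP => yl; apply: nj; exists y.
have [[j0 j0n [y0 ey0 y0l]]|none] := pselect (exists2 j0, (j0 < n)%N & close j0); last first.
  by exists 0%N => // j jn _; apply: far => jc; apply: none; exists j.
exists j0 => // j jn jj0; apply: far => -[y ey yl].
have h1 : e (y - y0 + (j%:R / n%:R - j0%:R / n%:R)) = 1.
  have -> : y - y0 + (j%:R / n%:R - j0%:R / n%:R) = y + (j%:R / n%:R) - (y0 + j0%:R / n%:R) by ring.
  have E1 : e (y + j%:R / n%:R) = e t by rewrite unitD ey -unitD addrAC addNr add0r.
  have E2 : e (y0 + j0%:R / n%:R) = e t by rewrite unitD ey0 -unitD addrAC addNr add0r.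
  apply: (mulIf (unit_neq0 (y0 + j0%:R / n%:R))).
  by rewrite -unitD subrK mul1r E1 E2.
have d1 : `|y - y0| < n%:R^-1.
  apply: le_lt_trans (ler_normB _ _) _.
  have -> : n%:R^-1 = (2 * n%:R)^-1 + (2 * n%:R)^-1 :> R by field; rewrite lt0r_neq0.
  exact: ltrD.
(* Indices below [n] differ by at most [n - 1], so the sum to which [unit_eq1] is applied stays
   below 1 in modulus and no wrapping around the circle can occur. *)
have dj : `|j%:R / n%:R - j0%:R / n%:R| <= 1 - n%:R^-1 :> R.
  rewrite -mulrBl normrM (gtr0_norm (_ : 0 < n%:R^-1)) ?invr_gt0//.
  rewrite ler_pdivrMr// mulrBl mul1r mulVf ?lt0r_neq0//.
  have jn1 : j%:R + 1 <= n%:R :> R by rewrite natr1 ler_nat.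
  have j0n1 : j0%:R + 1 <= n%:R :> R by rewrite natr1 ler_nat.
  by have := ler0n R j; have := ler0n R j0; rewrite ler_norml => *; apply/andP; split; lra.
have /eqP : y - y0 + (j%:R / n%:R - j0%:R / n%:R) = 0.
  apply: unit_eq1 h1; apply: le_lt_trans (ler_normD _ _) _.
  by rewrite -[ltRHS](subrK (n%:R^-1)) addrC; apply: ler_ltD.
rewrite addr_eq0 => /eqP yy.
have : n%:R^-1 <= `|j%:R / n%:R - j0%:R / n%:R| :> R.
  rewrite -mulrBl normrM (gtr0_norm (_ : 0 < n%:R^-1)) ?invr_gt0//.
  rewrite ler_peMl ?invr_ge0//.
  move: jj0; rewrite neq_ltn => /orP[] jlt.
    rewrite distrC ger0_norm; last by rewrite subr_ge0 ler_nat ltnW.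
    by rewrite lerBrDr addrC natr1 ler_nat.
  rewrite ger0_norm; last by rewrite subr_ge0 ler_nat ltnW.
  by rewrite lerBrDr addrC natr1 ler_nat.
by rewrite -normrN -yy leNgt d1.
Qed.

(** On the circle the monomial factors are unimodular, and all terms but one are at most [tau]. The
    index of the exceptional term varies with [t], so its [p]-th power is replaced by the sum over
    all terms, which can be integrated. *)
Lemma lacunary_peaks_le xs t : unzip2 xs = gs ->
  nc (lacunary xs).[e t] `^ p <=
  2 `^ p * (\sum_(g <- gs) nc g.[e t] `^ p + (n%:R * tau) `^ p).
Proof.
move=> xs2; have tau0 := tau_ge0.
have nt0 : 0 <= n%:R * tau by rewrite mulr_ge0.
have [j0 j0n hj] := one_peak t.
pose f j := nc (rot_peak (- (j%:R / n%:R))).[e t].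
have f0 j : 0 <= f j by exact: nc_ge0.
have h1 : nc (lacunary xs).[e t] <= f j0 + n%:R * tau.
  rewrite /lacunary horner_sum; apply: le_trans (nc_sum _ _) _.
  have -> : \sum_(x <- xs) nc ('X^(2 ^ x.1.+1) * x.2).[e t] = \sum_(j <- iota 0 n) f j.
    transitivity (\sum_(g <- unzip2 xs) nc g.[e t]); last by rewrite xs2 /gs big_map.
    rewrite /unzip2 big_map; apply: eq_bigr => x _.
    by rewrite hornerM hornerXn ncM ncX nc_unit expr1n mul1r.
  rewrite (bigD1_seq j0) ?mem_iota ?iota_uniq//=; apply: lerD => //.
  apply: (@le_trans _ _ (\sum_(j <- iota 0 n) tau)); last first.
    by rewrite big_const_seq count_predT size_iota iter_addr_0 mulr_natl.
  rewrite big_mkcond big_seq [leRHS]big_seq; apply: ler_sum => j; rewrite mem_iota/= add0n => jn.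
  by case: ifP => // jj0; exact: hj.
apply: le_trans (le_powR (ltW p0) (nc_ge0 _) h1) _.
apply: le_trans (powR_split_max (ltW p0) (f0 j0) nt0) _.
apply: ler_wpM2l; first exact: powR_ge0.
rewrite lerD2r /gs big_map (bigD1_seq j0) ?mem_iota ?iota_uniq//= lerDl.
by apply: sumr_ge0 => j _; exact: powR_ge0.
Qed.

(** The assumption on [tau] says that the [n] small terms together weigh no more than one peak
    integral. The exponent 1 of [n] is the [be] of the general frame. *)
Lemma pmean_lacunary_peaks xs : unzip2 xs = gs -> tau `^ p <= (n%:R `^ p)^-1 * peak p L ->
  pmean p (horner (lacunary xs)) 1 <= 2 `^ p * 2 * n%:R `^ 1 * peak p L.
Proof.
move=> xs2 ht; have np0 : 0 < n%:R `^ p :> R by rewrite powR_gt0// ltr0n.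
pose G t := \sum_(g <- gs) nc g.[cpt 0 1 t] `^ p.
have cg g : continuous (fun t => nc g.[cpt 0 1 t] `^ p) by exact: continuous_poly_cpt.
have cG : continuous G.
  move=> t; rewrite /G; elim: (gs) => [|g l ih].
    by under eq_fun do rewrite big_nil; exact: cvg_cst.
  by under eq_fun do rewrite big_cons; apply: cvgD => //; exact: cg.
have cs : {within `[(0 : R), 1], continuous (fun t => G t + (n%:R * tau) `^ p)}.
  by apply: continuous_subspaceT => t; apply: cvgD; [exact: cG|exact: cvg_cst].
have A0 := peak_gt0 L p0.
have IG : rint 0 1 G = n%:R * peak p L.
  rewrite /G rint_sum// /gs big_map.
  rewrite (eq_bigr (fun=> peak p L)); last first.
    by move=> j _; rewrite -(pmean_rot_peak (- (j%:R / n%:R))) pmeanE.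
  by rewrite big_const_seq count_predT size_iota iter_addr_0 mulr_natl.
apply: (@le_trans _ _ (rint 0 1 (fun t => 2 `^ p * (G t + (n%:R * tau) `^ p)))).
  rewrite pmeanE; apply: le_rint.
  - by apply: continuous_subspaceT; exact: cg.
  - by move=> t; apply: cvgM; [exact: cvg_cst|exact: cs].
  move=> t _; have := lacunary_peaks_le t xs2.
  by rewrite /G; have -> : cpt 0 1 t = e t by rewrite /cpt add0r mul1r.
rewrite rintZ// rintD; last 2 first.
- exact: continuous_subspaceT.
- exact/continuous_subspaceT/cst_continuous.
rewrite IG rint_cst// subr0 mulr1 powRr1// -!mulrA ler_pM2l ?powR_gt0//.
have tau0 := tau_ge0.
have : (n%:R * tau) `^ p <= peak p L.
  rewrite powRM//; apply: (le_trans (ler_wpM2l (ltW np0) ht)).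
  by rewrite mulrA divff ?mul1r// lt0r_neq0.
have : peak p L <= n%:R * peak p L by rewrite ler_peMl ?ler1n// ltW.
lra.
Qed.

End disjoint_peaks.

Lemma no_reverse_carleson_peaks p q m (mu : {finite_measure set (R * R)%type -> \bar R}) :
  1 <= p -> 0 < q -> q < p -> (0 < m)%N -> ~ reverse_carleson 0 p q%:E m mu.
Proof.
move=> p1 q0 qp m0; have p0 : 0 < p := lt_le_trans ltr01 p1.
have B0 : 0 <= 2 `^ p * 2 :> R by rewrite mulr_ge0 ?powR_ge0.
have pq : 1 < p / q by rewrite ltr_pdivlMr// mul1r.
apply: (no_reverse_carleson_lacunary p1 q0 m0 B0 pq) => n n0.
have d0 : 0 < (n%:R `^ p)^-1 :> R by rewrite invr_gt0 powR_gt0// ltr0n.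
(* The sharpness [L] is chosen after the number [n] of peaks, whose spacing determines the distance
   [1 / (2 n)]. *)
have [L hL] := peak_far p0 (inv_double_le n0) d0.
exists [seq rot_peak L (- (j%:R / n%:R)) | j <- iota 0 n], (peak p L); split.
- by rewrite size_map size_iota.
- exact: peak_gt0.
- by move=> g /mapP[j _ ->]; exact: pmean_rot_peak.
- by move=> xs xs2 _; apply: (pmean_lacunary_peaks p1 n0 xs2); exact: hL.
Qed.

(** * Orthogonality of monomials and sums of distinct powers *)

Lemma rint_Re_unitX d : (0 < d)%N -> rint 0 1 (fun t => Re (e t ^+ d)) = 0.
Proof.
move=> d0.
have hd (z : C) : nc (z - 0) < 2 -> cdiffable (horner 'X^d) z.
  by move=> _; eexists; exact: cdiff_horner.
have h12 : 0 < (1 : R) < 2 by rewrite ltr01/= ltr1n.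
have := mean_value hd h12; rewrite hornerXn expr0n; case: d d0 {hd} => // d _ h.
by rewrite -[RHS]h; apply: eq_rint => t _; rewrite hornerXn /cpt add0r mul1r.
Qed.

(** The real inner product of the plane, that is the real part of [a] times the conjugate of [b]; it
    keeps Parseval's identity within real integrals. *)
Definition cdot (a b : C) : R := Re a * Re b + Im a * Im b.

Lemma nc_sqrD a b : nc (a + b) ^+ 2 = nc a ^+ 2 + nc b ^+ 2 + 2 * cdot a b.
Proof. by rewrite !nc_sqr cReD cImD /cdot; ring. Qed.

Lemma cdot_sum (I : Type) (a : C) (l : seq I) (F : I -> C) :
  cdot a (\sum_(i <- l) F i) = \sum_(i <- l) cdot a (F i).
Proof.
elim: l => [|i l ih]; first by rewrite !big_nil /cdot /= !mulr0 addr0.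
by rewrite !big_cons -ih /cdot cReD cImD; ring.
Qed.

Lemma cdotC a b : cdot a b = cdot b a.
Proof. by rewrite /cdot; ring. Qed.

Lemma cdot_unitX t N d : cdot (e t ^+ N) (e t ^+ (N + d)) = Re (e t ^+ d).
Proof.
have h : Re (e t ^+ N) ^+ 2 + Im (e t ^+ N) ^+ 2 = 1.
  by rewrite -nc_sqr ncX nc_unit !expr1n.
rewrite exprD /cdot cReM cImM.
transitivity ((Re (e t ^+ N) ^+ 2 + Im (e t ^+ N) ^+ 2) * Re (e t ^+ d)); first by ring.
by rewrite h mul1r.
Qed.

Lemma continuous_cdot_unitX N N' : continuous (fun t => cdot (e t ^+ N) (e t ^+ N')).
Proof.
have aux a d : continuous (fun t => cdot (e t ^+ a) (e t ^+ (a + d))).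
  have -> : (fun t => cdot (e t ^+ a) (e t ^+ (a + d))) = (fun t => Re (horner 'X^d (cpt 0 1 t))).
    by apply/funext => t; rewrite cdot_unitX hornerXn /cpt add0r mul1r.
  by apply: continuous_Re_cpt => t; exact: clim_horner.
have [h|h] := leP N N'; first by rewrite -(subnKC h); exact: aux.
have -> : (fun t => cdot (e t ^+ N) (e t ^+ N')) = (fun t => cdot (e t ^+ N') (e t ^+ N)).
  by apply/funext => t; rewrite cdotC.
by rewrite -(subnKC (ltnW h)); exact: aux.
Qed.

Lemma rint_cdot_unitX N N' : N != N' -> rint 0 1 (fun t => cdot (e t ^+ N) (e t ^+ N')) = 0.
Proof.
wlog h : N N' / (N < N')%N.
  move=> H; rewrite neq_ltn => /orP[h|h]; first by apply: H => //; rewrite ltn_eqF.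
  transitivity (rint 0 1 (fun t => cdot (e t ^+ N') (e t ^+ N))).
    by apply: eq_rint => t _; rewrite cdotC.
  by apply: H => //; rewrite ltn_eqF.
move=> _; rewrite -(subnKC (ltnW h)).
transitivity (rint 0 1 (fun t => Re (e t ^+ (N' - N)))); last by apply: rint_Re_unitX; rewrite subn_gt0.
by apply: eq_rint => t _; rewrite cdot_unitX.
Qed.

(** Adding a new power expands the square into 1, the previous square and cross terms, which have
    mean 0 since the exponents are distinct. *)
Lemma parseval_units (Ns : seq nat) : uniq Ns ->
  rint 0 1 (fun t => nc (\sum_(N <- Ns) e t ^+ N) ^+ 2) = (size Ns)%:R.
Proof.
have csum (l : seq nat) : continuous (fun t => nc (\sum_(N <- l) e t ^+ N) ^+ 2).
  move=> t; rewrite (_ : (fun t => _) = (fun t => nc (horner (\sum_(N <- l) 'X^N) (cpt 0 1 t)) ^+ 2)).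
    apply: cvgM; apply: (@continuous_nc_cpt _ (horner (\sum_(N <- l) 'X^N))) => x; exact: clim_horner.
  apply/funext => x; rewrite horner_sum; congr (nc _ ^+ 2).
  by apply: eq_bigr => N _; rewrite hornerXn /cpt add0r mul1r.
elim: Ns => [_|N Ns ih /=/andP[NNs uNs]].
  rewrite -[RHS](mul0r (1 - 0)) -rint_cst//.
  by apply: eq_rint => t _; rewrite big_nil nc0 expr0n.
pose S t := \sum_(M <- Ns) cdot (e t ^+ N) (e t ^+ M).
have cS : continuous S.
  move=> t; rewrite /S; elim: (Ns) => [|M l ihl].
    by under eq_fun do rewrite big_nil; exact: cvg_cst.
  by under eq_fun do rewrite big_cons; apply: cvgD => //; exact: continuous_cdot_unitX.
have S0 : rint 0 1 S = 0.
  rewrite /S rint_sum; last by move=> M; exact: continuous_cdot_unitX.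
  rewrite big_seq big1// => M MN; apply: rint_cdot_unitX.
  by apply: contraNneq NNs => ->.
transitivity (rint 0 1 (fun t => (1 + nc (\sum_(M <- Ns) e t ^+ M) ^+ 2) + 2 * S t)).
  apply: eq_rint => t _; rewrite big_cons nc_sqrD cdot_sum.
  by rewrite ncX nc_unit !expr1n.
have w (h : R -> R) : continuous h -> {within `[(0 : R), 1], continuous h}.
  exact: continuous_subspaceT.
rewrite rintD; last 2 first.
- by apply: w => t; apply: cvgD; [exact: cvg_cst|exact: csum].
- by apply: w => t; apply: cvgM; [exact: cvg_cst|exact: cS].
rewrite rintZ; last exact: w.
rewrite S0 mulr0 addr0 rintD; last 2 first.
- by apply: w; exact: cst_continuous.
- by apply: w; exact: csum.
by rewrite rint_cst// subr0 mulr1 ih// -[RHS]natr1 addrC.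
Qed.

(** Jensen's inequality with exponent [2 / p] bounds the mean of the [p]-th power by the power
    [p / 2] of the mean square, which is [n] by Parseval. Thus [be = p / 2], and [q < 2] makes it
    smaller than [p / q]. *)
Lemma no_reverse_carleson_lacunary_ones p q m (mu : {finite_measure set (R * R)%type -> \bar R}) :
  1 <= p -> p < 2 -> 0 < q -> q < 2 -> (0 < m)%N -> ~ reverse_carleson 0 p q%:E m mu.
Proof.
move=> p1 p2 q0 q2 m0; have p0 : 0 < p := lt_le_trans ltr01 p1.
have pq : p / 2 < p / q by rewrite ltr_pM2l// ltf_pV2 ?posrE.
apply: (no_reverse_carleson_lacunary p1 q0 m0 ler01 pq) => n n0.
exists (nseq n 1), 1; split.
- by rewrite size_nseq.
- exact: ltr01.
- by move=> g; rewrite mem_nseq => /andP[_ /eqP ->]; exact: pmean_one.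
move=> xs xs2 xs1; rewrite mul1r mulr1.
pose Ns := [seq (2 ^ K.+1)%N | K <- unzip1 xs].
have uNs : uniq Ns by rewrite map_inj_uniq// => a b /eqP; rewrite eqn_exp2l// eqSS => /eqP.
have sNs : size Ns = n by rewrite !size_map -(size_map snd) -/(unzip2 xs) xs2 size_nseq.
have lacE t : (lacunary xs).[cpt 0 1 t] = \sum_(N <- Ns) e t ^+ N.
  rewrite /lacunary horner_sum /Ns !big_map big_seq [RHS]big_seq; apply: eq_bigr => x xin.
  have : x.2 \in nseq n (1 : {poly C}) by rewrite -xs2 map_f.
  rewrite mem_nseq => /andP[_ /eqP ->].
  by rewrite hornerM hornerC mulr1 hornerXn /cpt add0r mul1r.
have := parseval_units uNs; rewrite sNs => pv.
have th1 : 1 <= 2 / p by rewrite ler_pdivlMr// mul1r ltW.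
have cu : {within `[(0 : R), 1], continuous (fun t => nc (lacunary xs).[cpt 0 1 t] `^ p)}.
  by apply: continuous_subspaceT; exact: continuous_poly_cpt.
have E t : (nc (lacunary xs).[cpt 0 1 t] `^ p) `^ (2 / p) = nc (\sum_(N <- Ns) e t ^+ N) ^+ 2.
  by rewrite -powRrM mulrCA divff ?lt0r_neq0// mulr1 powR_mulrn ?nc_ge0// lacE.
have cu2 : {within `[(0 : R), 1], continuous (fun t => (nc (lacunary xs).[cpt 0 1 t] `^ p) `^ (2 / p))}.
  have -> : (fun t => (nc (lacunary xs).[cpt 0 1 t] `^ p) `^ (2 / p)) = (fun t => nc (lacunary xs).[cpt 0 1 t] `^ 2).
    by apply/funext => t; rewrite -powRrM mulrCA divff ?lt0r_neq0// mulr1.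
  by apply: continuous_subspaceT; exact: continuous_poly_cpt.
have := rint_jensen th1 (fun t => powR_ge0 _ _) cu cu2.
have -> : rint 0 1 (fun t => (nc (lacunary xs).[cpt 0 1 t] `^ p) `^ (2 / p)) = n%:R.
  by rewrite -pv; apply: eq_rint => t _; exact: E.
have p20 : 0 <= p / 2 by rewrite divr_ge0// ltW.
move=> /(le_powR p20 (powR_ge0 _ _)); rewrite -powRrM.
have -> : 2 / p * (p / 2) = 1 by field; rewrite lt0r_neq0.
by rewrite powRr1 ?pmeanE//; apply: rint_ge0 => t _; exact: powR_ge0.
Qed.

End small_exponents.

Theorem theorem6p1 (R : realType) (s p : R) (q : \bar R) :
  0 <= s -> 1 <= p -> (0%:E < q)%E ->
  (* (1) *)
  (0 < s -> forall m : nat, s < m%:R ->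
     forall mu : {finite_measure set (R * R)%type -> \bar R},
       on_closed_disc mu -> ~ reverse_carleson s p q m mu) /\
  (* (2) *)
  (2 <= p -> (p%:E <= q)%E -> forall m : nat, (0 < m)%N ->
     forall mu : {finite_measure set (R * R)%type -> \bar R},
       on_closed_disc mu -> (reverse_carleson 0 p q m mu <-> arc_condition mu)) /\
  (* (3) *)
  (2 <= p -> (q < p%:E)%E -> forall m : nat, (0 < m)%N ->
     forall mu : {finite_measure set (R * R)%type -> \bar R},
       on_closed_disc mu -> ~ reverse_carleson 0 p q m mu) /\
  (* (4) *)
  (p < 2 -> (2%:E <= q)%E -> forall m : nat, (0 < m)%N ->
     forall mu : {finite_measure set (R * R)%type -> \bar R},
       on_closed_disc mu -> (reverse_carleson 0 p q m mu <-> arc_condition mu)) /\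
  (* (5) *)
  (p < 2 -> (q < 2%:E)%E -> forall m : nat, (0 < m)%N ->
     forall mu : {finite_measure set (R * R)%type -> \bar R},
       on_closed_disc mu -> ~ reverse_carleson 0 p q m mu).
Proof.
move=> _ p1 q0.
have necessity m (mu : {finite_measure set (R * R)%type -> \bar R}) :
    (0 < m)%N -> reverse_carleson 0 p q m mu -> arc_condition mu.
  by move=> m0 [k [k0 rc]]; exact: reverse_carleson_arcs p1 q0 m0 k0 rc.
split; [|split; [|split; [|split]]].
- by move=> s0 m sm mu _; exact: no_reverse_carleson_smooth.
- move=> p2 pq m m0 mu _; split; first exact: necessity.
  by apply: arc_condition_reverse_carleson => //; rewrite /Qexp max_l.
(* The upper bound on [q] rules out [+oo] and positivity rules out [-oo], so [q] is a real number
   here. *)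
- move=> _ qp m m0 mu _; case: q q0 qp {necessity} => // q; rewrite !lte_fin => q0 qp.
  exact: no_reverse_carleson_peaks.
- move=> p2 pq m m0 mu _; split; first exact: necessity.
  by apply: arc_condition_reverse_carleson => //; rewrite /Qexp max_r// ltW.
- move=> p2 q2 m m0 mu _; case: q q0 q2 {necessity} => // q; rewrite !lte_fin => q0 q2.
  exact: no_reverse_carleson_lacunary_ones.
Qed.
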